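(* Let $n\ge 1$ be an integer and $q=2^n$. Define \[X_{1,n}=\tfrac{1}{6227020800}(q-2)(q-3)(q-4)(q-5)(q-6)(q-7)(q-8)(q-9)(q-10)(q-11),\] \[X_{2,n}=\tfrac{1}{46080}(q-2)(q-4)(q-6)(q-8)(q-10),\qquad X'_n = X_{1,n}-X_{2,n}+\tfrac{1}{1152}(q-2)(q-4)(q-8),\] \[Y_n=-\tfrac{1}{1944}(q-1)(q-4)(q-16),\qquad W_n=\tfrac{1}{23040}q(q-2)(q-4)(q-8)(q-16),\] and define the numbers $m_{66},m_{78},m_{143},m_{429},m_{572},m_{858},m_{1716}$ (depending on $n$) as follows: - $m_{66}=1$ if $n\equiv 0\pmod 6$, and $m_{66}=0$ otherwise; - $m_{78}=1$ if $n\equiv 0\pmod{10}$, and $m_{78}=0$ otherwise; - $m_{143}=\frac{q-4}{12}$ if $n$ is even, and $m_{143}=0$ if $n$ is odd; - $m_{429}=\frac{q(q-4)(q-10)}{576}$ if $n$ is even, and $m_{429}=\frac{(q-2)(q-4)(q-8)}{576}$ if $n$ is odd; - $m_{572}=\frac{(q-1)(q-4)(q-16)}{648}$ if $n$ is even, and $m_{572}=0$ if $n$ is odd; - $m_{858}=W_n-1$ if $n\equiv 6,10,12,18,20,24,36,40,42,48,50,54\pmod{60}$; $m_{858}=W_n-2$ if $n\equiv 0,30\pmod{60}$; $m_{858}=W_n$ otherwise; - $m_{1716}=X'_n$ if $n$ is odd; $m_{1716}=X'_n+Y_n$ if $n\equiv 2,4,8,14,16,22,26,28,32,34,38,44,46,52,56,58\pmod{60}$;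 $m_{1716}=X'_n+Y_n+\frac{5}{11}$ if $n\equiv 10,20,40,50\pmod{60}$; $m_{1716}=X'_n+Y_n+\frac{6}{13}$ if $n\equiv 6,12,18,24,36,42,48,54\pmod{60}$; $m_{1716}=X'_n+Y_n+\frac{131}{143}$ if $n\equiv 0,30\pmod{60}$. Then there exists a simple $3$-$(2^n+1,13,\lambda)$ design with $\mathrm{PSL}(2,2^n)$ as an automorphism group if and only if \[\lambda=66\,i_{66}+78\,i_{78}+143\,i_{143}+429\,i_{429}+572\,i_{572}+858\,i_{858}+1716\,i_{1716}\] for some integers $i_{\mu}$ with $0\le i_\mu\le m_\mu$ for each $\mu\in\{66,78,143,429,572,858,1716\}$.
   Context: Let $\mathrm{GF}(2^n)$ be the field with $2^n$ elements and $X=\mathrm{GF}(2^n)\cup\{\infty\}$ the projective line. The group $G=\mathrm{PSL}(2,2^n)$ is the group of all maps $X\to X$, $x\mapsto\frac{ax+b}{cx+d}$ with $a,b,c,d\in\mathrm{GF}(2^n)$, $ad-bc\ne0$ (with the usual conventions for $\infty$). A simple $t$-$(v,k,\lambda)$ design is a pair $(X,\mathcal B)$ with $|X|=v$ and $\mathcal B$ a set (no repetitions) of $k$-subsets of $X$, called blocks, such that every $t$-subset of $X$ is contained in exactly $\lambda$ elements of $\mathcal B$. Here the point set is the projective line $X$, and ''with $\mathrm{PSL}(2,2^n)$ as an automorphism group'' means that every $g\in G$ maps $\mathcal B$ onto itself, i.e. $\mathcal B$ is a union of $G$-orbits of $13$-subsets of $X$. *)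

(* Defs.v *)
From HB Require Import structures.
From mathcomp Require Import all_boot all_order all_algebra all_fingroup.
From mathcomp Require Import ring.
Set Implicit Arguments.
Unset Strict Implicit.
Unset Printing Implicit Defensive.
Import Order.TTheory GRing.Theory Num.Theory.
Local Open Scope ring_scope.

Section ProjectiveLine.

Variable F : finFieldType.
Implicit Types (a b c d : F) (x : option F).

(* The projective line over F is [option F], with [None] as the point oo. *)
Definition mobius a b c d x : option F :=
  match x with
  | Some z => if c * z + d == 0 then None else Some ((a * z + b) / (c * z + d))
  | None => if c == 0 then None else Some (a / c)
  end.

(* All fractional linear maps with nonzero determinant, as in PGL(2, F); for F
   of characteristic 2 every element is a square, so this is also PSL(2, F).
   Every such map is a permutation (see mobius_perm_in_PSL2 below), so that none
   is lost by working inside {perm option F}. *)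
Definition PSL2 : {set {perm option F}} :=
  [set g : {perm option F} | [exists a, exists b, exists c, exists d,
    (a * d - b * c != 0) && [forall x, g x == mobius a b c d x]]].

Lemma PSL2P (g : {perm option F}) :
  reflect (exists a b c d, a * d - b * c != 0 /\ g =1 mobius a b c d)
          (g \in PSL2).
Proof.
rewrite inE; apply: (iffP existsP) => [[a /existsP[b /existsP[c /existsP[d]]]]|].
  by move=> /andP[nz /forallP gE]; exists a, b, c, d; split=> // x; exact/eqP.
move=> [a [b [c [d [nz gE]]]]].
exists a; apply/existsP; exists b; apply/existsP; exists c; apply/existsP.
by exists d; rewrite nz; apply/forallP=> x; rewrite gE.
Qed.

Lemma mobius1 x : mobius 1 0 0 1 x = x.
Proof.
case: x => [z|] /=; last by rewrite eqxx.
by rewrite mul0r add0r oner_eq0 mul1r addr0 divr1.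
Qed.

Lemma mobius_scale s x : s != 0 -> mobius s 0 0 s x = x.
Proof.
move=> s0; case: x => [z|] /=; last by rewrite eqxx.
by rewrite mul0r add0r (negPf s0) addr0 mulrC mulKf.
Qed.

Let frac (u v : F) : option F := if v == 0 then None else Some (u / v).

Let mobius_frac a b c d u v : (u != 0) || (v != 0) ->
  mobius a b c d (frac u v) = frac (a * u + b * v) (c * u + d * v).
Proof.
rewrite /frac; have [->|v0 _] := eqVneq v 0.
  rewrite orbF /= => u0; rewrite !mulr0 !addr0 mulf_eq0 (negPf u0) orbF.
  by case: eqVneq => // c0; congr Some; rewrite -mulf_div divff ?mulr1.
have E p q : p * u + q * v = (p * (u / v) + q) * v.
  by rewrite mulrDl -mulrA divfK.
rewrite /= !E mulf_eq0 (negPf v0) orbF; case: eqVneq => // w0.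
by rewrite -mulf_div divff ?mulr1.
Qed.

Lemma mobius_comp a b c d a' b' c' d' x : a * d - b * c != 0 ->
  mobius a' b' c' d' (mobius a b c d x) =
  mobius (a' * a + b' * c) (a' * b + b' * d)
         (c' * a + d' * c) (c' * b + d' * d) x.
Proof.
move=> nz; case: x => [z|] /=.
  rewrite -[if c * z + d == 0 then _ else _]/(frac _ _) mobius_frac.
    by rewrite /frac; do ![congr (if _ == _ then _ else Some (_ / _)) | ring].
  rewrite -negb_and; apply: contra nz => /andP[/eqP u0 /eqP v0].
  have -> : a * d - b * c = a * (c * z + d) - c * (a * z + b) by ring.
  by rewrite u0 v0 !mulr0 subr0.
rewrite -[if c == 0 then _ else _]/(frac _ _) mobius_frac // -negb_and.
by apply: contra nz => /andP[/eqP-> /eqP->]; rewrite mulr0 mul0r subr0.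
Qed.

Lemma mobius_inj a b c d : a * d - b * c != 0 -> injective (mobius a b c d).
Proof.
move=> nz; apply: (can_inj (g := mobius d (- b) (- c) a)) => x.
rewrite mobius_comp //.
have -> : d * a + - b * c = a * d - b * c by ring.
have -> : d * b + - b * d = 0 by ring.
have -> : - c * a + a * c = 0 by ring.
have -> : - c * b + a * d = a * d - b * c by ring.
exact: mobius_scale.
Qed.

Lemma mobius_perm_in_PSL2 a b c d (nz : a * d - b * c != 0) :
  perm (mobius_inj nz) \in PSL2.
Proof. by apply/PSL2P; exists a, b, c, d; split=> // x; rewrite permE. Qed.

Lemma PSL2_group_set : group_set PSL2.
Proof.
apply/group_setP; split=> [|g h /PSL2P[a [b [c [d [nz gE]]]]]].
  apply/PSL2P; exists 1, 0, 0, 1; split=> [|x]; last by rewrite perm1 mobius1.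
  by rewrite mulr1 mulr0 subr0 oner_eq0.
move=> /PSL2P[a' [b' [c' [d' [nz' hE]]]]]; apply/PSL2P.
exists (a' * a + b' * c), (a' * b + b' * d), (c' * a + d' * c), (c' * b + d' * d).
split=> [|x]; last by rewrite permM hE gE mobius_comp.
have -> : (a' * a + b' * c) * (c' * b + d' * d)
          - (a' * b + b' * d) * (c' * a + d' * c)
        = (a' * d' - b' * c') * (a * d - b * c) by ring.
by rewrite mulf_neq0.
Qed.

Canonical PSL2_group := Group PSL2_group_set.

End ProjectiveLine.

Definition simple_design (T : finType) (t v k lambda : nat)
    (B : {set {set T}}) : Prop :=
  [/\ #|T| = v,
      forall A, A \in B -> #|A| = k &
      forall S : {set T}, #|S| = t -> #|[set A in B | S \subset A]| = lambda].

Definition design_aut (T : finType) (B : {set {set T}}) : {set {perm T}} :=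
  [set g : {perm T} | [set g @: A | A : {set T} in B] == B].

(* The quantities below are rational numbers: the individual summands need not
   be integers. Numerals are written with %:R because a bare numeral in
   ring_scope is expanded to a unary natural number. *)
Section Multiplicities.

Variable n : nat.

Definition qn : rat := 2%:R ^+ n.
Local Notation q := qn.

Definition X1 : rat :=
  1 / 6227020800%:R * (q - 2%:R) * (q - 3%:R) * (q - 4%:R) * (q - 5%:R)
  * (q - 6%:R) * (q - 7%:R) * (q - 8%:R) * (q - 9%:R) * (q - 10%:R)
  * (q - 11%:R).

Definition X2 : rat :=
  1 / 46080%:R * (q - 2%:R) * (q - 4%:R) * (q - 6%:R) * (q - 8%:R)
  * (q - 10%:R).

Definition X' : rat :=
  X1 - X2 + 1 / 1152%:R * (q - 2%:R) * (q - 4%:R) * (q - 8%:R).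

Definition Y : rat := - (1 / 1944%:R) * (q - 1) * (q - 4%:R) * (q - 16%:R).

Definition W : rat :=
  1 / 23040%:R * q * (q - 2%:R) * (q - 4%:R) * (q - 8%:R) * (q - 16%:R).

Definition m66 : rat := if (n %% 6 == 0)%N then 1 else 0.

Definition m78 : rat := if (n %% 10 == 0)%N then 1 else 0.

Definition m143 : rat := if odd n then 0 else (q - 4%:R) / 12%:R.

Definition m429 : rat :=
  if odd n then (q - 2%:R) * (q - 4%:R) * (q - 8%:R) / 576%:R
  else q * (q - 4%:R) * (q - 10%:R) / 576%:R.

Definition m572 : rat :=
  if odd n then 0 else (q - 1) * (q - 4%:R) * (q - 16%:R) / 648%:R.

Definition m858 : rat :=
  if (n %% 60)%N \in [:: 6; 10; 12; 18; 20; 24; 36; 40; 42; 48; 50; 54]%N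
  then W - 1
  else if (n %% 60)%N \in [:: 0; 30]%N then W - 2%:R
  else W.

(* The last branch is the case n = 0, 30 (mod 60): the residues listed before
   it, together with 0 and 30, are exactly the even residues mod 60. *)
Definition m1716 : rat :=
  if odd n then X'
  else if (n %% 60)%N \in
      [:: 2; 4; 8; 14; 16; 22; 26; 28; 32; 34; 38; 44; 46; 52; 56; 58]%N
  then X' + Y
  else if (n %% 60)%N \in [:: 10; 20; 40; 50]%N then X' + Y + 5%:R / 11%:R
  else if (n %% 60)%N \in [:: 6; 12; 18; 24; 36; 42; 48; 54]%N
  then X' + Y + 6%:R / 13%:R
  else X' + Y + 131%:R / 143%:R.

End Multiplicities.

(* Main.v *)
Require Import Defs.
From mathcomp Require Import all_boot all_order all_algebra all_fingroup.
From mathcomp Require Import all_solvable all_field.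
From mathcomp Require Import ring zify.

(** Why the theorem is true.  Write q = 2^n, G = PSL(2, q).  The group G is sharply
3-transitive on the projective line, so a family of 13-subsets that is a union
of G-orbits always is a 3-design, and double counting the pairs (3-subset,
block) gives lambda * |G| = 1716 * (number of blocks) ([covering_count]).  An
orbit of blocks with stabiliser of order s therefore contributes 1716 / s to
lambda, and the theorem amounts to: the order s is one of 26, 22, 12, 4, 3, 2,
1, and the number of orbits with a given s is the corresponding m_(1716/s).

Stabilisers.  Let H be the stabiliser of a block B.  A nontrivial element of H
fixes 0, 1 or 2 points of B.
If some element fixes two of them, it acts on the other eleven in one cycle, and
B is equivalent to {oo, 0} together with the 11-th roots of unity.  The form
x^12 y + x y^12 that vanishes on this block is so sparse that its stabiliser can
be read off: it consists of the maps z -> a z and z -> a / z with a^11 = 1, and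
has order 22 ([two_fixpts_block11], [stab_type_block11]).
Otherwise, if some element fixes none of them, it is a 13-cycle on B.  A cyclic
element sending oo to 0 and 0 to 1 is z -> 1 / (c z + 1), and it has order 13
exactly when c is a root of an explicit sextic psi; its six roots form one orbit
of Frobenius, which makes all such blocks equivalent.  Counting the pairs
(13-cycle, starting point) in two ways and comparing with Burnside's lemma gives
|H| = 26 ([block13_conj], [stab_type_no_fixpts]).
Otherwise each nontrivial element has exactly one fixed point; then H has a common
fixed point ([common_fixpoint]), lies in an affine group AGL(1, q), and is
determined by its translations and its elements of order 3
([stab_type_one_fixpt]): the orders 1, 2, 3, 4 and 12 remain.

Counting.  The two exceptional types form a single orbit each, when they exist,
which is decided by the divisibility of q - 1 by 11 and of |G| by 13.  For the other
types, the elements, or pairs of elements, stabilising a block are counted in two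
ways: by involutions, by commuting pairs of involutions, by elements of order 3, and by
pairs of an involution and an element of order 3.  Each of these configurations
is, up to conjugation, an explicit affine one, generating a group that acts
freely away from few points, so that the blocks it stabilises are counted by a
binomial coefficient ([card_stable_sets]).  Together with the total number of
13-subsets these relations form a triangular linear system for the numbers of
orbits, whose solution is the list of the m_mu. *)

Set Implicit Arguments.
Unset Strict Implicit.
Unset Printing Implicit Defensive.
Import Order.TTheory GRing.Theory Num.Theory.
Local Open Scope group_scope.
Local Open Scope ring_scope.

(** * Homographies and sharp 3-transitivity *)

Section Homographies.

Variable F : finFieldType.
Implicit Types (a b c d u v w : F) (x y z : option F) (g h : {perm option F}).
Notation G := (PSL2_group F).

(** Deciding the determinant condition inside the definition makes every
coefficient tuple denote an element of G. *)
Definition homography a b c d : {perm option F} :=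
  if @idP (a * d - b * c != 0) is ReflectT nz then perm (mobius_inj nz) else 1%g.

Lemma homographyE a b c d : a * d - b * c != 0 ->
  homography a b c d =1 mobius a b c d.
Proof. by rewrite /homography; case: {-}_ / idP => // nz _ x; rewrite permE. Qed.

Lemma homography_in a b c d : homography a b c d \in G.
Proof.
rewrite /homography; case: {-}_ / idP => [nz|_]; last exact: group1.
exact: mobius_perm_in_PSL2.
Qed.

Lemma homographyP g : g \in G ->
  exists a b c d, a * d - b * c != 0 /\ g = homography a b c d.
Proof.
case/PSL2P=> a [b [c [d [nz gE]]]]; exists a, b, c, d; split=> //.
by apply/permP=> x; rewrite gE homographyE.
Qed.

Definition affinity a b := homography a b 0 1.

Lemma affinityE a b x : a != 0 ->
  affinity a b x = if x is Some z then Some (a * z + b) else None.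
Proof.
move=> a0; rewrite homographyE ?mulr1 ?mulr0 ?subr0 //.
by case: x => [z|] /=; rewrite ?mul0r ?add0r ?oner_eq0 ?eqxx ?divr1.
Qed.

Lemma affinity_in a b : affinity a b \in G. Proof. exact: homography_in. Qed.

Lemma affinity10 : affinity 1 0 = 1%g.
Proof.
apply/permP=> -[z|]; rewrite affinityE ?oner_eq0 // perm1 //.
by rewrite mul1r addr0.
Qed.

Lemma affinityM a b c d : a != 0 -> c != 0 ->
  (affinity a b * affinity c d)%g = affinity (c * a) (c * b + d).
Proof.
move=> a0 c0; apply/permP=> -[z|]; rewrite permM !affinityE ?mulf_neq0 //.
by congr Some; ring.
Qed.

Lemma affinity_inj a b c d : a != 0 -> c != 0 ->
  affinity a b = affinity c d -> a = c /\ b = d.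
Proof.
move=> a0 c0 E.
have := congr1 (fun g : {perm option F} => g (Some 0)) E.
rewrite !affinityE // !mulr0 !add0r => -[bd].
have := congr1 (fun g : {perm option F} => g (Some 1)) E.
by rewrite !affinityE // !mulr1 bd => -[/addIr].
Qed.

Lemma fix_infty_affine g : g \in G -> g None = None ->
  exists a b, a != 0 /\ g = affinity a b.
Proof.
case/homographyP=> a [b [c [d [nz ->]]]]; rewrite homographyE //=.
case: eqVneq => // c0 _; move: nz; rewrite c0 mulr0 subr0.
rewrite mulf_eq0 negb_or => /andP[a0 d0].
exists (a / d), (b / d); split; first by rewrite mulf_neq0 ?invr_eq0.
apply/permP=> x; rewrite affinityE ?mulf_neq0 ?invr_eq0 //.
rewrite homographyE ?mulr0 ?subr0 ?mulf_neq0 //.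
case: x => [z|] /=; last by rewrite eqxx.
by rewrite mul0r add0r (negPf d0); congr Some; field.
Qed.

Lemma three_fixed_standard g : g \in G -> g None = None ->
  g (Some 0) = Some 0 -> g (Some 1) = Some 1 -> g = 1%g.
Proof.
move=> gG /(fix_infty_affine gG)[a [b [a0 ->]]]; rewrite !affinityE //.
rewrite mulr0 add0r => -[b0]; rewrite b0 mulr1 addr0 => -[->].
exact: affinity10.
Qed.

Lemma three_transitive x y z : x != y -> y != z -> x != z ->
  exists2 g, g \in G & [/\ g None = x, g (Some 0) = y & g (Some 1) = z].
Proof.
case: x y z => [x|] [y|] [z|] //.
- rewrite !(inj_eq (@Some_inj _)) => xy yz xz.
  (* The columns (x, 1) and (y, 1) are scaled by y - z and z - x, so that their sum
  represents z. *)
  have nz : x * (y - z) * (z - x) - y * (z - x) * (y - z) != 0.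
    have -> : x * (y - z) * (z - x) - y * (z - x) * (y - z)
            = (y - z) * (z - x) * (x - y) by ring.
    by rewrite !mulf_neq0 // subr_eq0 // eq_sym.
  have st : y - z + (z - x) != 0.
    have -> : y - z + (z - x) = y - x by ring.
    by rewrite subr_eq0 eq_sym.
  have s0 : y - z != 0 by rewrite subr_eq0.
  have t0 : z - x != 0 by rewrite subr_eq0 eq_sym.
  exists (homography (x * (y - z)) (y * (z - x)) (y - z) (z - x)).
    exact: homography_in.
  rewrite !homographyE //=; split.
  + by rewrite (negPf s0) mulfK.
  + by rewrite !mulr0 !add0r (negPf t0) mulfK.
  + by rewrite !mulr1 (negPf st); congr Some; apply: (canLR (mulfK st)); ring.
- rewrite (inj_eq (@Some_inj _)) => xy _ _.
  have nz : x * -1 - - y * 1 != 0.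
    have -> : x * -1 - - y * 1 = y - x by ring.
    by rewrite subr_eq0 eq_sym.
  exists (homography x (- y) 1 (- 1)); first exact: homography_in.
  rewrite !homographyE //=; split; first by rewrite oner_eq0 divr1.
    by rewrite !mulr0 !add0r oppr_eq0 oner_eq0 divrNN divr1.
  by rewrite mulr1 subrr eqxx.
- rewrite (inj_eq (@Some_inj _)) => _ _ xz.
  have nz : x * 0 - (z - x) * 1 != 0.
    by rewrite mulr0 mulr1 sub0r oppr_eq0 subr_eq0 eq_sym.
  exists (homography x (z - x) 1 0); first exact: homography_in.
  rewrite !homographyE //=; split; first by rewrite oner_eq0 divr1.
    by rewrite mulr0 addr0 eqxx.
  by rewrite !mulr1 addr0 oner_eq0 divr1 addrC subrK.
rewrite (inj_eq (@Some_inj _)) => _ yz _.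
have zy : z - y != 0 by rewrite subr_eq0 eq_sym.
exists (affinity (z - y) y); first exact: homography_in.
by rewrite !affinityE // mulr0 add0r mulr1 subrK.
Qed.

(** Conjugating the three points to oo, 0 and 1 leaves only the identity: fixing oo
makes the map affine, and an affine map is determined by its values at 0 and 1. *)
Lemma three_fixed x y z g : g \in G -> x != y -> y != z -> x != z ->
  g x = x -> g y = y -> g z = z -> g = 1%g.
Proof.
move=> gG xy yz xz gx gy gz.
have [h hG [hx hy hz]] := three_transitive xy yz xz.
have E : (g ^ h^-1)%g = 1%g.
  apply: three_fixed_standard; first by rewrite groupJ ?groupV.
  - by rewrite conjgE invgK !permM hx gx -hx permK.
  - by rewrite conjgE invgK !permM hy gy -hy permK.
  - by rewrite conjgE invgK !permM hz gz -hz permK.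
by apply: (@conjg_inj _ h^-1%g); rewrite E conj1g.
Qed.

Lemma eq_on_three x y z g h : g \in G -> h \in G ->
  x != y -> y != z -> x != z -> g x = h x -> g y = h y -> g z = h z -> g = h.
Proof.
move=> gG hG xy yz xz ex ey ez; apply/eqP; rewrite eq_mulgV1; apply/eqP.
apply: (@three_fixed x y z) => //; first by rewrite groupM ?groupV.
- by rewrite permM ex permK.
- by rewrite permM ey permK.
- by rewrite permM ez permK.
Qed.

Lemma two_transitive x y : x != y ->
  exists2 g, g \in G & g x = None /\ g y = Some 0.
Proof.
move=> xy.
have [z [xz yz]] : exists z, x != z /\ y != z.
  case: x y xy => [x|] [y|] // => xy.
  - by exists None.
  - by exists (Some (x + 1)); rewrite (inj_eq (@Some_inj _)) -subr_eq0 opprD addNKr oppr_eq0 oner_eq0.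
  by exists (Some (y + 1)); rewrite (inj_eq (@Some_inj _)) -subr_eq0 opprD addNKr oppr_eq0 oner_eq0.
have [g gG [gx gy _]] := three_transitive xy yz xz.
by exists g^-1%g; rewrite ?groupV // -gx -gy !permK.
Qed.

Lemma point_transitive x : exists2 g, g \in G & g x = None.
Proof.
have [y xy] : exists y, x != y by case: x => [x|]; [exists None | exists (Some 0)].
by have [g gG [gx _]] := two_transitive xy; exists g.
Qed.

Lemma card_PSL2 : #|G| = (#|F|.+1 * (#|F| * #|F|.-1))%N.
Proof.
rewrite -(card_orbit_stab 'P G None); congr (_ * _)%N.
  rewrite -card_option -cardsT; apply: eq_card => x; rewrite inE.
  have [g gG gx] := point_transitive x.
  by apply/orbitP; exists g^-1%g; rewrite ?groupV //= apermE -gx permK.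
have -> : 'C_G[None | 'P] =
  [set affinity p.2 p.1 | p in setX [set: F] [set~ 0]].
  apply/setP=> g; apply/setIP/imsetP => [[gG /astab1P/= gN]|[[b a] + ->]].
    have [a [b [a0 ->]]] := fix_infty_affine gG gN.
    by exists (b, a); rewrite // !inE.
  rewrite in_setX in_setC1 => /andP[_ a0]; split; first exact: affinity_in.
  by apply/astab1P; rewrite /= apermE affinityE.
rewrite card_in_imset; last first.
  move=> [b a] [d c]; rewrite !inE /= => a0 c0.
  by case/(affinity_inj a0 c0) => -> ->.
by rewrite cardsX cardsT cardsC1.
Qed.

End Homographies.
Arguments homography {F} (a b c d)%_ring_scope.
Arguments affinity {F} (a b)%_ring_scope.

(** * Fixed points of permutations and of homographies *)

Section FreeActions.
Variable T : finType.
Implicit Types (g k : {perm T}) (K : {group {perm T}}) (B S : {set T}).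

Lemma acts_on_stable K S : (forall k, k \in K -> k @: S = S) -> [acts K, on S | 'P].
Proof.
move=> KS; apply/actsP=> k kK x /=; rewrite apermE -{1}(KS k kK) mem_imset //.
exact: perm_inj.
Qed.

Lemma mem_stable g S x : g @: S = S -> (g x \in S) = (x \in S).
Proof. by move=> gS; rewrite -{1}gS mem_imset //; apply: perm_inj. Qed.

Lemma stable_expg g S i : g @: S = S -> (g ^+ i)%g @: S = S.
Proof.
move=> gS; elim: i => [|i IHi].
  by rewrite expg0 -[RHS]imset_id; apply: eq_imset => x; rewrite perm1.
rewrite expgS -[RHS]IHi -[in RHS]gS -imset_comp; apply: eq_imset => x.
by rewrite permM.
Qed.

Lemma stable_cycle g S k : g @: S = S -> k \in <[g]>%g -> k @: S = S.
Proof. by move=> gS /cycleP[i ->]; apply: stable_expg. Qed.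

Definition fixpts g S := [set x in S | g x == x].

Lemma fixptsE g S : 'Fix_(S | 'P)[g] = fixpts g S.
Proof. by apply/setP=> x; rewrite in_setI [RHS]inE; congr andb; apply/afix1P/eqP. Qed.

Lemma sum_fixpts K S : (forall k, k \in K -> k @: S = S) ->
  (\sum_(k in K) #|fixpts k S| = #|orbit 'P K @: S| * #|K|)%N.
Proof.
move=> /acts_on_stable/Frobenius_Cauchy <-.
by apply: eq_bigr => k _; rewrite fixptsE.
Qed.

Lemma fixpts1 S : fixpts 1%g S = S.
Proof. by apply/setP=> x; rewrite inE perm1 eqxx andbT. Qed.

(** Burnside's lemma with only the identity contributing. *)
Lemma card_free_dvd K S : (forall k, k \in K -> k @: S = S) ->
  (forall k x, k \in K -> k != 1%g -> x \in S -> k x != x) -> (#|K| %| #|S|)%N.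
Proof.
move=> KS Kfree; apply/dvdnP; exists #|orbit 'P K @: S|.
rewrite -(sum_fixpts KS) (bigD1 1%g) //= fixpts1 big1 ?addn0 // => k /andP[kK k1].
apply/eqP; rewrite cards_eq0; apply/eqP/setP=> x; rewrite !inE.
by apply/negbTE; rewrite negb_and; case: (boolP (x \in S)) => //= xS; apply: Kfree.
Qed.

Lemma card_fixpts_mod p g S : prime p -> #[g]%g = p -> g @: S = S ->
  #|S| = #|fixpts g S| %[mod p].
Proof.
move=> pp og gS; rewrite -fixptsE -afix_cycle.
apply: pgroup_fix_mod; first by rewrite /pgroup -orderE og pnat_id.
by apply: acts_on_stable => k; apply: stable_cycle.
Qed.

Lemma fixpts_expg g S i : fixpts g S \subset fixpts (g ^+ i)%g S.
Proof.
apply/subsetP=> x; rewrite !inE => /andP[-> /eqP gx] /=.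
by elim: i => [|i /eqP IHi]; rewrite ?expg0 ?perm1 // expgS permM gx IHi.
Qed.
End FreeActions.

Section Elements.

Variables (F : finFieldType) (n : nat).
Hypothesis hn : (0 < n)%N.
Hypothesis hF : #|F| = (2 ^ n)%N.
Implicit Types (a b c d u v w : F) (x y z : option F) (g h k : {perm option F}).
Notation G := (PSL2_group F).

Lemma char2 : 2%:R = 0 :> F.
Proof. by have := card_finPcharP hF isT; rewrite inE => /andP[_ /eqP]. Qed.

Lemma addff (a : F) : a + a = 0.
Proof. by rewrite -mulr2n -mulr_natl char2 mul0r. Qed.

(** Reduces the integer coefficients that occur in polynomial identities mod 2. *)
Lemma natF (m : nat) : m%:R = (odd m)%:R :> F.
Proof. by rewrite -{1}(odd_double_half m) natrD -mul2n natrM char2 mul0r addr0. Qed.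

Lemma oppF (a : F) : - a = a.
Proof. by apply/eqP; rewrite eq_sym -addr_eq0 addff. Qed.

Lemma odd_card_line : odd #|{: option F}|.
Proof. by rewrite card_option hF /= oddX orbF -lt0n. Qed.

Lemma card_fixpts_le2 g B : g \in G -> g != 1%g -> (#|fixpts g B| <= 2)%N.
Proof.
move=> gG; apply: contraR; rewrite -ltnNge => /card_gt2P[x [y [z [[]]]]].
rewrite !inE => /andP[_ /eqP gx] /andP[_ /eqP gy] /andP[_ /eqP gz] [xy yz zx].
by apply/eqP; apply: (three_fixed gG xy yz _ gx gy gz); rewrite eq_sym.
Qed.

(** Recovers a from the map z -> a z + b. *)
Definition slope g : F :=
  match g (Some 1), g (Some 0) with Some u, Some v => u - v | _, _ => 0 end.

Lemma slope_affinity a b : a != 0 -> slope (affinity a b) = a.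
Proof. by move=> a0; rewrite /slope !affinityE // mulr0 mulr1 add0r addrK. Qed.

Lemma affinity_sq b : (affinity 1 b * affinity 1 b)%g = 1%g :> {perm option F}.
Proof. by rewrite affinityM ?oner_eq0 // !mul1r addff affinity10. Qed.

(** After moving p to oo, the stabiliser of p becomes the group of maps
z -> a z + b, and mu reads off a.  Its kernel consists of translations, which have
exponent 2 in characteristic 2; the elements outside the kernel fix b / (1 - a) too. *)
Lemma multiplier p : exists mu : {perm option F} -> F,
  [/\ forall g, g \in G -> g p = p -> mu g != 0,
      forall g h, g \in G -> h \in G -> g p = p -> h p = p ->
         mu (g * h)%g = mu g * mu h,
      forall g, g \in G -> g p = p -> mu g = 1 -> (g * g)%g = 1%g
    & forall g, g \in G -> g p = p -> mu g != 1 -> exists2 p', p' != p & g p' = p'].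
Proof.
have [k kG kp] := point_transitive p; exists (fun g => slope (g ^ k)%g).
have affJ g : g \in G -> g p = p ->
    exists a b, a != 0 /\ (g ^ k)%g = affinity a b.
  move=> gG gp; apply: fix_infty_affine; first by rewrite groupJ.
  by rewrite -kp permJ gp.
split.
- by move=> g gG gp; have [a [b [a0 ->]]] := affJ g gG gp; rewrite slope_affinity.
- move=> g h gG hG gp hp; rewrite conjMg.
  have [a [b [a0 ->]]] := affJ g gG gp; have [c [d [c0 ->]]] := affJ h hG hp.
  by rewrite affinityM // !slope_affinity ?mulf_neq0 // mulrC.
- move=> g gG gp; have [a [b [a0 E]]] := affJ g gG gp.
  rewrite E slope_affinity // => a1; apply: (@conjg_inj _ k).
  by rewrite conjMg E a1 conj1g affinity_sq.
move=> g gG gp; have [a [b [a0 E]]] := affJ g gG gp.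
rewrite E slope_affinity // => a1.
exists (k^-1%g (Some (b / (1 - a)))).
  by rewrite -(inj_eq (@perm_inj _ k)) permKV kp.
apply: (@perm_inj _ k); rewrite -permJ permKV E affinityE //; congr Some.
by field; rewrite subr_eq0 eq_sym.
Qed.

Lemma order2P g : #[g]%g = 2%N <-> g != 1%g /\ (g * g)%g = 1%g.
Proof.
split=> [o|[g1 gg]].
  by rewrite -order_gt1 o; have := expg_order g; rewrite o expgS expg1.
by apply/prime_nt_dvdP; rewrite ?order_eq1 // order_dvdn expgS expg1 gg.
Qed.

(** The projective line has the odd number q + 1 of points. *)
Lemma involution_fix g : g \in G -> #[g]%g = 2%N -> exists p, g p = p.
Proof.
move=> gG og.
have gT : g @: [set: option F] = setT.
  apply/setP=> x; rewrite !inE; apply/imsetP.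
  by exists (g^-1%g x); rewrite ?inE ?permKV.
have := card_fixpts_mod (isT : prime 2) og gT.
rewrite cardsT modn2 odd_card_line; case: (posnP #|fixpts g setT|) => [->//|].
by case/card_gt0P=> p; rewrite inE => /andP[_ /eqP]; exists p.
Qed.

(** A fixed point p, a moved point x and its image determine the involution, so
sending oo, 0, 1 to p, x, g x conjugates z -> z + 1 to g. *)
Lemma involution_conj g : g \in G -> #[g]%g = 2%N ->
  exists2 k, k \in G & g = (affinity 1 1 ^ k)%g.
Proof.
move=> gG og; have [p gp] := involution_fix gG og.
have [g1 gg] := (order2P g).1 og.
have [x gx] : exists x, g x != x.
  apply/existsP; apply: contraR g1; rewrite negb_exists => /forallP E.
  by apply/eqP/permP=> x; rewrite perm1; apply/eqP; rewrite -[_ == _]negbK E.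
have px : p != x by apply: contraNneq gx => <-; rewrite gp.
have pgx : p != g x by rewrite -gp (inj_eq perm_inj).
have ggx : g (g x) = x by rewrite -permM gg perm1.
have xgx : x != g x by rewrite eq_sym.
have [k kG [kp k0 k1]] := three_transitive px xgx pgx.
exists k => //; apply: (eq_on_three gG _ px xgx pgx).
- by rewrite groupJ // affinity_in.
- by rewrite -kp permJ affinityE ?oner_eq0 // kp gp.
- by rewrite -k0 permJ affinityE ?oner_eq0 // mul1r add0r k1 k0.
- by rewrite ggx -k1 permJ affinityE ?oner_eq0 // mul1r addff k0.
Qed.

Lemma two_fixpts_conj g p p' : g \in G -> p != p' -> g p = p -> g p' = p' ->
  exists k a, [/\ k \in G, a != 0, k None = p, k (Some 0) = p' & g = (affinity a 0 ^ k)%g].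
Proof.
move=> gG pp gp gp'; have [k kG [kp kp']] := two_transitive pp.
have [||a [b [a0 E]]] := @fix_infty_affine _ (g ^ k)%g; first by rewrite groupJ.
  by rewrite -kp permJ gp.
exists k^-1%g, a; rewrite groupV -kp -kp' !permK; split=> //.
apply: (@conjg_inj _ k); rewrite conjgKV E; congr affinity.
have := congr1 (fun s : {perm option F} => s (Some 0)) E.
by rewrite affinityE // mulr0 add0r -kp' permJ gp' kp' => -[].
Qed.

Lemma fixpts_conj g k (B : {set option F}) : #|fixpts (g ^ k)%g (k @: B)| = #|fixpts g B|.
Proof.
rewrite -[RHS](card_imset _ (@perm_inj _ k)); apply: eq_card => x.
apply/idP/imsetP => [|[y]]; rewrite inE.
  case/andP=> /imsetP[y yB ->]; rewrite permJ (inj_eq perm_inj) => gy.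
  by exists y => //; rewrite inE yB.
by case/andP=> yB /eqP gy ->; rewrite inE mem_imset ?yB ?permJ ?gy ?eqxx //; exact: perm_inj.
Qed.

End Elements.

(** * Groups all of whose elements fix one point; block stabilisers *)

(** By Burnside's lemma, the sum over the orbits O of K on S of |K| - |O| is
|K| - 1.  A non-regular orbit contributes at least |K| / 2, so (unless K is trivial)
there is exactly one of them, and it contributes |K| - 1: it is a point. *)
Lemma common_fixpoint (T : finType) (K : {group {perm T}}) (S : {set T}) :
  (forall k, k \in K -> k @: S = S) -> S != set0 ->
  (forall k, k \in K -> k != 1%g -> #|fixpts k S| = 1%N) ->
  exists2 p, p \in S & forall k, k \in K -> k p = p.
Proof.
move=> KS S0 K1; have actK := acts_on_stable KS.
pose Orb := orbit 'P K @: S.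
have leK O : O \in Orb -> (#|O| <= #|K|)%N.
  by case/imsetP=> x _ ->; apply: dvdn_leq; rewrite ?cardG_gt0 // dvdn_orbit.
have sumOrb : (\sum_(O in Orb) (#|K| - #|O|) = #|K| - 1)%N.
  have sumK := sum_fixpts KS.
  rewrite (bigD1 1%g) //= fixpts1 in sumK.
  have E : (\sum_(k in K | k != 1%g) #|fixpts k S| = #|K| - 1)%N.
    rewrite (eq_bigr (fun => 1%N)) => [|k /andP[]]; last exact: K1.
    by rewrite sum1_card [#|K|](cardD1 1%g) group1 addKn; apply: eq_card => k; rewrite !inE andbC.
  rewrite sumnB // sum_nat_const -sumK E (acts_sum_card_orbit actK).
  by rewrite addnC addnK.
suff [O OOrb O1] : exists2 O, O \in Orb & #|O| = 1%N.
  case/imsetP: OOrb O1 => p pS -> /eqP/cards1P[y E].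
  have /set1P py : p \in [set y] by rewrite -E orbit_refl.
  exists p => // k kK; have : k p \in [set y].
    by rewrite -E; have := mem_orbit 'P p kK; rewrite /= apermE.
  by move/set1P; rewrite -py.
case: (posnP (#|K| - 1)) => [K_1|K_gt1].
  case/set0Pn: S0 => x xS; exists (orbit 'P K x); first exact: imset_f.
  apply/eqP; rewrite eqn_leq; apply/andP; split; last first.
    by rewrite card_gt0; apply/set0Pn; exists x; apply: orbit_refl.
  by apply: leq_trans (leK _ (imset_f _ xS)) _; lia.
have half O : O \in Orb -> (#|O| < #|K|)%N -> (#|O|.*2 <= #|K|)%N.
  case/imsetP=> x _ -> ltK; have /dvdnP[m Em] := dvdn_orbit 'P K x.
  rewrite Em -mul2n leq_mul2r; rewrite Em in ltK; move: ltK {Em}.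
  by move: #|orbit 'P K x| => o; case: m => [|[|m]]; lia.
have [O OOrb ltO] : exists2 O, O \in Orb & (#|O| < #|K|)%N.
  apply/exists_inP; apply: contraTT K_gt1 => /exists_inPn nO.
  rewrite -sumOrb big1 // => O OO; apply/eqP; rewrite subn_eq0 leqNgt.
  exact: nO.
exists O => //; apply/eqP; rewrite eqn_leq; apply/andP; split; last first.
  case/imsetP: OOrb => x _ ->.
  by rewrite card_gt0; apply/set0Pn; exists x; apply: orbit_refl.
rewrite leqNgt; apply/negP=> O_gt1.
move: sumOrb; rewrite (bigD1 O) //= => sumOrb.
have [O' /andP[O'Orb neqO] ltO'] : exists2 O', (O' \in Orb) && (O' != O) & (#|O'| < #|K|)%N.
  apply/exists_inP; apply: contraTT O_gt1 => /exists_inPn nO.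
  move: sumOrb; rewrite big1 ?addn0 => [|O' OO'].
    by move: ltO {nO} => /=; move: #|O| #|K| => o c; lia.
  by apply/eqP; rewrite subn_eq0 leqNgt; apply: nO.
move: sumOrb; rewrite (bigD1 O') /=; last by rewrite O'Orb.
have := half _ OOrb ltO; have := half _ O'Orb ltO'; move: ltO ltO' K_gt1 O_gt1 => /=.
set s := (X in (_ + (_ + X))%N); move: s #|O| #|O'| #|K| => s o o' c; lia.
Qed.

Lemma card_offdiag (T : finType) (A : {set T}) :
  #|[set p in setX A A | p.1 != p.2]| = (#|A| * #|A|.-1)%N.
Proof.
pose D := [set (x, x) | x in A].
have -> : [set p in setX A A | p.1 != p.2] = setX A A :\: D.
  apply/setP=> -[x y]; rewrite !inE /=.
  case: eqVneq => [<-|xy]; rewrite ?andbT ?andbF.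
    by case: (boolP (x \in A)) => xA; rewrite ?andbF // (imset_f (fun x => (x,x)) xA).
  case: imsetP => // -[z zA [e1 e2]]; by rewrite e1 e2 eqxx in xy.
have sD : D \subset setX A A.
  by apply/subsetP=> _ /imsetP[x xA ->]; rewrite !inE /= xA.
rewrite cardsD (setIidPr sD) cardsX card_imset => [|x y []//].
by case: #|A| => // m; rewrite mulnS addKn mulnC.
Qed.

Section Stabilisers.

Variables (F : finFieldType) (n : nat).
Hypothesis hn : (0 < n)%N.
Hypothesis hF : #|F| = (2 ^ n)%N.
Implicit Types (a b c d : F) (x y z p : option F) (g h k : {perm option F}).
Implicit Types B : {set option F}.
Notation G := (PSL2_group F).

Fact stab_key : unit. Proof. exact: tt. Qed.

(** Sealed, so that rewriting with membership in explicitly described sets does not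
unfold it into the definition of the group. *)
Definition stab B : {group {perm option F}} :=
  locked_with stab_key 'C_G[B | 'P^*]%G.

Lemma stabE B : stab B = 'C_G[B | 'P^*]%G.
Proof. by rewrite /stab unlock. Qed.

Lemma stabP B g : reflect (g \in G /\ g @: B = B) (g \in stab B).
Proof.
have E : ('P^*)%act B g = g @: B by apply: eq_imset => x; rewrite /= apermE.
by rewrite stabE; apply: (iffP setIP) => -[gG]; [move/astab1P | move=> gB; split=> //; apply/astab1P]; rewrite E.
Qed.

Lemma stab_in B g : g \in stab B -> g \in G. Proof. by case/stabP. Qed.

Lemma stab_im B g : g \in stab B -> g @: B = B. Proof. by case/stabP. Qed.

Definition invols B := [set g in stab B | #[g]%g == 2%N].
Definition order3s B := [set g in stab B | #[g]%g == 3%N].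
(** Ordered pairs; they detect the Klein four-subgroups. *)
Definition comm_invols B :=
  [set p in setX (invols B) (invols B) | (p.1 != p.2) && (p.1 * p.2 == p.2 * p.1)%g].

Definition stab_type B s t u v :=
  [/\ #|stab B| = s, #|invols B| = t, #|order3s B| = u & #|comm_invols B| = v].

Lemma perm_order3 g : #[g]%g = 3%N -> g != 1%g /\ (g ^+ 3 = 1)%g.
Proof. by move=> o; rewrite -order_gt1 o; have := expg_order g; rewrite o. Qed.

Section OneFixedPoint.

Variable B : {set option F}.
Hypothesis cardB : #|B| = 13%N.
Hypothesis fix1 : forall g, g \in stab B -> g != 1%g -> #|fixpts g B| = 1%N.

(** All nontrivial powers of g fix exactly the points p in B and p' outside B, so
the order of g divides both |B| - 1 = 12 and q - 1, which is odd. *)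
Lemma order3_of_two_fixpts g p p' : g \in stab B -> g != 1%g -> p \in B -> p != p' ->
  g p = p -> g p' = p' -> #[g]%g = 3%N.
Proof.
move=> gH g1 pB pp gp gp'.
have gG := stab_in gH.
have p'B : p' \notin B.
  apply: contraT; rewrite negbK => p'B; have := fix1 gH g1.
  move/eqP/cards1P=> [x E].
  have : p \in fixpts g B by rewrite inE pB gp eqxx.
  have : p' \in fixpts g B by rewrite inE p'B gp' eqxx.
  by rewrite E !inE => /eqP e1 /eqP e2; rewrite e1 e2 eqxx in pp.
have cyc k : k \in <[g]>%g -> [/\ k \in stab B, k p = p & k p' = p'].
  case/cycleP=> i ->; rewrite groupX //; split=> //.
    by elim: i => [|i IHi]; rewrite ?expg0 ?perm1 // expgS permM gp IHi.
  by elim: i => [|i IHi]; rewrite ?expg0 ?perm1 // expgS permM gp' IHi.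
have free k x : k \in <[g]>%g -> k != 1%g -> x != p -> x != p' -> k x != x.
  move=> /cyc[kH kp kp'] k1 xp xp'; apply: contraNneq k1 => kx; apply/eqP.
  by apply: (three_fixed (stab_in kH) xp pp xp').
have d12 : (#[g]%g %| 12)%N.
  have -> : 12%N = #|B :\ p| by have := cardsD1 p B; rewrite cardB pB => -[].
  apply: card_free_dvd => [k kg|k x kg k1]; last first.
    by case/setD1P=> xp xB; apply: free => //; apply: contraNneq p'B => <-.
  have [kH kp _] := cyc k kg.
  apply/eqP; rewrite eqEcard (card_imset _ (@perm_inj _ k)) leqnn andbT.
  apply/subsetP=> _ /imsetP[x /setD1P[xp xB] ->]; apply/setD1P; split.
    by rewrite -kp (inj_eq perm_inj).
  by rewrite (mem_stable _ (stab_im kH)).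
have dodd : (#[g]%g %| #|F|.-1)%N.
  have -> : #|F|.-1 = #|~: [set p; p']|.
    by rewrite cardsCs setCK cards2 pp card_option subSS subn1.
  apply: card_free_dvd => [k kg|k x kg k1]; last first.
    by rewrite !inE negb_or => /andP[xp xp']; apply: free.
  have [kH kp kp'] := cyc k kg.
  apply/eqP; rewrite eqEcard (card_imset _ (@perm_inj _ k)) leqnn andbT.
  apply/subsetP=> _ /imsetP[x + ->]; rewrite !inE !negb_or => /andP[xp xp'].
  by apply/andP; split; [rewrite -kp | rewrite -kp']; rewrite (inj_eq perm_inj).
have o_odd : odd #[g]%g.
  apply: dvdn_odd dodd _; rewrite hF -subn1 oddB ?expn_gt0 // oddX orbF.
  by case: n hn.
have : #[g]%g != 1%N by rewrite order_eq1.
have : (#[g]%g <= 12)%N by apply: dvdn_leq.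
by move: d12 o_odd; move: #[g]%g => m; do 13?[case: m => [|m] //].
Qed.
End OneFixedPoint.
End Stabilisers.

(** * Stabilisers inside the affine group *)

Section OneFixedPointTypes.

Variables (F : finFieldType) (n : nat).
Hypothesis hn : (0 < n)%N.
Hypothesis hF : #|F| = (2 ^ n)%N.
Implicit Types (a b c d : F) (x y z p : option F) (g h k : {perm option F}).
Implicit Types B : {set option F}.
Notation G := (PSL2_group F).

(** Let T be the set of elements of multiplier 1 at the common fixed point p.  Its
elements have exponent 2, the others have order 3 and multiplier w or w^2 for a
primitive cube root of unity w, hence |H| is |T| or 3|T|; and |H| divides 12
because H acts freely on the other points of B.  In the second case |T| = 2 is
excluded, since the unique involution would commute with an element of order 3,
and their product, of multiplier w, would have order 6. *)
Lemma stab_type_one_fixpt B : #|B| = 13%N ->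
  (forall g, g \in stab B -> g != 1%g -> #|fixpts g B| = 1%N) ->
  [\/ stab_type B 1 0 0 0, stab_type B 2 1 0 0, stab_type B 4 3 0 6
    | stab_type B 3 0 2 0 \/ stab_type B 12 3 8 6].
Proof.
move=> cardB fix1; set H := stab B.
have [p pB pfix] : exists2 p, p \in B & forall g, g \in H -> g p = p.
  apply: common_fixpoint => //; first by move=> g /stab_im.
  by rewrite -card_gt0 cardB.
have [mu [mu_nz muM mu1 mu_fix]] := multiplier hF p.
have HG g : g \in H -> g \in G by exact: stab_in.
have muMH g h : g \in H -> h \in H -> mu (g * h)%g = mu g * mu h.
  by move=> gH hH; apply: muM; auto.
have mu_1 : mu 1%g = 1.
  have nz := mu_nz _ (HG _ (group1 H)) (perm1 p).
  by apply: (mulfI nz); rewrite -muMH ?group1 // mulg1 mulr1.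
have dvd12 : (#|H| %| 12)%N.
  have -> : 12%N = #|B :\ p| by have := cardsD1 p B; rewrite cardB pB => -[].
  apply: card_free_dvd => [k kH|k x kH k1].
    apply/eqP; rewrite eqEcard (card_imset _ (@perm_inj _ k)) leqnn andbT.
    apply/subsetP=> _ /imsetP[x /setD1P[xp xB] ->]; apply/setD1P; split.
      by rewrite -(pfix k kH) (inj_eq perm_inj).
    by rewrite (mem_stable _ (stab_im kH)).
  case/setD1P=> xp xB; apply: contraNneq xp => kx.
  have /eqP/cards1P[y E] := fix1 k kH k1.
  have : x \in fixpts k B by rewrite inE xB kx eqxx.
  have : p \in fixpts k B by rewrite inE pB pfix ?eqxx.
  by rewrite E !inE => /eqP -> ->.
pose T := [set g in H | mu g == 1].
have T_sq g : g \in T -> (g * g = 1)%g.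
  by rewrite inE => /andP[gH /eqP]; apply: mu1; auto.
have U3 g : g \in H -> g \notin T -> #[g]%g = 3%N.
  move=> gH; rewrite inE gH /= => mug.
  have [p' pp' gp'] := mu_fix g (HG _ gH) (pfix _ gH) mug.
  apply: (order3_of_two_fixpts hn hF cardB fix1 gH _ pB _ (pfix _ gH) gp').
    by apply: contraNneq mug => ->; rewrite mu_1.
  by rewrite eq_sym.
have T1 : 1%g \in T by rewrite inE group1 mu_1 eqxx.
have TM g h : g \in T -> h \in T -> (g * h)%g \in T.
  rewrite !inE => /andP[gH /eqP mg] /andP[hH /eqP mh].
  by rewrite groupM // muMH // mg mh mulr1 eqxx.
have TC g h : g \in T -> h \in T -> (g * h = h * g)%g.
  have inv k : k \in T -> k^-1%g = k.
    by move=> kT; apply/eqP; rewrite eq_invg_mul T_sq.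
  by move=> gT hT; rewrite -(inv _ (TM _ _ gT hT)) invMg !inv.
have invE : invols B = T :\ 1%g.
  apply/setP=> g; rewrite in_setD1 inE -/H; apply/andP/andP=> [[gH /eqP o]|[g1 gT]].
    have [g1 gg] := (order2P g).1 o; split=> //.
    by apply: contraT => gT; have := U3 _ gH gT; rewrite o.
  split; first by move: gT; rewrite inE => /andP[].
  by apply/eqP/order2P; rewrite T_sq.
have ordE : order3s B = H :\: T.
  apply/setP=> g; rewrite in_setD inE -/H andbC; case: (boolP (g \in H)) => gH; last by rewrite !andbF.
  rewrite !andbT; apply/eqP/idP=> [o|]; last exact: U3.
  apply: contraL (isT : true) => gT; have := T_sq g gT.
  have [g1 g3] := perm_order3 o; move=> gg.
  by move: g3; rewrite expgS expg2 gg mulg1 => g1'; rewrite g1' eqxx in g1.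
have sTH : T \subset H by apply/subsetP=> g; rewrite inE => /andP[].
have cardI : #|invols B| = #|T|.-1 by rewrite invE [#|T|](cardsD1 1%g) T1.
have cardO : #|order3s B| = (#|H| - #|T|)%N by rewrite ordE cardsD (setIidPr sTH).
have cardC : #|comm_invols B| = (#|T|.-1 * #|T|.-2)%N.
  rewrite -cardI -card_offdiag; apply: eq_card => -[g h]; rewrite !inE /=.
  case: (boolP (g \in H)) => //= gH; case: eqP => //= og; case: (boolP (h \in H)) => //= hH.
  case: eqP => //= oh; case: eqVneq => //= gh.
  have gT : g \in T :\ 1%g by rewrite -invE inE gH og.
  have hT : h \in T :\ 1%g by rewrite -invE inE hH oh.
  by move: gT hT => /setD1P[_ gT] /setD1P[_ hT]; rewrite TC // eqxx.
rewrite /stab_type -/H cardI cardO cardC.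
have [U0|] := eqVneq (H :\: T) set0.
  have TH : #|T| = #|H|.
    by apply: eq_card => g; move/setP: U0 => /(_ g); rewrite !inE; case: (g \in H); rewrite ?andbF // andbT => /negbFE.
  have n3 : ~~ (3 %| #|H|)%N.
    apply/negP=> /(Cauchy (isT : prime 3))[g gH o].
    have : g \in H :\: T by rewrite -ordE inE -/H gH o.
    by rewrite U0 inE.
  have : (#|H| <= 12)%N by apply: dvdn_leq.
  rewrite TH; move: dvd12 n3; move: #|H| => m; rewrite subnn.
  do 13?[case: m => [|m] //] => _ _ _.
  - by constructor 1.
  - by constructor 2.
  - by constructor 3.
case/set0Pn=> h0; rewrite in_setD => /andP[h0T h0H].
have h03 := U3 _ h0H h0T; have [_ h0_cube] := perm_order3 h03.
pose w := mu h0.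
have w_nz : w != 0 by apply: mu_nz; auto.
have w1 : w != 1 by move: h0T; rewrite inE h0H.
have w3 : w ^+ 3 = 1.
  by rewrite -mu_1 -h0_cube !expgS mulg1 !muMH ?groupM // mulrA.
have ww : w ^+ 2 + w + 1 = 0.
  have : (w - 1) * (w ^+ 2 + w + 1) = w ^+ 3 - 1 by ring.
  by rewrite w3 subrr => /eqP; rewrite mulf_eq0 subr_eq0 (negPf w1) => /eqP.
have coset k : k \in H -> [set g in H | mu g == mu k] = T :* k.
  move=> kH; apply/setP=> g; rewrite inE; apply/andP/rcosetP=> [[gH /eqP mg]|[t]].
    exists (g * k^-1)%g; last by rewrite mulgKV.
    rewrite inE groupM ?groupV //=; apply/eqP.
    have k_nz : mu k != 0 by apply: mu_nz; auto.
    by apply: (mulIf k_nz); rewrite -muMH ?groupM ?groupV // mulgKV mul1r.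
  by rewrite inE => /andP[tH /eqP mt] ->; rewrite groupM // muMH // mt mul1r.
have cardH : #|H| = (3 * #|T|)%N.
  have w2w : w ^+ 2 != w by rewrite expr2 -subr_eq0 -{3}[w]mulr1 -mulrBr mulf_neq0 // subr_eq0.
  have w21 : w ^+ 2 != 1.
    by apply: contraNneq w1 => E; rewrite -w3 exprS E mulr1.
  have mu2 : mu (h0 * h0)%g = w ^+ 2 by rewrite muMH.
  have -> : #|H| = (#|T| + (#|T :* h0| + #|T :* (h0 * h0)|))%N.
    rewrite -!coset ?groupM // mu2 -/w -(cardsID T H) (setIidPr sTH).
    rewrite -(cardsID [set g in H | mu g == w] (H :\: T)); congr (_ + (_ + _))%N.
      apply: eq_card => g; rewrite !inE; case: (g \in H); rewrite ?andbF //= !andbT.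
      by case: (mu g =P w) => [->|]; rewrite ?andbF ?w1.
    apply: eq_card => g; rewrite !inE; case: (boolP (g \in H)); rewrite ?andbF //= => gH.
    (* mu g is a cube root of unity. *)
    have gz : (mu g - 1) * (mu g - w) * (mu g - w ^+ 2) = 0.
      have g3 : mu g ^+ 3 = 1.
        have [->|mg1] := eqVneq (mu g) 1; first by rewrite expr1n.
        have gT : g \notin T by rewrite inE gH.
        have [_ gc] := perm_order3 (U3 _ gH gT).
        by rewrite -mu_1 -gc !expgS mulg1 !muMH ?groupM // mulrA.
      have -> : (mu g - 1) * (mu g - w) * (mu g - w ^+ 2) = mu g ^+ 3 - w ^+ 3
         - (w ^+ 2 + w + 1) * (mu g ^+ 2 - w * mu g) by ring.
      by rewrite g3 w3 ww mul0r subrr subr0.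
    rewrite ?andbT; apply/andP/eqP=> [[n1 n2]|->]; last by rewrite w21 w2w.
    move/eqP: gz; rewrite !mulf_eq0 !subr_eq0 (negPf n2).
    by rewrite (negPf n1) => /eqP.
  by rewrite !card_rcoset mulSn mul2n addnn.
have nT2 : #|T| != 2%N.
  apply/negP=> T2; have : #|T :\ 1%g| == 1%N.
    by move: T2; rewrite (cardsD1 1%g) T1.
  case/cards1P=> t Et; have tT1 : t \in T :\ 1%g by rewrite Et inE.
  have [t1 tT] := setD1P tT1.
  have tH := subsetP sTH _ tT.
  have tJ : (t ^ h0)%g = t.
    have : (t ^ h0)%g \in T :\ 1%g.
      rewrite in_setD1 conjg_eq1 t1 inE groupJ // conjgE !muMH ?groupM ?groupV //.
      move: tT; rewrite inE => /andP[_ /eqP ->]; rewrite mul1r.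
      by rewrite -muMH ?groupV // mulVg mu_1 eqxx.
    by rewrite Et inE => /eqP.
  have comm : commute h0 t by apply: commute_sym; apply/commgP/conjg_fixP.
  have htT : (h0 * t)%g \notin T.
    rewrite inE groupM //= muMH //; move: tT; rewrite inE => /andP[_ /eqP ->].
    by rewrite mulr1.
  have [_] := perm_order3 (U3 _ (groupM h0H tH) htT).
  rewrite expgMn // h0_cube mul1g expgS expg2 T_sq // mulg1 => tt.
  by rewrite tt eqxx in t1.
have d4 : (#|T| %| 4)%N by rewrite -(@dvdn_pmul2l 3) // -cardH.
have : (#|T| <= 4)%N by apply: dvdn_leq.
rewrite cardH; move: d4 nT2; move: #|T| => m; do 5?[case: m => [|m] //] => _ _ _.
- by constructor 4; left.
- by constructor 4; right.
Qed.
End OneFixedPointTypes.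

(** * Blocks with an 11-cycle *)

Section ElevenCycles.

Variables (F : finFieldType) (n : nat).
Hypothesis hn : (0 < n)%N.
Hypothesis hF : #|F| = (2 ^ n)%N.
Implicit Types (a b c d z : F) (x y p : option F) (g h k : {perm option F}).
Implicit Types B : {set option F}.
Notation G := (PSL2_group F).
Let char2 := char2 hF.
Let addff := addff hF.
Let oppF := oppF hF.
Let c3 : 3%:R = 1 :> F := natF hF 3.
Let c4 : 4%:R = 0 :> F := natF hF 4.
Let c6 : 6%:R = 0 :> F := natF hF 6.

Lemma pow4D a b : (a + b) ^+ 4 = a ^+ 4 + b ^+ 4.
Proof. by ring: char2 c4 c6. Qed.

Lemma pow12D a b : (a + b) ^+ 12 = a ^+ 12 + a ^+ 8 * b ^+ 4 + a ^+ 4 * b ^+ 8 + b ^+ 12.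
Proof. by rewrite (exprM _ 4 3) pow4D; ring: char2 c3. Qed.

(** Two distinct commuting involutions generate a group of order 4. *)
Lemma comm_invols0 B : ~~ (4 %| #|stab B|)%N -> #|comm_invols B| = 0%N.
Proof.
apply: contraNeq; rewrite -lt0n => /card_gt0P[[g h]].
rewrite !inE /= => /andP[/andP[/andP[gH /eqP og] /andP[hH /eqP oh]] /andP[gh /eqP cgh]].
have nsub : ~~ (<[g]> \subset <[h]>)%g.
  rewrite cycle_subG /= (cycle2g oh) !inE negb_or (negPf gh) andbT.
  by rewrite -order_gt1 og.
have TI : (<[g]> :&: <[h]> = 1)%g by apply: prime_TIg nsub; rewrite -orderE og.
have cards : #|(<[g]> * <[h]>)%g| = 4%N by rewrite TI_cardMg // -!orderE og oh.
have sub : (<[g]> <*> <[h]> \subset stab B)%g by rewrite join_subG !cycle_subG gH.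
rewrite -cards -cent_joinEr ?cardSg //.
by rewrite cycle_subG /= cent_cycle; apply/cent1P; apply: commute_sym.
Qed.

Lemma prime_root_exists (p : nat) : prime p -> (p %| #|F|.-1)%N ->
  exists a, p.-primitive_root a.
Proof.
move=> pp pd; have pd' : (p %| #|[set: {unit F}]%G|)%N by rewrite card_finField_unit.
have [u _ ou] := Cauchy pp pd'; exists (FinRing.uval u).
have [|m mprim mp] := @prim_order_exists _ p (FinRing.uval u) (prime_gt0 pp).
  by rewrite -FinRing.val_unitX -ou expg_order.
suff <- : m = p by [].
apply/prime_nt_dvdP => //; apply: contraTneq (prime_gt1 pp) => m1.
move: mprim; rewrite m1 => /prim_expr_order; rewrite expr1 => u1.
by rewrite -ou order_gt1 negbK; apply/eqP/val_inj.
Qed.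

Lemma prime_prim_root (p : nat) a : prime p -> a ^+ p = 1 -> a != 1 -> p.-primitive_root a.
Proof.
move=> pp ap a1; have [m mprim mp] := prim_order_exists (prime_gt0 pp) ap.
suff <- : m = p by [].
apply/prime_nt_dvdP => //; apply: contraNneq a1 => m1.
by move: mprim; rewrite m1 => /prim_expr_order; rewrite expr1 => ->.
Qed.

Lemma prim_root_dvd (m : nat) a : m.-primitive_root a -> (m %| #|F|.-1)%N.
Proof.
move=> am; rewrite (prim_order_dvd am); apply/eqP.
have a0 : a != 0.
  apply/eqP=> a0; have := prim_expr_order am; rewrite a0 expr0n.
  rewrite (gtn_eqF (prim_order_gt0 am)) => /eqP.
  by rewrite eq_sym oner_eq0.
apply: (mulfI a0); rewrite -exprS mulr1 prednK ?expf_card //.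
by rewrite hF expn_gt0.
Qed.

Lemma card_unity_roots (m : nat) a : m.-primitive_root a -> #|[set z : F | z ^+ m == 1]| = m.
Proof.
move=> am; have -> : [set z | z ^+ m == 1] = [set a ^+ (i : 'I_m) | i : 'I_m].
  apply/setP=> z; rewrite inE; apply/eqP/imsetP => [/(prim_rootP am)[i ->]|[i _ ->]].
    by exists i.
  by rewrite exprAC (prim_expr_order am) expr1n.
rewrite card_imset ?card_ord // => i j /eqP.
by rewrite (eq_prim_root_expr am) !modn_small // => /eqP/val_inj.
Qed.

Lemma expr12_eq (z : F) : z != 0 -> (z ^+ 12 == z) = (z ^+ 11 == 1).
Proof. by move=> z0; rewrite exprS -{3}[z]mulr1 (inj_eq (mulfI z0)). Qed.

(** As z^12 = z means z = 0 or z^11 = 1, this is {oo, 0} together with the 11-th roots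
of unity. *)
Definition block11 : {set option F} := None |: [set Some z | z in [set z : F | z ^+ 12 == z]].

Lemma mem_block11 (z : F) : (Some z \in block11) = (z ^+ 12 == z).
Proof. by rewrite !inE /= mem_imset ?inE // => ? ? []. Qed.

Section Block11.
Variable a11 : F.
Hypothesis a11P : 11.-primitive_root a11.

Lemma card_roots12 : #|[set z : F | z ^+ 12 == z]| = 12%N.
Proof.
have -> : [set z : F | z ^+ 12 == z] = 0 |: [set z : F | z ^+ 11 == 1].
  apply/setP=> z; rewrite !inE; have [->|z0] := eqVneq z 0.
    by rewrite expr0n eqxx.
  by rewrite expr12_eq.
by rewrite cardsU1 (card_unity_roots a11P) inE expr0n /= eq_sym oner_eq0.
Qed.

Lemma card_block11 : #|block11| = 13%N.
Proof.
rewrite cardsU1 card_imset ?card_roots12 => [|? ? [] //].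
by case: imsetP => // -[].
Qed.

(** A map (a z + b) / (c z + d) that preserves the set of solutions of z^12 = z makes
(a z + b)^12 (c z + d) + (a z + b) (c z + d)^12 vanish there.  In characteristic 2
the 12-th powers have four terms only; reduced with z^12 = z, the expression becomes
a polynomial of degree at most 9 with twelve roots, so it is zero.  Its
coefficients in degrees 9 and 8 form a linear system of determinant a d - b c
for a^8 b^4 and c^8 d^4. *)
Lemma stab_block11_form a b c d : a * d - b * c != 0 ->
  homography a b c d \in stab block11 -> (b == 0) && (c == 0) || (a == 0) && (d == 0).
Proof.
move=> nz /stabP[_ gB].
(* Coefficients, by increasing degree, after the reductions z^12 = z and z^13 = z^2. *)
pose s := [:: b^+12*d + d^+12*b; a^+12*d + c^+12*b + b^+12*c + d^+12*a;
  a^+12*c + c^+12*a; 0; a^+4*b^+8*d + c^+4*d^+8*b; a^+4*b^+8*c + c^+4*d^+8*a; 0; 0;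
  a^+8*b^+4*d + c^+8*d^+4*b; a^+8*b^+4*c + c^+8*d^+4*a].
have sroot z : z ^+ 12 = z -> (Poly s).[z] = 0.
  move=> z12; have zB : Some z \in block11 by rewrite mem_block11 z12.
  have E : (a * z + b) ^+ 12 * (c * z + d) + (a * z + b) * (c * z + d) ^+ 12 = 0.
    move: zB; rewrite -(mem_stable _ gB) homographyE //=.
    case: eqVneq => [->|w0]; first by rewrite expr0n !mulr0 addr0.
    rewrite mem_block11 => /eqP.
    set u := a * z + b; set v := c * z + d => uv.
    rewrite expr_div_n in uv.
    have : u ^+ 12 * v = u * v ^+ 12.
      have -> : u ^+ 12 = u / v * v ^+ 12 by rewrite -uv divfK ?expf_neq0.
      by rewrite mulrAC divfK.
    by move=> ->; apply: addff.
  rewrite horner_Poly /= -[RHS]E.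
  have E1 : (a * z + b) ^+ 12 = a ^+ 12 * z + a^+8*b^+4*z^+8 + a^+4*b^+8*z^+4 + b^+12.
    by rewrite -{2}z12 pow12D; ring.
  have E2 : (c * z + d) ^+ 12 = c ^+ 12 * z + c^+8*d^+4*z^+8 + c^+4*d^+8*z^+4 + d^+12.
    by rewrite -{2}z12 pow12D; ring.
  by rewrite E1 E2; ring.
have s0 : Poly s = 0.
  apply/eqP; apply: contraT => sn0.
  have rt : all (root (Poly s)) (enum [set z : F | z ^+ 12 == z]).
    by apply/allP=> z; rewrite mem_enum inE => /eqP/sroot; rewrite /root => ->.
  have := max_poly_roots sn0 rt (enum_uniq _).
  by rewrite -cardE card_roots12 => /leq_trans/(_ (size_Poly s)).
have e9 : a^+8*b^+4*c + c^+8*d^+4*a = 0.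
  by have := congr1 (fun p : {poly F} => p`_9) s0; rewrite coef_Poly coef0.
have e8 : a^+8*b^+4*d + c^+8*d^+4*b = 0.
  by have := congr1 (fun p : {poly F} => p`_8) s0; rewrite coef_Poly coef0.
(* Cramer's rule for the two coefficients. *)
have /eqP ab : a ^+ 8 * b ^+ 4 * (a * d - b * c) = 0.
  have -> : a ^+ 8 * b ^+ 4 * (a * d - b * c) = a * (a^+8*b^+4*d + c^+8*d^+4*b)
    - b * (a^+8*b^+4*c + c^+8*d^+4*a) by ring.
  by rewrite e8 e9 !mulr0 subrr.
have /eqP cd : c ^+ 8 * d ^+ 4 * (a * d - b * c) = 0.
  have -> : c ^+ 8 * d ^+ 4 * (a * d - b * c) = d * (a^+8*b^+4*c + c^+8*d^+4*a)
    - c * (a^+8*b^+4*d + c^+8*d^+4*b) by ring.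
  by rewrite e8 e9 !mulr0 subrr.
have ab0 : (a == 0) || (b == 0).
  by move: ab; rewrite mulf_eq0 (negPf nz) orbF mulf_eq0 !expf_eq0.
have cd0 : (c == 0) || (d == 0).
  by move: cd; rewrite mulf_eq0 (negPf nz) orbF mulf_eq0 !expf_eq0.
move: ab0 cd0.
have [a0|a0] /= := eqVneq a 0.
  move: nz; rewrite a0 mul0r sub0r oppr_eq0 mulf_eq0 negb_or.
  by move=> /andP[_ /negPf ->] _ /= ->; rewrite orbT.
move=> /eqP b0; move: nz; rewrite b0 mul0r subr0 mulf_eq0 negb_or eqxx.
by move=> /andP[_ /negPf ->]; rewrite orbF => ->.
Qed.

Lemma stab_block11 g : (g \in stab block11) =
  (g \in [set affinity z 0 | z in [set z : F | z ^+ 11 == 1]]) ||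
  (g \in [set homography 0 z 1 0 | z in [set z : F | z ^+ 11 == 1]]).
Proof.
have unit11 z : z ^+ 11 = 1 -> z != 0 /\ z ^+ 12 = z.
  move=> z11; split; last by rewrite exprS z11 mulr1.
  by apply: contraPneq z11 => ->; rewrite expr0n /= => /eqP; rewrite eq_sym oner_eq0.
have stable h : h \in G -> (forall x, x \in block11 -> h x \in block11) -> h \in stab block11.
  move=> hG hB; apply/stabP; split=> //; apply/eqP.
  by rewrite eqEcard card_imset ?leqnn ?andbT; [apply/subsetP=> _ /imsetP[x /hB ? ->]|exact: perm_inj].
apply/idP/orP; last first.
  case=> /imsetP[z]; rewrite inE => /eqP/unit11[z0 z12] ->.
    apply: stable => [|[w|]]; rewrite ?affinity_in ?affinityE // !mem_block11.
    by move=> /eqP w12; rewrite addr0 exprMn z12 w12.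
  apply: stable => [|x]; rewrite ?homography_in // homographyE ?mulr0 ?mulr1 ?sub0r ?oppr_eq0 //.
  case: x => [w|] /=; last by rewrite oner_eq0 mul0r mem_block11 expr0n.
  rewrite mem_block11 mul0r mul1r addr0 add0r => /eqP w12.
  by case: eqVneq => w0; rewrite ?mem_block11 ?expr_div_n ?z12 ?w12 // setU11.
move=> gS; have [gG gB] := stabP _ _ gS.
have [a [b [c [d [nz gE]]]]] := homographyP gG.
have := stab_block11_form nz; rewrite -gE => /(_ gS) form.
have g1 : g (Some 1) \in block11 by rewrite (mem_stable _ gB) mem_block11 expr1n.
move: g1; rewrite gE homographyE //= !mulr1.
case/orP: form => /andP[/eqP e1 /eqP e2]; move: nz; rewrite e1 e2 ?mul0r ?mulr0 ?subr0 ?sub0r ?oppr_eq0.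
  rewrite mulf_eq0 negb_or => /andP[a0 d0]; rewrite add0r addr0 (negPf d0) mem_block11.
  have ad0 : a / d != 0 by rewrite mulf_neq0 ?invr_eq0.
  rewrite expr12_eq // => ad11; left.
  apply/imsetP; exists (a / d); rewrite ?inE //.
  apply/permP=> x; rewrite affinityE // homographyE ?mulr0 ?subr0 ?mulf_neq0 //.
  case: x => [z|] /=; last by rewrite eqxx.
  by rewrite mul0r add0r !addr0 (negPf d0) mulrAC.
rewrite mulf_eq0 negb_or => /andP[b0 c0]; rewrite add0r addr0 (negPf c0) mem_block11.
have ad0 : b / c != 0 by rewrite mulf_neq0 ?invr_eq0.
rewrite expr12_eq // => ad11; right.
apply/imsetP; exists (b / c); rewrite ?inE //.
apply/permP=> x; rewrite !homographyE ?mulr0 ?mul0r ?sub0r ?oppr_eq0 ?mulr1 ?mulf_neq0 ?invr_eq0 //.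
case: x => [z|] /=; rewrite ?oner_eq0 ?(negPf c0) ?mul0r //.
rewrite ?mul0r ?add0r ?addr0 mul1r mulf_eq0 (negPf c0) /=.
by case: eqVneq => // z0; rewrite invfM mulrA.
Qed.

Lemma stab_type_block11 : stab_type block11 22 11 0 0.
Proof.
pose M := [set z : F | z ^+ 11 == 1].
have cardM : #|M| = 11%N := card_unity_roots a11P.
have nz z : z \in M -> z != 0.
  by rewrite inE; apply: contraTneq => ->; rewrite expr0n /= eq_sym oner_eq0.
pose A := [set affinity z 0 | z in M]; pose I := [set homography 0 z 1 0 | z in M].
have SE : stab block11 = A :|: I :> {set _}.
  by apply/setP=> g; rewrite in_setU stab_block11.
have invE z x : z != 0 -> homography 0 z 1 0 x =
   if x is Some w then if w == 0 then None else Some (z / w) else Some 0.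
  move=> z0; rewrite homographyE ?mul0r ?sub0r ?mulr1 ?oppr_eq0 //.
  by case: x => [w|] /=; rewrite ?oner_eq0 ?mul0r // mul1r addr0 add0r.
have cardA : #|A| = 11%N.
  by rewrite card_in_imset // => z w /nz z0 /nz w0 /(affinity_inj z0 w0)[].
have cardI : #|I| = 11%N.
  rewrite card_in_imset // => z w /nz z0 /nz w0.
  move/(congr1 (fun g : {perm option F} => g (Some 1))); rewrite !invE //.
  by rewrite oner_eq0 !divr1 => -[].
have AI : A :&: I = set0.
  apply/setP=> g; rewrite in_set0; apply/negP=> /setIP[/imsetP[z /nz z0 ->] /imsetP[w /nz w0]].
  move/(congr1 (fun g : {perm option F} => g None)).
  by rewrite affinityE // invE.
have cardS : #|stab block11| = 22%N by rewrite SE cardsU cardA cardI AI cards0.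
split=> //.
- rewrite -[RHS]cardI; apply: eq_card => g; rewrite inE SE in_setU.
  apply/andP/idP=> [[/orP[|//] /imsetP[z zM ->] /eqP/order2P[z1]]|gI].
    have z0 := nz z zM; rewrite affinityM // -affinity10 => /affinity_inj[].
    + by rewrite mulf_neq0.
    + exact: oner_neq0.
    move=> zz _; case/negP: z1; move: zM; rewrite inE.
    by rewrite !exprS !mulrA zz !mul1r zz !mul1r zz !mul1r zz !mul1r zz !mul1r mulr1 => /eqP ->; rewrite affinity10.
  split; first by rewrite gI orbT.
  case/imsetP: gI => z /nz z0 ->; apply/eqP/order2P; split.
    apply/eqP=> /(congr1 (fun g : {perm option F} => g None)).
    by rewrite invE // perm1.
  apply/permP=> -[w|]; rewrite permM perm1 !invE // ?eqxx //.
  case: eqVneq => [->|w0] //; rewrite mulf_eq0 invr_eq0 (negPf z0) (negPf w0) /=.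
  by rewrite invfM invrK mulrA divff // mul1r.
- apply/eqP; rewrite cards_eq0; apply/eqP/setP=> g; rewrite !inE.
  apply/negbTE/andP=> -[gS /eqP o3]; have := order_dvdG gS.
  by rewrite o3 cardS.
by rewrite comm_invols0 // cardS.
Qed.

End Block11.

(** Normalise the two fixed points to 0 and oo and a third point of B to 1.  The
element becomes z -> a z; its nontrivial powers fix nothing else, so it has order
dividing 11, and B contains all the powers of a. *)
Lemma two_fixpts_block11 B g : #|B| = 13%N -> g \in stab B -> g != 1%g ->
  #|fixpts g B| = 2%N ->
  (exists a, 11.-primitive_root a) /\ exists2 k, k \in G & B = k @: block11.
Proof.
move=> cardB gS g1 fix2; have [gG gB] := stabP _ _ gS.
have /cards2P[p [p' [pp E]]] : #|fixpts g B| == 2%N by rewrite fix2.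
have [pB gp] : p \in B /\ g p = p.
  have : p \in fixpts g B by rewrite E !inE eqxx.
  by rewrite inE => /andP[-> /eqP].
have [p'B gp'] : p' \in B /\ g p' = p'.
  have : p' \in fixpts g B by rewrite E !inE eqxx orbT.
  by rewrite inE => /andP[-> /eqP].
have [x xB [xp xp']] : exists2 x, x \in B & x != p /\ x != p'.
  have : (0 < #|B :\: [set p; p']|)%N.
    by rewrite cardsD cardB subn_gt0 (leq_ltn_trans (subset_leq_card (subsetIr _ _))) // cards2 pp.
  by case/card_gt0P=> x; rewrite !inE negb_or => /andP[/andP[xp xp'] xB]; exists x.
have [p'x px] : p' != x /\ p != x by rewrite eq_sym xp' eq_sym xp.
have [k kG [k0 k1 k2]] := three_transitive pp p'x px.
pose B' := k^-1%g @: B.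
have kB' : k @: B' = B.
  by rewrite -imset_comp -[RHS]imset_id; apply: eq_imset => y /=; rewrite permKV.
have memB' y : (y \in B') = (k y \in B) by rewrite -kB' mem_imset //; apply: perm_inj.
have [||a [b [a0 gE]]] := @fix_infty_affine _ (g ^ k^-1)%g; first by rewrite groupJ ?groupV.
  by rewrite conjgE invgK !permM k0 gp -k0 permK.
have b0 : b = 0.
  have := congr1 (fun g : {perm option F} => g (Some 0)) gE.
  by rewrite affinityE // mulr0 add0r conjgE invgK !permM k1 gp' -k1 permK => -[].
rewrite b0 in gE.
have o11 : (#[g]%g %| 11)%N.
  have -> : 11%N = #|B :\: [set p; p']|.
    have sp : [set p; p'] \subset B by apply/subsetP=> y; rewrite !inE => /orP[]/eqP->.
    by rewrite cardsD cardB (setIidPr sp) cards2 pp.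
  have cyc h : h \in <[g]>%g -> [/\ h \in stab B, h p = p & h p' = p'].
    case/cycleP=> i ->; rewrite groupX //; split=> //.
      by elim: i => [|i IHi]; rewrite ?expg0 ?perm1 // expgS permM gp IHi.
    by elim: i => [|i IHi]; rewrite ?expg0 ?perm1 // expgS permM gp' IHi.
  apply: card_free_dvd => [h /cyc[hS hp hp']|h y /cyc[hS hp hp'] h1].
    apply/eqP; rewrite eqEcard (card_imset _ (@perm_inj _ h)) leqnn andbT.
    apply/subsetP=> _ /imsetP[y + ->]; rewrite !inE !negb_or => /andP[/andP[yp yp'] yB].
    rewrite (mem_stable _ (stab_im hS)) yB andbT.
    by apply/andP; split; [rewrite -hp | rewrite -hp']; rewrite (inj_eq perm_inj).
  rewrite !inE negb_or => /andP[/andP[yp yp'] yB]; apply: contraNneq h1 => hy; apply/eqP.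
  by apply: (three_fixed (stab_in hS) yp pp yp').
have powE i : ((g ^ k^-1) ^+ i)%g (Some 1) = Some (a ^+ i).
  rewrite gE; elim: i => [|i IHi]; first by rewrite expg0 perm1.
  by rewrite expgSr permM IHi affinityE // addr0 -exprS.
have a11 : a ^+ 11 = 1.
  have := powE 11%N; rewrite -conjXg.
  have -> : (g ^+ 11 = 1)%g by apply/eqP; rewrite -order_dvdn.
  by rewrite conj1g perm1 => -[].
have a1 : a != 1.
  apply: contraNneq g1 => a1; apply/eqP/(@conjg_inj _ k^-1%g).
  by rewrite gE a1 affinity10 conj1g.
have aP := prime_prim_root (isT : prime 11) a11 a1.
split; first by exists a.
exists k => //; suff -> : block11 = B' by rewrite kB'.
apply/eqP.
rewrite eqEcard (card_block11 aP) -(card_imset _ (@perm_inj _ k)) kB' cardB leqnn andbT.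
apply/subsetP=> -[z|]; last by rewrite memB' k0.
rewrite mem_block11; have [->|z0] := eqVneq z 0; first by rewrite memB' k1.
rewrite expr12_eq //; move=> /eqP/(prim_rootP aP)[i ->].
rewrite -powE -conjXg memB' conjgE invgK !permM permKV k2.
by rewrite (mem_stable _ (stable_expg i gB)).
Qed.

End ElevenCycles.

(** * The homographies z -> 1 / (c z + 1) *)

Section CyclicTriples.

Variables (F : finFieldType) (n : nat).
Hypothesis hn : (0 < n)%N.
Hypothesis hF : #|F| = (2 ^ n)%N.
Implicit Types (a b c d z : F) (x y p : option F) (g h k : {perm option F}).
Implicit Types B : {set option F}.
Notation G := (PSL2_group F).
Let char2 := char2 hF.
Let addff := addff hF.
Let oppF := oppF hF.
Let c3 : 3%:R = 1 :> F := natF hF 3.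
Let c4 : 4%:R = 0 :> F := natF hF 4.
Let c5 : 5%:R = 1 :> F := natF hF 5.
Let c11 : 11%:R = 1 :> F := natF hF 11.
Let c45 : 45%:R = 1 :> F := natF hF 45.
Let c84 : 84%:R = 0 :> F := natF hF 84.
Let c70 : 70%:R = 0 :> F := natF hF 70.
Let c21 : 21%:R = 1 :> F := natF hF 21.

Lemma homographyM a b c d a' b' c' d' :
  a * d - b * c != 0 -> a' * d' - b' * c' != 0 ->
  (homography a b c d * homography a' b' c' d')%g =
  homography (a' * a + b' * c) (a' * b + b' * d)
             (c' * a + d' * c) (c' * b + d' * d).
Proof.
move=> nz nz'; apply/permP=> x.
rewrite permM !homographyE ?mobius_comp //.
have -> : (a' * a + b' * c) * (c' * b + d' * d)
          - (a' * b + b' * d) * (c' * a + d' * c)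
        = (a' * d' - b' * c') * (a * d - b * c) by ring.
by rewrite mulf_neq0.
Qed.

(** The general element that sends oo to 0 and 0 to 1, for c <> 0. *)
Definition turn c := homography 0 1 c 1.

Lemma turn_nz c : c != 0 -> 0 * 1 - 1 * c != 0.
Proof. by move=> c0; rewrite mul0r mul1r sub0r oppr_eq0. Qed.

Lemma turnN c : c != 0 -> turn c None = Some 0.
Proof. by move=> c0; rewrite homographyE ?turn_nz //= (negPf c0) mul0r. Qed.

Lemma turn0 c : c != 0 -> turn c (Some 0) = Some 1.
Proof.
move=> c0; rewrite homographyE ?turn_nz //= !mulr0 !add0r oner_eq0.
by rewrite divr1.
Qed.

Lemma turnP g : g \in G -> g None = Some 0 -> g (Some 0) = Some 1 ->
  exists2 c, c != 0 & g = turn c.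
Proof.
case/homographyP=> a [b [c [d [nz ->]]]]; rewrite !homographyE //=.
case: eqVneq => // c0 [/eqP]; rewrite mulf_eq0 invr_eq0 (negPf c0) orbF => /eqP a0.
rewrite !mulr0 !add0r; case: eqVneq => // d0 [bd].
have bd' : b = d by rewrite -[b](divfK d0) bd mul1r.
exists (c / d); first by rewrite mulf_neq0 ?invr_eq0.
apply/permP=> x; rewrite homographyE // homographyE ?turn_nz ?mulf_neq0 ?invr_eq0 //.
rewrite a0 bd'; case: x => [z|] /=; last first.
  by rewrite mulf_eq0 invr_eq0 (negPf c0) (negPf d0) !mul0r.
have -> : c / d * z + 1 = (c * z + d) / d by rewrite mulrDl divff // mulrAC.
rewrite mulf_eq0 invr_eq0 (negPf d0) orbF; case: eqVneq => // w0.
by rewrite !mul0r !add0r invf_div mul1r.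
Qed.

(** The pair (U_m, U_(m+1)) for U_(m+2) = U_(m+1) + c U_m, U_0 = 0, U_1 = 1; these
are the coefficients of the powers of the matrix with rows (0, 1) and (c, 1). *)
Fixpoint fib c (m : nat) {struct m} : F * F :=
  if m is m'.+1 then let: (u, v) := fib c m' in (v, v + c * u)%R else (0, 1).

Lemma turn_expg c m u v : c != 0 -> fib c m = (u, v) ->
  c * u * (v + c * u) - v * (c * v) != 0 /\
  (turn c ^+ m.+1)%g = homography (c * u) v (c * v) (v + c * u).
Proof.
move=> c0; elim: m u v => [|m IHm] u v /=.
  by move=> [<- <-]; rewrite expg1 !mulr0 !addr0 !mulr1 mul1r sub0r oppr_eq0.
case: (fib c m) IHm => u' v' /(_ _ _ erefl)[nz E] [<- <-]; split.
  have -> : c * v' * (v' + c * u' + c * v') - (v' + c * u') * (c * (v' + c * u'))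
    = - c * (c * u' * (v' + c * u') - v' * (c * v')) by ring.
  by rewrite mulf_neq0 ?oppr_eq0.
rewrite expgSr E homographyM ?turn_nz //; congr homography; ring.
Qed.

(** The reduction mod 2 of U_13.  If the matrix has eigenvalues in the ratio t, then
1 / c = t + 1 / t, so the roots correspond to the six pairs {t, 1 / t} with t of order 13. *)
Definition psi c := c ^+ 6 + c ^+ 5 + c ^+ 2 + c + 1.

Lemma fib12 c : (fib c 12).2 = psi c.
Proof. by rewrite /= /psi; ring: c11 c45 c84 c70 c21. Qed.

Lemma psi_neq0 c : psi c = 0 -> c != 0.
Proof.
by apply: contra_eqN => /eqP->; rewrite /psi !expr0n /= !add0r oner_eq0.
Qed.

(** The 13-th power of the matrix is scalar iff its off-diagonal entry U_13 vanishes. *)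
Lemma turn13 c : c != 0 -> (turn c ^+ 13 == 1)%g = (psi c == 0).
Proof.
move=> c0; have := fib12 c.
case E : (fib c 12) => [u v] /= vE; have [nz ->] := turn_expg c0 E.
rewrite {E}vE in nz *; apply/eqP/eqP=> [E|E].
  have := congr1 (fun s : {perm option F} => s None) E.
  rewrite homographyE // perm1 /= mulf_eq0 (negPf c0) /=.
  by case: eqVneq.
move: nz; rewrite E mulr0 mul0r subr0 add0r mulf_eq0 orbb => nz.
apply/permP=> x; rewrite homographyE ?mulr0 ?mul0r ?subr0 ?(mulf_neq0 nz nz) //.
by rewrite perm1 mobius_scale.
Qed.

Lemma order_turn c : psi c = 0 -> #[turn c]%g = 13%N.
Proof.
move=> c_root; have c0 := psi_neq0 c_root.
apply/prime_nt_dvdP => //; last by rewrite order_dvdn turn13 // c_root eqxx.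
rewrite order_eq1; apply/eqP=> E.
by have := turnN c0; rewrite E perm1.
Qed.

Lemma psi_sqr c : psi (c ^+ 2) = psi c ^+ 2.
Proof. by rewrite /psi; ring: char2 c3 c4 c5. Qed.

Section Roots.
Variable c : F.
Hypothesis c_root : psi c = 0.
Let c0 : c != 0 := psi_neq0 c_root.

Lemma root_neq1 : c != 1.
Proof.
apply: contra_eqN c_root => /eqP ->; rewrite /psi !expr1n.
have -> : 1 + 1 + 1 + 1 + 1 = 5%:R :> F by ring.
by rewrite c5 oner_eq0.
Qed.

Lemma root_exp6 : c ^+ 6 = c ^+ 5 + c ^+ 2 + c + 1.
Proof.
by apply/eqP; rewrite -subr_eq0 oppF !addrA; apply/eqP.
Qed.

Lemma root_sqr_neq : c ^+ 2 != c.
Proof.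
rewrite expr2 -{3}[c]mulr1 (inj_eq (mulfI c0)); exact: root_neq1.
Qed.

Lemma root_pow4_neq : c ^+ 4 != c.
Proof.
apply/negP=> /eqP E; have c_cube : c ^+ 3 = 1.
  by apply: (mulfI c0); rewrite -exprS E mulr1.
have := c_root; rewrite /psi (exprD c 3 3) (exprD c 3 2) c_cube !mul1r.
have -> : 1 + c ^+ 2 + c ^+ 2 + c + 1 = c by ring: char2 c3 c4 c5.
by apply/eqP.
Qed.

(** If c^7 = 1, then (c + 1) psi(c) reduces to c^3 (c + 1)^2. *)
Lemma root_pow8_neq : c ^+ 8 != c.
Proof.
apply/negP=> /eqP E; have c7 : c ^+ 7 = 1.
  by apply: (mulfI c0); rewrite -exprS E mulr1.
have : c ^+ 3 * (c + 1) ^+ 2 = 0.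
  have <- : c * psi c + psi c = c ^+ 3 * (c + 1) ^+ 2.
    have -> : c * psi c = c ^+ 7 + c ^+ 6 + c ^+ 3 + c ^+ 2 + c by rewrite /psi; ring.
    by rewrite c7 /psi; ring: char2.
  by rewrite c_root mulr0 addr0.
move/eqP; rewrite mulf_eq0 !expf_eq0 /= (negPf c0) /= addr_eq0 oppF.
by apply/negP; exact: root_neq1.
Qed.

(** The sextic psi divides X^64 - X: all roots lie in the field with 64 elements. *)
Lemma root_pow64 : c ^+ 64 = c.
Proof.
have e6 := root_exp6.
have e7 : c ^+ 7 = c ^+ 5 + c ^+ 3 + 1.
  have -> : c ^+ 7 = c * c ^+ 6 by ring.
  have -> : c * c ^+ 6 = c ^+ 6 + c ^+ 3 + c ^+ 2 + c by rewrite {1}e6; ring.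
  by rewrite e6; ring: char2.
have e8 : c ^+ 8 = c ^+ 5 + c ^+ 4 + c ^+ 2 + 1.
  have -> : c ^+ 8 = c * c ^+ 7 by ring.
  have -> : c * c ^+ 7 = c ^+ 6 + c ^+ 4 + c by rewrite e7; ring.
  by rewrite e6; ring: char2.
have e10 : c ^+ 10 = c ^+ 4 + c ^+ 3 + c.
  have -> : c ^+ 10 = c ^+ 2 * c ^+ 8 by ring.
  have -> : c ^+ 2 * c ^+ 8 = c ^+ 7 + c ^+ 6 + c ^+ 4 + c ^+ 2 by rewrite e8; ring.
  by rewrite e6 e7; ring: char2.
have e16 : c ^+ 16 = c ^+ 5 + c ^+ 4 + c ^+ 3 + c ^+ 2 + c.
  rewrite (exprM c 8 2) e8.
  have -> : (c ^+ 5 + c ^+ 4 + c ^+ 2 + 1) ^+ 2 = c ^+ 10 + c ^+ 8 + c ^+ 4 + 1 by ring: char2 c3 c4 c5.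
  by rewrite e8 e10; ring: char2 c3.
have e32 : c ^+ 32 = c ^+ 4 + c ^+ 3 + c ^+ 2.
  rewrite (exprM c 16 2) e16.
  have -> : (c ^+ 5 + c ^+ 4 + c ^+ 3 + c ^+ 2 + c) ^+ 2 = c ^+ 10 + c ^+ 8 + c ^+ 6 + c ^+ 4 + c ^+ 2 by ring: char2 c3 c4 c5.
  by rewrite e10 e8 e6; ring: char2 c3.
rewrite (exprM c 32 2) e32.
have -> : (c ^+ 4 + c ^+ 3 + c ^+ 2) ^+ 2 = c ^+ 8 + c ^+ 6 + c ^+ 4 by ring: char2 c3 c4 c5.
by rewrite e8 e6; ring: char2 c3 c4 c5.
Qed.

Lemma root_pow16_neq : c ^+ 16 != c.
Proof.
apply: contra root_pow4_neq => /eqP E.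
by rewrite -{1}E -exprM root_pow64.
Qed.

Lemma root_pow32_neq : c ^+ 32 != c.
Proof.
apply: contra root_sqr_neq => /eqP E.
by rewrite -{1}E -exprM root_pow64.
Qed.

Definition frob_orbit := [:: c; c ^+ 2; c ^+ 4; c ^+ 8; c ^+ 16; c ^+ 32].

(** A coincidence between two of these conjugates would place c in the field with 2, 4
or 8 elements. *)
Lemma frob_orbit_uniq : uniq frob_orbit.
Proof.
have sqr_inj a b : (a ^+ 2 == b ^+ 2) = (a == b).
  by rewrite eqf_sqr oppF orbb.
rewrite /= !inE !negb_or !(eq_sym c).
rewrite root_sqr_neq root_pow4_neq root_pow8_neq root_pow16_neq root_pow32_neq /=.
rewrite (exprM c 2 2) (exprM c 4 2) (exprM c 8 2) (exprM c 16 2).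
rewrite !sqr_inj !(eq_sym c) ?root_sqr_neq root_pow4_neq root_pow8_neq root_pow16_neq /=.
rewrite (exprM c 2 2) (exprM c 4 2) (exprM c 8 2).
rewrite !sqr_inj !(eq_sym c) ?root_sqr_neq root_pow4_neq root_pow8_neq /=.
rewrite (exprM c 2 2) (exprM c 4 2).
rewrite !sqr_inj !(eq_sym c) ?root_sqr_neq root_pow4_neq /=.
by rewrite (exprM c 2 2) !sqr_inj eq_sym root_sqr_neq.
Qed.

(** As psi has coefficients in the prime field, its set of roots is stable under
squaring; the six conjugates of c exhaust a polynomial of degree 6. *)
Lemma psi_rootsE : [set z | psi z == 0] =i frob_orbit.
Proof.
pose p : {poly F} := Poly [:: 1; 1; 1; 0; 0; 1; 1].
have pE z : p.[z] = psi z by rewrite horner_Poly /= /psi; ring.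
have rt : {subset frob_orbit <= [set z | psi z == 0]}.
  move=> z; rewrite inE.
  have sq a : psi a == 0 -> psi (a ^+ 2) == 0 by rewrite psi_sqr => /eqP->; rewrite expr0n.
  have r1 : psi c == 0 by apply/eqP.
  have r2 := sq _ r1; have r4 := sq _ r2; have r8 := sq _ r4; have r16 := sq _ r8.
  have r32 := sq _ r16; rewrite -!exprM /= in r4 r8 r16 r32.
  by rewrite !inE => /or4P[/eqP->|/eqP->|/eqP->|/or3P[]/eqP->].
have p0 : p != 0.
  apply/eqP=> /(congr1 (fun q : {poly F} => q`_0)); rewrite coef_Poly coef0 /=.
  by apply/eqP; rewrite oner_eq0.
have le6 : (#|[set z | psi z == 0%R]| <= 6)%N.
  have rts : all (root p) (enum [set z | psi z == 0]).
    by apply/allP=> z; rewrite mem_enum inE /root pE.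
  have := max_poly_roots p0 rts (enum_uniq _); rewrite -cardE => lt.
  exact: leq_trans lt (size_Poly _).
have sub : {subset frob_orbit <= enum [set z | psi z == 0]}.
  by move=> z /rt; rewrite mem_enum.
have [|_ E] := uniq_min_size frob_orbit_uniq sub; first by rewrite -cardE.
by move=> z; rewrite -mem_enum E.
Qed.

Lemma card_psi_roots : #|[set z | psi z == 0]| = 6%N.
Proof. by rewrite (eq_card psi_rootsE) (card_uniqP frob_orbit_uniq). Qed.
End Roots.

End CyclicTriples.
Arguments turn {F} c%_ring_scope.

(** * Blocks with a 13-cycle *)

Section ThirteenCycles.

Variables (F : finFieldType) (n : nat).
Hypothesis hn : (0 < n)%N.
Hypothesis hF : #|F| = (2 ^ n)%N.
Implicit Types (a b c d z : F) (x y p : option F) (g h k : {perm option F}).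
Implicit Types B : {set option F}.
Notation G := (PSL2_group F).
Let char2 := char2 hF.
Let addff := addff hF.
Let oppF := oppF hF.

Lemma turn_in c : turn c \in G. Proof. exact: homography_in. Qed.

(** The parameter c is the ratio of the determinant to the squared trace, and squaring
the matrix squares both, as tr(M^2) = tr(M)^2 in characteristic 2. *)
Lemma turn_sqr_conj c : c != 0 -> (turn c ^+ 2 = turn (c ^+ 2) ^ affinity c 1)%g.
Proof.
move=> c0; have c20 : c ^+ 2 != 0 by rewrite expf_neq0.
apply: (mulgI (affinity c 1)); rewrite conjgE mulKVg.
have nzc : c * 1 - 1 * 0 != 0 by rewrite mulr1 mulr0 subr0.
have nzr : 0 * 1 - 1 * c != 0 by rewrite turn_nz.
have nzr2 : 0 * 1 - 1 * c ^+ 2 != 0 by rewrite turn_nz.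
rewrite expgS expg1 /turn mulgA /affinity !homographyM //; last first.
  have -> : (0 * c + 1 * 0) * (c * 1 + 1 * 1) - (0 * 1 + 1 * 1) * (c * c + 1 * 0) = - (c * c) by ring.
  by rewrite oppr_eq0 mulf_neq0.
congr homography; rewrite ?(mul1r, mulr1, mul0r, mulr0, add0r, addr0) ?expr2 //.
by rewrite addrA addff add0r.
Qed.

Definition block13 c : {set option F} := [set (h : {perm option F}) None | h in <[turn c]>%g].

Section Roots.
Variable c : F.
Hypothesis c_root : psi c = 0.
Let c0 : c != 0 := psi_neq0 c_root.

(** If a nontrivial power fixes one point of the orbit, it fixes them all, in
particular oo; its powers then include the generator, which moves oo. *)
Lemma turn_free h x : h \in <[turn c]>%g -> h != 1%g -> x \in block13 c -> h x != x.
Proof.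
move=> hr h1 /imsetP[k kr ->].
have hk : (k * h = h * k)%g.
  by have /centsP := cycle_abelian (turn c); apply.
rewrite -permM hk permM (inj_eq perm_inj).
apply: contraNneq h1 => hN.
have : (<[turn c]> :&: 'C[None | 'P] = 1)%g.
  apply: prime_TIg; first by rewrite -orderE (order_turn hF c_root).
  rewrite cycle_subG; apply/astab1P; rewrite /= apermE turnN //.
move/setP/(_ h); rewrite in_setI hr in_set1 /= => <-.
by apply/astab1P; rewrite /= apermE.
Qed.

Lemma card_block13 : #|block13 c| = 13%N.
Proof.
rewrite card_in_imset -?orderE ?(order_turn hF c_root) // => h k hr kr E.
apply/eqP; rewrite eq_mulgV1; apply: contraT => hk.
have : (h * k^-1)%g None != None.
  apply: turn_free hk _; first by rewrite groupM ?groupV.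
  by apply/imsetP; exists 1%g; rewrite ?group1 ?perm1.
by rewrite permM E permK eqxx.
Qed.

Lemma turn_stab13 : turn c \in stab (block13 c).
Proof.
apply/stabP; split; first exact: turn_in.
apply/eqP; rewrite eqEcard (card_imset _ (@perm_inj _ _)) leqnn andbT.
apply/subsetP=> _ /imsetP[_ /imsetP[h hr ->] ->]; apply/imsetP.
by exists (h * turn c)%g; rewrite ?permM // groupM ?cycle_id.
Qed.

Lemma fixpts_turn13 : #|fixpts (turn c) (block13 c)| = 0%N.
Proof.
apply/eqP; rewrite cards_eq0; apply/eqP/setP=> x; rewrite !inE.
apply/negbTE/negP=> /andP[xB]; apply/negP; apply: turn_free xB; rewrite ?cycle_id //.
by rewrite -order_eq1 (order_turn hF c_root).
Qed.

(** The square of an element of order 13 generates the same group, hence has the same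
orbits, and it is conjugate to the element of parameter c^2 by a map fixing oo. *)
Lemma block13_sqr : block13 c = affinity c 1 @: block13 (c ^+ 2).
Proof.
have cyc : <[turn (c ^+ 2) ^ affinity c 1]>%g = <[turn c]>%g.
  apply/eqP; rewrite eqEcard -turn_sqr_conj // cycle_subG mem_cycle -!orderE.
  by rewrite orderXgcd (order_turn hF c_root).
rewrite /block13 -cyc cycleJ.
apply/setP=> x; apply/imsetP/imsetP=> [[_ /imsetP[h hr ->] ->]|[_ /imsetP[h hr ->] ->]].
  exists (h None); first by apply: imset_f.
  by rewrite -permJ affinityE.
exists (h ^ affinity c 1)%g; first by rewrite memJ_conjg.
by rewrite -{2}[None](@affinityE _ c 1 None) // permJ.
Qed.

End Roots.

(** Any two roots are linked by iterated squaring. *)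
Lemma block13_conj c c' : psi c = 0 -> psi c' = 0 -> exists2 k, k \in G & block13 c' = k @: block13 c.
Proof.
move=> cr cr'; have := psi_rootsE hF cr c'.
have step a : psi a = 0 -> (exists2 k, k \in G & block13 a = k @: block13 c) ->
   exists2 k, k \in G & block13 (a ^+ 2) = k @: block13 c.
  move=> ar [k kG E]; exists (k * (affinity a 1)^-1)%g.
    by rewrite groupM ?groupV ?affinity_in.
  transitivity ((affinity a 1)^-1%g @: block13 a).
    rewrite (block13_sqr ar) -imset_comp -[LHS]imset_id.
    by apply: eq_imset => x /=; rewrite permK.
  by rewrite E -imset_comp; apply: eq_imset => x /=; rewrite permM.
have sq a : psi a = 0 -> psi (a ^+ 2) = 0 by rewrite (psi_sqr hF) => ->; rewrite expr0n.
have e1 : exists2 k, k \in G & block13 c = k @: block13 c.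
  exists 1%g; rewrite ?group1 // -[LHS]imset_id.
  by apply: eq_imset => x; rewrite perm1.
have r2 := sq _ cr; have r4 := sq _ r2; have r8 := sq _ r4; have r16 := sq _ r8.
have e2 := step _ cr e1; have e4 := step _ r2 e2; have e8 := step _ r4 e4.
have e16 := step _ r8 e8; have e32 := step _ r16 e16.
rewrite -!exprM /= in e4 e8 e16 e32.
by rewrite !inE cr' eqxx => /esym/or4P[/eqP->|/eqP->|/eqP->|/or3P[]/eqP->].
Qed.

(** Send oo, 0, 1 to y, g y, g (g y). *)
Lemma order13_conj g y : g \in G -> #[g]%g = 13%N -> g y != y ->
  exists c k, [/\ psi c = 0, k \in G, k None = y & g = (turn c ^ k)%g].
Proof.
move=> gG og gy.
(* Otherwise g = (g^2)^7 would fix y as well. *)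
have ggy : g (g y) != y.
  apply: contraNneq gy => E.
  have -> : g = (g ^+ 14)%g by rewrite expgS -og expg_order mulg1.
  have -> : (g ^+ 14)%g = ((g * g) ^+ 7)%g by rewrite -expg2 -expgM.
  by elim: 7%N => [|m IHm]; rewrite ?expg0 ?perm1 // expgS !permM E.
have y_gy : y != g y by rewrite eq_sym.
have y_ggy : y != g (g y) by rewrite eq_sym.
have gy_ggy : g y != g (g y) by rewrite (inj_eq perm_inj).
have [k kG [k0 k1 k2]] := three_transitive y_gy gy_ggy y_ggy.
have [||| c c0 gE] := @turnP _ (g ^ k^-1)%g; first by rewrite groupJ ?groupV.
- by rewrite conjgE invgK !permM k0 -k1 permK.
- by rewrite conjgE invgK !permM k1 -k2 permK.
exists c, k; split=> //; last by rewrite -gE conjgKV.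
by apply/eqP; rewrite -(turn13 hF) // -gE -conjXg -og expg_order conj1g.
Qed.

End ThirteenCycles.

(** * Stabilisers containing a 13-cycle *)

Section ThirteenStabilisers.

Variables (F : finFieldType) (n : nat).
Hypothesis hn : (0 < n)%N.
Hypothesis hF : #|F| = (2 ^ n)%N.
Implicit Types (a b c d z : F) (x y p : option F) (g h k : {perm option F}).
Implicit Types B : {set option F}.
Notation G := (PSL2_group F).

(** If a nontrivial power of g had a single fixed point in B, then g, which commutes
with it, would fix that point.  So the cyclic group of g acts freely on B. *)
Lemma no_fixpts_order13 B g : #|B| = 13%N ->
  (forall h, h \in stab B -> h != 1%g -> #|fixpts h B| != 2%N) ->
  g \in stab B -> g != 1%g -> #|fixpts g B| = 0%N -> #[g]%g = 13%N.
Proof.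
move=> cardB no2 gS g1 /eqP; rewrite cards_eq0 => /eqP fix0.
apply/prime_nt_dvdP; rewrite ?order_eq1 //.
have -> : 13%N = #|B| by rewrite cardB.
apply: card_free_dvd => [h|h x hg h1 xB].
  by apply: stable_cycle; apply: stab_im.
have hS : h \in stab B by move: hg => /cycleP[i ->]; rewrite groupX.
apply/negP=> /eqP hx.
have xh : x \in fixpts h B by rewrite inE xB hx eqxx.
have : #|fixpts h B| == 1%N.
  have := card_fixpts_le2 B (stab_in hS) h1; have := no2 h hS h1.
  have : (0 < #|fixpts h B|)%N by apply/card_gt0P; exists x.
  by case: #|_| => [|[|[|]]].
case/cards1P=> y fixE; move: xh; rewrite fixE => /set1P xy.
have : g x \in fixpts h B.
  rewrite inE (mem_stable _ (stab_im gS)) xB /= -permM.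
  have /centsP/(_ _ hg _ (cycle_id g)) comm := cycle_abelian g.
  by rewrite -comm permM hx.
rewrite fixE xy => /set1P gx.
have : x \in fixpts g B by rewrite inE xB xy gx eqxx.
by rewrite fix0 inE.
Qed.

Lemma order13_block B g y c k : #|B| = 13%N -> g \in stab B -> y \in B ->
  psi c = 0 -> k None = y -> g = (turn c ^ k)%g -> k @: block13 c = B.
Proof.
move=> cardB gS yB cr ky gE; apply/eqP.
rewrite eqEcard (card_imset _ (@perm_inj _ k)) (card_block13 hF cr) cardB leqnn andbT.
apply/subsetP=> _ /imsetP[_ /imsetP[h hr ->] ->].
have hk : (h ^ k)%g \in <[g]>%g by rewrite gE cycleJ memJ_conjg.
by rewrite -permJ ky (mem_stable _ (stable_cycle (stab_im gS) hk)).
Qed.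

(** The elements carrying one block to another form a coset of the stabiliser. *)
Lemma card_transporter B c : psi c = 0 -> (exists2 k, k \in G & k @: block13 c = B) ->
  #|[set k in G | k @: block13 c == B]| = #|stab B|.
Proof.
move=> cr [k0 k0G k0E].
have -> : [set k in G | k @: block13 c == B] = (k0 *: stab B)%g.
  apply/setP=> k; rewrite mem_lcoset inE; apply/andP/stabP=> [[kG /eqP kE]|[kG kE]].
    split; first by rewrite groupM ?groupV.
    rewrite -[RHS]kE -k0E -imset_comp; apply: eq_imset => x /=.
    by rewrite permM permK.
  rewrite groupMl ?groupV // in kG; split=> //; apply/eqP.
  rewrite -[RHS]kE -k0E -[RHS]imset_comp; apply: eq_imset => x /=.
  by rewrite permM permK.
by rewrite card_lcoset.
Qed.

(** Let N0 and N1 be the sets of elements of H with no, respectively one, fixed point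
in B.  A pair (g, y) with g in N0 and y in B is the image of the pair
(z -> 1 / (c z + 1), oo) under a unique k in G, for a unique root c of psi, and k
carries the model block to B.  As all six roots give equivalent blocks, there are
6 |H| such pairs, so 13 |N0| = 6 |H|.  Combined with |H| = 1 + |N0| + |N1| and
Burnside's lemma, which says that |H| divides 13 + |N1|, this leaves |H| = 26 only. *)
Lemma stab_type_no_fixpts B g0 : #|B| = 13%N ->
  (forall h, h \in stab B -> h != 1%g -> #|fixpts h B| != 2%N) ->
  g0 \in stab B -> g0 != 1%g -> #|fixpts g0 B| = 0%N ->
  stab_type B 26 13 0 0 /\
  exists c k, [/\ psi c = 0, k \in G & B = k @: block13 c].
Proof.
move=> cardB no2 g0S g01 fix0; set H := stab B.
pose N0 := [set g in H | (g != 1%g) && (#|fixpts g B| == 0%N)].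
pose N1 := [set g in H | (g != 1%g) && (#|fixpts g B| == 1%N)].
have ord g : g \in N0 -> #[g]%g = 13%N.
  by rewrite inE => /and3P[gS g1 /eqP]; apply: no_fixpts_order13.
have normal g y : g \in N0 -> y \in B ->
    exists c k, [/\ psi c = 0, k \in G, k None = y, g = (turn c ^ k)%g & k @: block13 c = B].
  move=> gN yB; have o13 := ord g gN.
  move: gN; rewrite inE -/H => /and3P[gS g1 /eqP/eqP]; rewrite cards_eq0 => /eqP fg.
  have gy : g y != y.
    by apply/negP=> gy; have := in_set0 y; rewrite -fg inE yB gy.
  have [c [k [cr kG ky gE]]] := order13_conj hF (stab_in gS) o13 gy.
  by exists c, k; split=> //; apply: (order13_block cardB gS yB cr ky gE).
have g0N : g0 \in N0 by rewrite inE g0S g01 fix0 eqxx.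
have [y0 y0B] : exists y, y \in B by apply/set0Pn; rewrite -card_gt0 cardB.
have [c0 [k0 [c0r k0G _ _ k0B]]] := normal g0 y0 g0N y0B.
split; last by exists c0, k0.
pose D := [set ck : F * {perm option F} |
            (psi ck.1 == 0) && ((ck.2 \in G) && (ck.2 @: block13 ck.1 == B))].
have cardD : #|D| = (6 * #|H|)%N.
  rewrite -sum1dep_card.
  rewrite -(pair_big_dep (fun c => psi c == 0)
    (fun c k => (k \in G) && (k @: block13 c == B)) (fun _ _ => 1%N)) /=.
  rewrite (eq_bigr (fun => #|H|)) => [|c /eqP cr].
    by rewrite sum_nat_const -(card_psi_roots hF c0r) cardsE.
  rewrite sum1dep_card; apply: card_transporter => //.
  have [k kG E] := block13_conj hF cr c0r.
  exists (k * k0)%g; first by rewrite groupM.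
  by rewrite -k0B E -[RHS]imset_comp; apply: eq_imset => x /=; rewrite permM.
have cardN0 : (#|N0| * 13 = 6 * #|H|)%N.
  rewrite -cardB -cardsX -cardD.
  pose f (ck : F * {perm option F}) := ((turn ck.1 ^ ck.2)%g, ck.2 None).
  have <- : f @: D = setX N0 B.
    apply/setP=> -[g y]; apply/imsetP/setXP => [[[c k]]|[gN yB]].
      rewrite inE /= => /and3P[/eqP cr kG /eqP kE] [-> ->].
      split; last by rewrite -kE imset_f //; apply/imsetP; exists 1%g; rewrite ?group1 ?perm1.
      have tS := turn_stab13 c.
      rewrite inE -{1}kE fixpts_conj (fixpts_turn13 hF cr) eqxx andbT conjg_eq1.
      rewrite -order_eq1 (order_turn hF cr) andbT.
      apply/stabP; split; first by rewrite groupJ // turn_in.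
      rewrite -[RHS]kE -[in RHS](stab_im tS) -kE -!imset_comp; apply: eq_imset => x /=.
      by rewrite permJ.
    have [c [k [cr kG ky gE kB]]] := normal g y gN yB.
    exists (c, k); last by rewrite /f /= -gE ky.
    by rewrite inE /= cr kG kB !eqxx.
  rewrite card_in_imset // => -[c k] [c' k'].
  rewrite inE /= => /and3P[/eqP cr kG _]; rewrite inE /= => /and3P[/eqP cr' kG' _] [gE kN].
  have c_nz := psi_neq0 cr; have c_nz' := psi_neq0 cr'.
  have k0E : k (Some 0) = k' (Some 0).
    by rewrite -(turnN c_nz) -permJ gE kN permJ !turnN.
  have k1E : k (Some 1) = k' (Some 1).
    by rewrite -(turn0 c_nz) -permJ gE k0E permJ !turn0.
  have kE : k = k'.
    apply: (eq_on_three kG kG' _ _ _ kN k0E k1E) => //.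
    by rewrite (inj_eq (@Some_inj _)) eq_sym oner_eq0.
  congr (_, _) => //; have tE : turn c = turn c' by apply: (@conjg_inj _ k); rewrite gE kE.
  have := congr1 (fun s : {perm option F} => s (Some 1)) tE.
  rewrite !homographyE ?turn_nz //= !mulr1 add0r.
  case: eqVneq => [e|_]; case: eqVneq => [e'|_] //.
    by move/eqP: e; move/eqP: e'; rewrite !addr_eq0 => /eqP-> /eqP->.
  by rewrite !mul1r => -[/invr_inj/addIr].
have cardH : #|H| = (1 + #|N0| + #|N1|)%N.
  have -> : H = 1%g |: (N0 :|: N1) :> {set _}.
    apply/setP=> g; rewrite !inE; have [->|g1] := eqVneq g 1%g; first by rewrite group1.
    case: (boolP (g \in H)) => //= gH.
    have := card_fixpts_le2 B (stab_in gH) g1; have := no2 g gH g1.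
    by case: #|_| => [|[|[|]]].
  rewrite cardsU1 !inE eqxx !andbF /= cardsU.
  have -> : N0 :&: N1 = set0.
    by apply/setP=> g; rewrite !inE; case: (#|_|) => [|[|m]]; rewrite ?andbF.
  by rewrite cards0 subn0 addnA.
(* The identity fixes 13 points of B, and each element of N1 fixes one. *)
have [r burnside] : exists r, (13 + #|N1| = r * #|H|)%N.
  exists #|orbit 'P H @: B|; rewrite -sum_fixpts => [|k]; last exact: stab_im.
  rewrite (bigD1 1%g) //= fixpts1 cardB; congr addn; symmetry.
  rewrite -sum1_card [RHS]big_mkcond [LHS]big_mkcond; apply: eq_bigr => g _.
  rewrite inE; case: (boolP (g \in H)) => //= gH; case: eqVneq => //= g1.
  have := card_fixpts_le2 B (stab_in gH) g1; have := no2 g gH g1.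
  by case: #|_| => [|[|[|]]].
have cardH26 : #|H| = 26%N.
  have d13 : (13 %| #|H|)%N by rewrite -(@Gauss_dvdr 13 6) // -cardN0 dvdn_mull.
  have := cardG_gt0 H.
  case/dvdnP: d13 => m E; move: cardN0 cardH burnside; rewrite E; clear.
  move: #|N0| #|N1| => n0 n1; case: r => [|[|r]]; nia.
have inv : #|invols B| = 13%N.
  have <- : #|N1| = 13%N by move: cardN0 cardH; rewrite cardH26; lia.
  apply: eq_card => g; rewrite !inE; case: (boolP (g \in stab B)) => //= gS.
  apply/eqP/andP=> [og|[g1 /eqP fg]].
    have [g1 _] := (order2P g).1 og; split=> //.
    have := card_fixpts_mod (isT : prime 2) og (stab_im gS).
    have := card_fixpts_le2 B (stab_in gS) g1; rewrite cardB.
    by case: #|_| => [|[|[|]]].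
  have := order_dvdG gS; rewrite -/H cardH26.
  have /cards1P[x fE] : #|fixpts g B| == 1%N by apply/eqP.
  have gx : x \in fixpts g B by rewrite fE set11.
  (* An element of N1 is an involution: its order divides 26, and neither it nor its
  square, which also fixes x, can have order 13. *)
  have no13 h : h \in stab B -> x \in fixpts h B -> #[h]%g != 13%N.
    move=> hS xh; apply/negP=> /eqP oh.
    have := card_fixpts_mod (isT : prime 13) oh (stab_im hS); rewrite cardB.
    have := card_fixpts_le2 B (stab_in hS); rewrite -order_gt1 oh => /(_ isT).
    have : (0 < #|fixpts h B|)%N by apply/card_gt0P; exists x.
    by case: #|_| => [|[|[|]]].
  have n13 := no13 g gS gx.
  have n26 : #[g]%g != 26%N.
    apply/negP=> /eqP og; case/negP: (no13 (g ^+ 2)%g (groupX _ gS) (subsetP (fixpts_expg g B 2) _ gx)).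
    by rewrite orderXgcd og.
  move: g1 n13 n26; rewrite -order_eq1; move: #[g]%g => m n1 n13 n26 m26.
  have : (m <= 26)%N by apply: dvdn_leq.
  by move: n1 n13 n26 m26; do 27?[case: m => [|m] //].
split=> //.
  apply/eqP; rewrite cards_eq0; apply/eqP/setP=> g; rewrite !inE.
  by apply/negbTE/andP=> -[gS /eqP o3]; have := order_dvdG gS; rewrite o3 -/H cardH26.
by apply: comm_invols0; rewrite -/H cardH26.
Qed.

End ThirteenStabilisers.

(** * Classification of the stabilisers *)

Lemma modn_pow2 (p k n : nat) : (2 ^ k %% p = 1 %% p)%N -> (2 ^ n %% p = 2 ^ (n %% k) %% p)%N.
Proof.
move=> k1.
have -> : (2 ^ n = (2 ^ k) ^ (n %/ k) * 2 ^ (n %% k))%N.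
  by rewrite -expnM -expnD mulnC -divn_eq.
by rewrite -modnMml -modnXm k1 modnXm exp1n modnMml mul1n.
Qed.

Lemma dvdn_pred_modn (p m : nat) : (0 < m)%N -> (1 < p)%N -> (p %| m.-1)%N = (m %% p == 1)%N.
Proof.
move=> m0 p1; case: m m0 => // m _ /=; rewrite -addn1 -{2}(modn_small p1).
by rewrite eqn_mod_dvd ?leq_addl // addnK.
Qed.

Section Classification.

Variables (F : finFieldType) (n : nat).
Hypothesis hn : (0 < n)%N.
Hypothesis hF : #|F| = (2 ^ n)%N.
Implicit Types (a b c d z : F) (x y p : option F) (g h k : {perm option F}).
Implicit Types B : {set option F}.
Notation G := (PSL2_group F).

Lemma stab_conj B k : k \in G -> stab (k @: B) = (stab B :^ k)%G.
Proof.
move=> kG; apply/val_inj/setP=> g /=; rewrite mem_conjg.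
have kE : k @: B = ('P^*)%act B k by apply: eq_imset => x; rewrite /= apermE.
apply/stabP/stabP=> -[gG gB].
  split; first by rewrite groupJ // groupV.
  rewrite conjgE invgK; apply: (imset_inj (@perm_inj _ k)).
  rewrite -[RHS]gB -!imset_comp; apply: eq_imset => x /=.
  by rewrite !permM permKV.
split; first by move: gG; rewrite groupJr // groupV.
rewrite -[in RHS]gB -!imset_comp; apply: eq_imset => x /=.
by rewrite conjgE invgK !permM permKV.
Qed.

Lemma card_stab_conj B k : k \in G -> #|stab (k @: B)| = #|stab B|.
Proof. by move=> kG; rewrite stab_conj //= cardJg. Qed.

Lemma card_invols_conj B k : k \in G -> #|invols (k @: B)| = #|invols B|.
Proof.
move=> kG; rewrite -[RHS](cardJg _ k); apply: eq_card => g.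
by rewrite mem_conjg !inE stab_conj //= mem_conjg orderJ.
Qed.

Lemma order3s0 B : ~~ (3 %| #|stab B|)%N -> #|order3s B| = 0%N.
Proof.
move=> n3; apply/eqP; rewrite cards_eq0; apply/eqP/setP=> g; rewrite !inE.
by apply: contraNF n3 => /andP[gS /eqP <-]; apply: order_dvdG.
Qed.

(** For the orders 22 and 26 the block is determined up to equivalence; for order 12
the common fixed point serves to count the pairs of an involution and an element of
order 3. *)
Variant stab_spec B : Prop :=
| Stab1 of stab_type B 1 0 0 0
| Stab2 of stab_type B 2 1 0 0
| Stab3 of stab_type B 3 0 2 0
| Stab4 of stab_type B 4 3 0 6
| Stab12 of stab_type B 12 3 8 6 & (exists p, forall g, g \in stab B -> g p = p)
| Stab22 of stab_type B 22 11 0 0 & (exists a : F, 11.-primitive_root a) &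
    (exists2 k, k \in G & B = k @: block11 F)
| Stab26 of stab_type B 26 13 0 0 & (exists c k, [/\ psi c = 0, k \in G & B = k @: block13 c]).

Lemma stabilisers B : #|B| = 13%N -> stab_spec B.
Proof.
move=> cardB.
case: (pickP [pred g in stab B | (g != 1%g) && (#|fixpts g B| == 2%N)]) => [g /and3P[gS g1 /eqP fg]|no2].
  have [[a aP] [k kG kE]] := two_fixpts_block11 cardB gS g1 fg.
  have [s t _ _] := stab_type_block11 hF aP.
  have card22 : #|stab B| = 22%N by rewrite kE card_stab_conj.
  apply: Stab22; [|by exists a|by exists k]; split=> //.
  - by rewrite kE card_invols_conj.
  - by rewrite order3s0 // card22.
  - by rewrite comm_invols0 // card22.
have no2' h : h \in stab B -> h != 1%g -> #|fixpts h B| != 2%N.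
  by move=> hS h1; have := no2 h; rewrite inE /= hS h1 /= => ->.
case: (pickP [pred g in stab B | (g != 1%g) && (#|fixpts g B| == 0%N)]) => [g /and3P[gS g1 /eqP fg]|no0].
  by have [st ex] := stab_type_no_fixpts hn hF cardB no2' gS g1 fg; apply: Stab26.
have fix1 h : h \in stab B -> h != 1%g -> #|fixpts h B| = 1%N.
  move=> hS h1; have := no0 h; rewrite inE /= hS h1 /=.
  have := no2' h hS h1; have := card_fixpts_le2 B (stab_in hS) h1.
  by case: #|_| => [|[|[|]]].
have [st|st|st|[]st] := stab_type_one_fixpt hn hF cardB fix1.
- exact: Stab1.
- exact: Stab2.
- exact: Stab4.
- exact: Stab3.
apply: Stab12 => //.
have [|||p _ pfix] := @common_fixpoint _ (stab B) B; last by exists p.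
- exact: stab_im.
- by rewrite -card_gt0 cardB.
exact: fix1.
Qed.

(** An element of order 3 stabilising B fixes a point of B, as 13 = 1 mod 3, hence a
second point of the line, as its multiplier is not 1. *)
Lemma order3_conj B g : #|B| = 13%N -> g \in order3s B ->
  exists w, w ^+ 2 + w + 1 = 0 /\ g \in (affinity w 0 ^: G)%g.
Proof.
move=> cardB; rewrite inE => /andP[gS /eqP og]; have [gG gB] := stabP _ _ gS.
have [p gp] : exists p, g p = p.
  have := card_fixpts_mod (isT : prime 3) og gB; rewrite cardB.
  case: (posnP #|fixpts g B|) => [->//|/card_gt0P[p]].
  by rewrite inE => /andP[_ /eqP]; exists p.
have [mu [mu_nz muM mu1 mu_fix]] := multiplier hF p.
have [g1 g3] := perm_order3 og.
have mug : mu g != 1.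
  apply/negP=> /eqP /(mu1 g gG gp) gg; move: g3; rewrite expgS expg2 gg mulg1 => g1'.
  by rewrite g1' eqxx in g1.
have [p' pp' gp'] := mu_fix g gG gp mug.
rewrite eq_sym in pp'.
have [k [w [kG w0 _ _ gE]]] := two_fixpts_conj gG pp' gp gp'.
have w3 : w ^+ 3 = 1.
  have := congr1 (fun s : {perm option F} => s (k (Some 1))) g3.
  rewrite gE -conjXg permJ perm1 => /perm_inj.
  by rewrite !expgS expg0 mulg1 !permM !affinityE // !addr0 mulr1 => -[E]; rewrite exprS expr2.
have w1 : w != 1.
  by apply: contraNneq g1 => w1; rewrite gE w1 affinity10 conj1g.
exists w; split; last by rewrite gE; apply: memJ_class.
have : (w - 1) * (w ^+ 2 + w + 1) = w ^+ 3 - 1 by ring.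
by rewrite w3 subrr => /eqP; rewrite mulf_eq0 subr_eq0 (negPf w1) => /eqP.
Qed.

Lemma dvdn_pred_card (p : nat) : (1 < p)%N -> (p %| #|F|.-1)%N = (2 ^ n %% p == 1)%N.
Proof. by move=> p1; rewrite hF dvdn_pred_modn // expn_gt0. Qed.

Lemma cube_root_iff : (exists w : F, w ^+ 2 + w + 1 = 0) <-> ~~ odd n.
Proof.
have d3 : (3 %| #|F|.-1)%N = ~~ odd n.
  rewrite dvdn_pred_card // (@modn_pow2 3 2) // modn2.
  by case: (odd n).
split=> [[w E]|]; rewrite -d3.
  have w3 : w ^+ 3 = 1.
    apply/eqP; rewrite -subr_eq0.
    have -> : w ^+ 3 - 1 = (w - 1) * (w ^+ 2 + w + 1) by ring.
    by rewrite E mulr0.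
  have w1 : w != 1.
    apply: contra_eqN E => /eqP->; rewrite expr1n.
    have -> : 1 + 1 + 1 = 3%:R :> F by ring.
    by rewrite (natF hF 3) oner_eq0.
  exact: (prim_root_dvd hF (prime_prim_root (isT : prime 3) w3 w1)).
move=> d; have [w wP] := prime_root_exists (isT : prime 3) d; exists w.
have w3 := prim_expr_order wP.
have w1 : w != 1.
  by rewrite -[w]expr1 -(prim_order_dvd wP).
have : (w - 1) * (w ^+ 2 + w + 1) = w ^+ 3 - 1 by ring.
by rewrite w3 subrr => /eqP; rewrite mulf_eq0 subr_eq0 (negPf w1) => /eqP.
Qed.

Lemma order11_iff : (exists a : F, 11.-primitive_root a) <-> (n %% 10 == 0)%N.
Proof.
have d11 : (11 %| #|F|.-1)%N = (n %% 10 == 0)%N.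
  rewrite dvdn_pred_card // (@modn_pow2 11 10) //.
  have : (n %% 10 < 10)%N by rewrite ltn_mod.
  by move: (n %% 10)%N => m; do 10?[case: m => [|m] //].
split=> [[a aP]|]; rewrite -d11; first exact: (prim_root_dvd hF aP).
exact: prime_root_exists.
Qed.

(** The roots of psi correspond to elements of order 13, and these exist, by Cauchy's
theorem, iff 13 divides |G| = (q + 1) q (q - 1), that is iff 2^(2n) = 1 mod 13. *)
Lemma psi_root_iff : (exists c : F, psi c = 0) <-> (n %% 6 == 0)%N.
Proof.
have d13 : (13 %| #|G|)%N = (n %% 6 == 0)%N.
  rewrite card_PSL2 !Euclid_dvdM // dvdn_pred_card //.
  have -> : (13 %| #|F|.+1)%N = (2 ^ n %% 13 == 12)%N.
    rewrite hF /dvdn -(addn1 (2 ^ n)) -modnDml.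
    have : (2 ^ n %% 13 < 13)%N by rewrite ltn_mod.
    by move: (2 ^ n %% 13)%N => m; do 13?[case: m => [|m] //].
  rewrite /dvdn hF -(@modn_dvdm 12 n 6) // (@modn_pow2 13 12) //.
  have : (n %% 12 < 12)%N by rewrite ltn_mod.
  by move: (n %% 12)%N => m; do 12?[case: m => [|m] //].
split=> [[c cr]|]; rewrite -d13.
  by rewrite -(order_turn hF cr) order_dvdG // homography_in.
move=> d; have [g gG og] := Cauchy (isT : prime 13) d.
have g1 : g != 1%g by rewrite -order_gt1 og.
have [y gy] : exists y, g y != y.
  apply/existsP; apply: contraR g1; rewrite negb_exists => /forallP E.
  by apply/eqP/permP=> x; rewrite perm1; apply/eqP; rewrite -[_ == _]negbK E.
by have [c [k [cr _ _ _]]] := order13_conj hF gG og gy; exists c.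
Qed.

End Classification.

(** * Subsets stable under a free action *)

Section FreeOrbits.
Local Open Scope nat_scope.
Local Open Scope group_scope.
Variables (T : finType) (K : {group {perm T}}) (Y Z : {set T}).
Hypothesis YK : forall k, k \in K -> k @: Y = Y.
Hypothesis ZK : forall k, k \in K -> k @: Z = Z.
Hypothesis YZ : Y :&: Z = set0.
Hypothesis Kfree : forall k x, k \in K -> k != 1%g -> x \in Y -> k x != x.

Let orb x := orbit 'P K x.

Lemma card_free_orbit x : x \in Y -> #|orb x| = #|K|.
Proof.
move=> xY; rewrite card_orbit; have -> : 'C_K[x | 'P] = 1%g; last by rewrite indexg1.
apply/trivgP/subsetP=> k /setIP[kK /astab1P]; rewrite /= apermE => kx.
by rewrite inE; apply: contraT => k1; have := Kfree kK k1 xY; rewrite kx eqxx.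
Qed.

Lemma orbit_stable (A : {set T}) x : (forall k, k \in K -> k @: A = A) ->
  x \in A -> orb x \subset A.
Proof.
move=> AK xA; apply/subsetP=> _ /orbitP[k kK <-].
by rewrite /= apermE (mem_stable _ (AK k kK)).
Qed.

Lemma card_stable_free (A : {set T}) : (forall k, k \in K -> k @: A = A) -> A \subset Y ->
  #|A| = (#|orb @: A| * #|K|)%N.
Proof.
move=> AK AY; apply: card_uniform_partition (orbit_partition (acts_on_stable AK)).
by move=> _ /imsetP[x xA ->]; rewrite card_free_orbit // (subsetP AY).
Qed.

Lemma cover_orbits (A : {set T}) : (forall k, k \in K -> k @: A = A) ->
  cover (orb @: A) = A.
Proof. by move=> AK; have /and3P[/eqP-> _ _] := orbit_partition (acts_on_stable AK). Qed.

Lemma stable_imset (A : {set T}) :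
  (forall k x, k \in K -> x \in A -> k x \in A) -> forall k, k \in K -> k @: A = A.
Proof.
move=> AK k kK; apply/eqP; rewrite eqEcard (card_imset _ (@perm_inj _ k)) leqnn andbT.
by apply/subsetP=> _ /imsetP[x xA ->]; apply: AK.
Qed.

(** A K-stable set B with given part Z outside Y is Z together with a union of m
regular orbits in Y. *)
Lemma card_stable_sets m :
  #|[set B : {set T} | [&& #|B| == (#|Z| + m * #|K|)%N, B :\: Y == Z
     & [forall k in K, k @: B == B]]]| = 'C(#|Y| %/ #|K|, m).
Proof.
have cardP : #|orb @: Y| = #|Y| %/ #|K|.
  by rewrite (card_stable_free YK (subxx _)) mulnK ?cardG_gt0.
rewrite -cardP -cards_draws.
pose D := [set C : {set {set T}} | (C \subset orb @: Y) & #|C| == m].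
have coverK C : C \in D -> [/\ forall k, k \in K -> k @: cover C = cover C,
    orb @: cover C = C & cover C \subset Y].
  rewrite inE => /andP[/subsetP CP _]; split.
  - apply: stable_imset => k x kK /bigcupP[O OC xO]; apply/bigcupP; exists O => //.
    have /imsetP[y _ Oy] := CP O OC; move: xO; rewrite !Oy /orb => /orbit_eqP <-.
    by have := mem_orbit 'P x kK; rewrite /= apermE.
  - apply/setP=> O; apply/imsetP/idP=> [[x /bigcupP[O' O'C xO'] ->]|OC].
      have /imsetP[y _ Oy] := CP _ O'C.
      by move: xO'; rewrite Oy => /orbit_eqP E; rewrite /orb E -/(orb y) -Oy.
    have /imsetP[y _ Oy] := CP O OC; exists y => //.
    by apply/bigcupP; exists O => //; rewrite Oy orbit_refl.
  apply/bigcupsP=> O /CP/imsetP[y yY ->]; exact: orbit_stable YK yY.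
pose f (C : {set {set T}}) := Z :|: cover C.
have fY C : C \in D -> f C :&: Y = cover C.
  move=> /coverK[_ _ CY]; rewrite /f setIUl [Z :&: Y]setIC YZ set0U.
  exact/setIidPl.
have fI : {in D &, injective f}.
  move=> C C' CD C'D E; have [_ <- _] := coverK C CD; have [_ <- _] := coverK C' C'D.
  by rewrite -(fY C CD) -(fY C' C'D) E.
rewrite -(card_in_imset fI); apply: eq_card => B; rewrite inE.
apply/and3P/imsetP=> [[/eqP cardB /eqP BZ /forall_inP BK]|[C CD ->]].
  have BYK k : k \in K -> k @: (B :&: Y) = B :&: Y.
    apply: stable_imset => {}k x kK /setIP[xB xY]; apply/setIP.
    by rewrite (mem_stable _ (eqP (BK k kK))) (mem_stable _ (YK kK)).
  exists (orb @: (B :&: Y)); last by rewrite /f cover_orbits // setUC -{1}(setID B Y) BZ.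
  rewrite inE imsetS ?subsetIr //=.
  have : #|B| = (#|Z| + #|orb @: (B :&: Y)| * #|K|)%N.
    by rewrite -(card_stable_free BYK (subsetIr _ _)) -(cardsID Y B) BZ addnC.
  by rewrite cardB => /addnI/eqP; rewrite eqn_pmul2r ?cardG_gt0 // eq_sym.
have [CK orbC CY] := coverK C CD; move: (CD); rewrite inE => /andP[_ /eqP Cm]; split.
- rewrite /f cardsU.
  have -> : Z :&: cover C = set0.
    by apply/eqP; rewrite -subset0 -YZ setIC setSI.
  by rewrite cards0 subn0 (card_stable_free CK CY) orbC Cm.
- rewrite /f setDUl; have -> : cover C :\: Y = set0 by apply/eqP; rewrite setD_eq0.
  rewrite setU0; apply/eqP/setDidPl; rewrite disjoint_sym -setI_eq0 YZ //.
- apply/forall_inP=> k kK; apply/eqP; rewrite /f imsetU.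
  by rewrite ZK // CK.
Qed.

End FreeOrbits.

(** * Blocks stabilised by translations *)

Section AffineCounts.

Variables (F : finFieldType) (n : nat).
Hypothesis hn : (0 < n)%N.
Hypothesis hF : #|F| = (2 ^ n)%N.
Implicit Types (a b c d z w : F) (x y p : option F) (g h k : {perm option F}).
Implicit Types B : {set option F}.
Notation G := (PSL2_group F).
Notation q := #|F|.
Let char2 := char2 hF.
Let addff := addff hF.
Let oppF := oppF hF.

Definition blocks : {set {set option F}} := [set B : {set option F} | #|B| == 13%N].

Section AffineGroup.
Variables M V : {set F}.
Hypothesis M1 : 1 \in M.
Hypothesis M0 : forall a, a \in M -> a != 0.
Hypothesis MM : forall a b, a \in M -> b \in M -> a * b \in M.
Hypothesis V0 : 0 \in V.
Hypothesis VD : forall a b, a \in V -> b \in V -> a + b \in V.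
Hypothesis MV : forall a b, a \in M -> b \in V -> a * b \in V.

(** The maps z -> a z + b with a in M and b in V; a group when M is a group of
multipliers and V an additive group stable under M. *)
Definition affine_set := [set affinity p.1 p.2 | p in setX M V].

Lemma affine_group_set : group_set affine_set.
Proof.
apply/group_setP; split.
  by apply/imsetP; exists (1, 0); rewrite ?affinity10 // in_setX M1.
move=> _ _ /imsetP[[a b] /setXP[/= aM bV] ->] /imsetP[[c d] /setXP[/= cM dV] ->] /=.
rewrite affinityM ?M0 //; apply/imsetP; exists (c * a, c * b + d) => //.
by rewrite in_setX /= MM ?VD ?MV.
Qed.
Canonical affine_group := Group affine_group_set.

Lemma card_affine_set : #|affine_set| = (#|M| * #|V|)%N.
Proof.
rewrite card_in_imset ?cardsX // => -[a b] [c d] /setXP[/= aM _] /setXP[/= cM _].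
by case/affinity_inj; rewrite ?M0 // => -> ->.
Qed.

Lemma affine_set_fix_infty k : k \in affine_set -> k None = None.
Proof. by case/imsetP=> -[a b] /setXP[/= aM bV] ->; rewrite affinityE ?M0. Qed.
End AffineGroup.

(** A translation fixes oo only, and an involution must fix a point of a block, 13
being odd. *)
Lemma invol_stab_infty B b : B \in blocks -> b != 0 -> affinity 1 b \in stab B -> None \in B.
Proof.
rewrite inE => /eqP cardB b0 bS.
have o2 : #[affinity 1 b]%g = 2%N.
  apply/order2P; rewrite (affinity_sq hF); split=> //.
  apply/eqP=> /(congr1 (fun s : {perm option F} => s (Some 0))).
  rewrite affinityE ?oner_eq0 // perm1 mulr0 add0r => -[]; exact/eqP.
have := card_fixpts_mod (isT : prime 2) o2 (stab_im bS); rewrite cardB.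
case: (posnP #|fixpts (affinity 1 b) B|) => [->//|/card_gt0P[p]].
rewrite inE affinityE ?oner_eq0 // => /andP[pB]; case: p pB => [z|//] _.
by rewrite mul1r (inj_eq (@Some_inj _)) -subr_eq0 addrAC subrr add0r (negPf b0).
Qed.

(** The translations by V act freely on the affine line, and a block they stabilise
contains oo. *)
Lemma card_translation_blocks (V : {set F}) m :
  0 \in V -> (forall a b, a \in V -> b \in V -> a + b \in V) -> (1 < #|V|)%N ->
  (1 + m * #|V| = 13)%N ->
  #|[set B in blocks | [forall b in V, affinity 1 b \in stab B]]| = 'C(q %/ #|V|, m).
Proof.
move=> V0 VD V_gt1 m13.
have M1 : 1 \in [set 1 : F] by rewrite inE.
have M0 a : a \in [set 1 : F] -> a != 0 by move=> /set1P->; rewrite oner_eq0.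
have MM a b : a \in [set 1 : F] -> b \in [set 1 : F] -> a * b \in [set 1 : F].
  by move=> /set1P-> /set1P->; rewrite mulr1.
have MV a b : a \in [set 1 : F] -> b \in V -> a * b \in V.
  by move=> /set1P->; rewrite mul1r.
pose K := affine_group M1 M0 MM V0 VD MV.
have cardK : #|K| = #|V| by rewrite card_affine_set // cards1 mul1n.
have KN k : k \in K -> k None = None by apply: affine_set_fix_infty.
have [v vV v0] : exists2 v, v \in V & v != 0.
  move: V_gt1; rewrite (cardsD1 0) V0 ltnS => /card_gt0P[v /setD1P[]].
  by exists v.
have K1 k : k \in K -> k @: [set None] = [set None].
  by move=> /KN kN; rewrite imset_set1 kN.
have KY k : k \in K -> k @: (~: [set None]) = ~: [set None].
  move=> kK; apply: stable_imset kK => {}k x /KN kN.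
  by rewrite !inE -{2}kN (inj_eq perm_inj).
have YZ : ~: [set None] :&: [set None] = set0 :> {set option F}.
  by rewrite setIC setICr.
have Kfree k x : k \in K -> k != 1%g -> x \in ~: [set None] -> k x != x.
  case/imsetP=> -[a b] /setXP[/= /set1P-> bV] ->; rewrite !inE => k1.
  case: x => // z _; rewrite affinityE ?oner_eq0 // (inj_eq (@Some_inj _)) mul1r.
  rewrite -subr_eq0 addrAC subrr add0r; apply: contra k1 => /eqP->.
  by rewrite affinity10.
have := card_stable_sets KY K1 YZ Kfree m.
rewrite cardK cards1 m13 cardsC1 card_option => <-.
apply: eq_card => B; rewrite inE [RHS]inE.
apply/andP/and3P => [[Bb /forall_inP BV]|[cardB /eqP BZ /forall_inP BK]].
  have NB := invol_stab_infty Bb v0 (BV v vV).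
  split; first by rewrite inE in Bb.
    by rewrite setDE setCK; apply/eqP/setIidPr; rewrite sub1set.
  apply/forall_inP=> k /imsetP[[a b] /setXP[/= /set1P-> bV] ->].
  by apply/eqP/stab_im/BV.
split; first by rewrite inE.
apply/forall_inP=> b bV; apply/stabP; split; first exact: affinity_in.
by apply/eqP/BK/imsetP; exists (1, b); rewrite // in_setX M1.
Qed.

Definition common_blocks g h := #|[set B in blocks | (g \in stab B) && (h \in stab B)]|.

Lemma common_blocks_conj g h k : k \in G -> common_blocks (g ^ k)%g (h ^ k)%g = common_blocks g h.
Proof.
move=> kG; rewrite /common_blocks.
have kI : injective (fun B : {set option F} => k @: B) by apply: imset_inj; apply: perm_inj.
rewrite -[RHS](card_imset _ kI); apply: eq_card => B.
have BE : k @: (k^-1%g @: B) = B.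
  by rewrite -imset_comp -[RHS]imset_id; apply: eq_imset => x /=; rewrite permKV.
rewrite -BE mem_imset // !inE (card_imset _ (@perm_inj _ k)).
by rewrite stab_conj //= !memJ_conjg.
Qed.

Lemma common_blocks_invol : common_blocks (affinity 1 1) (affinity 1 1) = 'C(q %/ 2, 6).
Proof.
have c2 : #|[set 0; 1 : F]| = 2%N by rewrite cards2 eq_sym oner_eq0.
rewrite -[in RHS]c2 -card_translation_blocks ?c2 //; first last.
- move=> a b; rewrite !inE => /orP[]/eqP-> /orP[]/eqP->;
    by rewrite ?addr0 ?add0r ?addff eqxx ?orbT.
- by rewrite !inE eqxx.
apply: eq_card => B; rewrite inE [RHS]inE andbb; congr andb.
apply/idP/forall_inP => [S1 b|]; last by apply; rewrite !inE eqxx orbT.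
by rewrite !inE => /orP[]/eqP-> //; rewrite affinity10 group1.
Qed.

(** The group generated is that of the translations by {0, 1, e, 1 + e}. *)
Lemma common_blocks_commuting_invols e : e != 0 -> e != 1 ->
  common_blocks (affinity 1 1) (affinity 1 e) = 'C(q %/ 4, 3).
Proof.
move=> e0 e1; pose V := [set x in [:: 0; 1; e; 1 + e]].
have c4 : #|V| = 4%N.
  have ne a b : a + b != 0 -> a != b by apply: contraNneq => ->; rewrite addff.
  have n1 : 0 != 1 :> F by rewrite eq_sym oner_eq0.
  have n2 : 0 != e by rewrite eq_sym.
  have n3 : 0 != 1 + e by rewrite eq_sym addr_eq0 oppF eq_sym.
  have n4 : 1 != e by rewrite eq_sym.
  have n5 : 1 != 1 + e by apply: ne; rewrite addrA addff add0r.
  have n6 : e != 1 + e by apply: ne; rewrite addrCA addff addr0 oner_eq0.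
  by rewrite cardsE; apply/card_uniqP => /=; rewrite !inE !negb_or n1 n2 n3 n4 n5 n6.
rewrite -[in RHS]c4 -card_translation_blocks ?c4 //; first last.
- have ee := addff e; have oo := addff 1.
  have E1 a : a + (a + e) = e by rewrite addrA addff add0r.
  have E2 : e + (1 + e) = 1 by rewrite addrCA addff addr0.
  move=> a b; rewrite !inE => /or4P[]/eqP-> /or4P[]/eqP->;
    rewrite ?addr0 ?add0r ?addff ?E1 ?E2 ?[1 + e + 1]addrC ?[1 + e + e]addrC ?E1 ?E2 ?[e + 1]addrC eqxx ?orbT //.
- by rewrite !inE eqxx.
apply: eq_card => B; rewrite inE [RHS]inE; congr andb.
apply/andP/forall_inP => [[S1 Se] b|S]; last first.
  by split; apply: S; rewrite !inE eqxx ?orbT.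
rewrite !inE => /or4P[]/eqP-> //; first by rewrite affinity10 group1.
have -> : affinity 1 (1 + e) = (affinity 1 1 * affinity 1 e)%g.
  by rewrite affinityM ?oner_eq0 // !mul1r.
by rewrite groupM.
Qed.

End AffineCounts.

(** * Blocks stabilised by an element of order 3 *)

Section OrderThreeCounts.

Variables (F : finFieldType) (n : nat).
Hypothesis hn : (0 < n)%N.
Hypothesis hF : #|F| = (2 ^ n)%N.
Implicit Types (a b c d z : F) (x y p : option F) (g h k : {perm option F}).
Implicit Types B : {set option F}.
Notation G := (PSL2_group F).
Notation q := #|F|.
Let char2 := char2 hF.
Let addff := addff hF.
Let oppF := oppF hF.

Section Root.
Variable w : F.
Hypothesis ww : w ^+ 2 + w + 1 = 0.

Lemma w_sqr : w * w = w + 1.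
Proof.
by have /eqP := ww; rewrite expr2 -addrA addr_eq0 oppF => /eqP.
Qed.

Lemma w_neq0 : w != 0.
Proof.
apply/negP=> /eqP w0; move: ww; rewrite w0 expr0n /= !add0r => /eqP.
by rewrite oner_eq0.
Qed.

Lemma w_neq1 : w != 1.
Proof.
apply/negP=> /eqP w1; move: ww; rewrite w1 expr1n addff add0r => /eqP.
by rewrite oner_eq0.
Qed.

Lemma w1_neq0 : w + 1 != 0.
Proof. by rewrite addr_eq0 oppF w_neq1. Qed.

Lemma w1_neq1 : w + 1 != 1.
Proof. by rewrite -subr_eq0 addrK w_neq0. Qed.

Lemma w_mul1 : w * (w + 1) = 1.
Proof. by rewrite mulrDr w_sqr mulr1 addrAC addff add0r. Qed.

Lemma w1_mul1 : (w + 1) * w = 1.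
Proof. by rewrite mulrC w_mul1. Qed.

Lemma w1_sqr : (w + 1) * (w + 1) = w.
Proof. by rewrite mulrDr mulr1 w1_mul1 addrCA addff addr0. Qed.

Lemma w1_root : (w + 1) ^+ 2 + (w + 1) + 1 = 0.
Proof. by rewrite expr2 w1_sqr addrA addff add0r addff. Qed.

Lemma root3_cases z : z ^+ 2 + z + 1 = 0 -> (z == w) || (z == w + 1).
Proof.
move=> zz; rewrite -(subr_eq0 z w) -(subr_eq0 z (w + 1)) -mulf_eq0 !oppF.
have -> : (z + w) * (z + (w + 1)) =
  z ^+ 2 + z + 1 + (w ^+ 2 + w + 1) + 2%:R * (z * w - 1) by ring.
by rewrite zz ww char2 mul0r !addr0.
Qed.

(** The group of cube roots of unity, whose third element is w^2 = w + 1. *)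
Definition M3 := [set x in [:: 1; w; w + 1]].

Let M3_1 : 1 \in M3. Proof. by rewrite !inE eqxx. Qed.

Let M3_0 a : a \in M3 -> a != 0.
Proof.
by rewrite !inE => /or3P[]/eqP->; rewrite ?oner_eq0 ?w_neq0 ?w1_neq0.
Qed.

Let M3_M a b : a \in M3 -> b \in M3 -> a * b \in M3.
Proof.
rewrite !inE => /or3P[]/eqP-> /or3P[]/eqP->;
  by rewrite ?mulr1 ?mul1r ?w_sqr ?w_mul1 ?w1_mul1 ?w1_sqr eqxx ?orbT.
Qed.

Lemma card_M3 : #|M3| = 3%N.
Proof.
rewrite cardsE; apply/card_uniqP; rewrite /= !inE !negb_or.
rewrite ![1 == _]eq_sym w_neq1 w1_neq1 -subr_eq0 opprD addrA subrr sub0r.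
by rewrite oppr_eq0 oner_eq0.
Qed.

Lemma order_affinity_w : #[affinity w 0]%g = 3%N.
Proof.
apply/prime_nt_dvdP => //.
  rewrite order_eq1 -affinity10; apply/eqP=> /affinity_inj[]; rewrite ?w_neq0 ?oner_eq0 //.
  by move/eqP; rewrite (negPf w_neq1).
rewrite order_dvdn !expgS expg0 mulg1 !affinityM ?mulf_neq0 ?w_neq0 //.
by rewrite w_sqr w1_mul1 !mulr0 !addr0 affinity10.
Qed.

Lemma affinity_w_fix x : (affinity w 0 x == x) = (x \in [set None; Some 0]).
Proof.
rewrite affinityE ?w_neq0 // !inE; case: x => [z|] //=.
rewrite addr0 !(inj_eq (@Some_inj _)) -subr_eq0 -{2}[z]mul1r -mulrBl mulf_eq0.
by rewrite subr_eq0 (negPf w_neq1).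
Qed.

Lemma affinity_wC b : (affinity 1 b ^ affinity w 0 = affinity 1 (w * b))%g.
Proof.
apply: (mulgI (affinity w 0)); rewrite conjgE mulKVg !affinityM ?w_neq0 ?oner_eq0 //.
by rewrite !mul1r !mulr1 ?mulr0 !addr0 add0r.
Qed.

(** The map z -> w z has order 3 and fixes exactly 0 and oo; as 13 = 1 mod 3, a stable
block contains exactly one of them. *)
Lemma fix_affinity_w B : B \in blocks F -> affinity w 0 \in stab B ->
  (None \in B) = (Some 0 \notin B).
Proof.
rewrite inE => /eqP cardB wS.
have := card_fixpts_mod (isT : prime 3) order_affinity_w (stab_im wS); rewrite cardB.
have -> : fixpts (affinity w 0) B = B :&: [set None; Some 0].
  by apply/setP=> x; rewrite in_setI inE affinity_w_fix.
have [NB|NB] := boolP (None \in B); have [SB|SB] := boolP (Some 0 \in B) => //.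
  by rewrite (setIidPr _) ?cards2 //; apply/subsetP=> x; rewrite !inE => /orP[]/eqP->.
suff -> : B :&: [set None; Some 0] = set0 by rewrite cards0.
apply/setP=> x; rewrite !inE; apply/negP=> /andP[xB /orP[]/eqP xE].
  by rewrite -xE xB in NB.
by rewrite -xE xB in SB.
Qed.

Lemma stab_M3 B a : affinity w 0 \in stab B -> a \in M3 -> affinity a 0 \in stab B.
Proof.
move=> wS; rewrite !inE => /or3P[]/eqP-> //; first by rewrite affinity10 group1.
have -> : affinity (w + 1) 0 = (affinity w 0 * affinity w 0)%g.
  by rewrite affinityM ?w_neq0 // w_sqr mulr0 addr0.
by rewrite groupM.
Qed.

(** A stable block is oo or 0 together with four of the (q - 1) / 3 regular orbits of
the group of the maps z -> a z with a^3 = 1. *)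
Lemma common_blocks_order3 : common_blocks (affinity w 0) (affinity w 0) = (2 * 'C((q.-1) %/ 3, 4))%N.
Proof.
have V0 : 0 \in [set 0 : F] by rewrite inE.
have VD a b : a \in [set 0 : F] -> b \in [set 0 : F] -> a + b \in [set 0 : F].
  by move=> /set1P-> /set1P->; rewrite addr0.
have MV a b : a \in M3 -> b \in [set 0 : F] -> a * b \in [set 0 : F].
  by move=> _ /set1P->; rewrite mulr0.
pose K := affine_group M3_1 M3_0 M3_M V0 VD MV.
have cardK : #|K| = 3%N by rewrite (card_affine_set _ M3_0) card_M3 cards1.
pose Y := ~: [set None; Some (0 : F)].
have cardY : #|Y| = q.-1 by rewrite cardsCs setCK cards2 card_option subSS subn1.
have memK k : k \in K -> exists2 a, a \in M3 & k = affinity a 0.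
  by case/imsetP=> -[a b] /setXP[/= aM /set1P->] ->; exists a.
have Kx k x : k \in K -> x \in [set None; Some 0] -> k x = x.
  by case/memK=> a aM ->; rewrite !inE => /orP[]/eqP->; rewrite affinityE ?M3_0 // mulr0 add0r.
have KY k : k \in K -> k @: Y = Y.
  move=> kK; apply: stable_imset kK => {}k x kK; rewrite !inE !negb_or.
  have e1 := Kx k None kK; have e2 := Kx k (Some 0) kK; rewrite !inE /= in e1 e2.
  by rewrite -{2}e1 // -{2}e2 // !(inj_eq perm_inj).
have Kfree k x : k \in K -> k != 1%g -> x \in Y -> k x != x.
  case/memK=> a aM -> a1; rewrite !inE negb_or => /andP[].
  case: x => // z _; rewrite (inj_eq (@Some_inj _)) => z0.
  rewrite (affinityE _ _ (M3_0 aM)) addr0 (inj_eq (@Some_inj _)).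
  apply: contra a1 => az; rewrite -affinity10; apply/eqP; congr affinity; apply/eqP.
  by rewrite -(inj_eq (mulIf z0)) mul1r.
(* Blocks that contain exactly x0 among the two fixed points. *)
have count x0 : x0 \in [set None; Some 0] ->
   #|[set B : {set option F} | [&& #|B| == 13%N, B :\: Y == [set x0] & [forall k in K, k @: B == B]]]| = 'C((q.-1) %/ 3, 4).
  move=> x0Z; have := card_stable_sets KY _ _ Kfree 4 (Z := [set x0]).
  rewrite cardK cards1 cardY => -> //.
    by move=> k kK; rewrite imset_set1 Kx.
  apply/setP=> x; rewrite !inE; apply/negP=> /andP[+ /eqP xE].
  by rewrite xE; move: x0Z; rewrite !inE => ->.
rewrite mul2n -addnn -{1}(count None) ?inE ?eqxx // -(count (Some 0)) ?inE ?eqxx ?orbT //.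
rewrite -cardsUI; set I := _ :&: _.
have -> : I = set0.
  apply/setP=> B; rewrite !inE; apply/negP=> /andP[/and3P[_ /eqP-> _] /and3P[_ /eqP E _]].
  by have := set11 (Some (0 : F)); rewrite -E inE.
rewrite cards0 addn0; apply: eq_card => B; rewrite in_setU !inE -/Y andbb.
have DY : B :\: Y = B :&: [set None; Some 0] by rewrite setDE setCK.
have stabK : affinity w 0 \in stab B = [forall k in K, k @: B == B].
  apply/idP/forall_inP => [wS k /memK[a aM ->]|E].
    by apply/eqP/stab_im/stab_M3.
  apply/stabP; split; first exact: affinity_in.
  by apply/eqP/E/imsetP; exists (w, 0); rewrite // in_setX !inE !eqxx orbT.
rewrite stabK; case: (boolP (#|B| == 13%N)) => //= cardB.
case: (boolP [forall k in K, k @: B == B]) => KB; rewrite ?andbF // !andbT.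
have BB : B \in blocks F by rewrite inE.
rewrite -stabK in KB; have := fix_affinity_w BB KB.
rewrite DY; have [NB /esym SB|NB /esym/negbT] := boolP (None \in B).
  symmetry; apply/orP; left; apply/eqP/setP=> x; rewrite !inE.
  have [->|xN] := eqVneq x None; first by rewrite NB.
  by case: eqVneq => [->|]; rewrite ?andbF // (negPf SB).
rewrite negbK => SB; symmetry; apply/orP; right; apply/eqP/setP=> x; rewrite !inE.
have [->|xS] := eqVneq x (Some 0); first by rewrite SB orbT.
by case: eqVneq => [->|]; rewrite ?andbF // (negPf NB).
Qed.

(** The two maps generate the group of order 12 of the maps z -> a z + b with a^3 = 1
and b in the subfield {0, 1, w, w + 1}; it acts freely off this subfield and oo, and a
stable block contains oo but not 0, so none of the subfield. *)
Lemma common_blocks_invol_order3 : common_blocks (affinity 1 1) (affinity w 0) = ((q - 4) %/ 12)%N.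
Proof.
pose V := [set x in [:: 0; 1; w; w + 1]].
have VE z : (z \in V) = (z == 0) || (z \in M3) by rewrite !inE.
have V0 : 0 \in V by rewrite VE eqxx.
have cardV : #|V| = 4%N.
  have -> : V = 0 |: M3 by apply/setP=> z; rewrite VE in_setU1.
  by rewrite cardsU1 card_M3; case: (boolP (0 \in M3)) => // /M3_0; rewrite eqxx.
have VD a b : a \in V -> b \in V -> a + b \in V.
  have E1 z : z + (z + 1) = 1 by rewrite addrA addff add0r.
  have E2 z : z + 1 + 1 = z by rewrite -addrA addff addr0.
  have E3 z : z + 1 + z = 1 by rewrite addrC.
  have E4 z : 1 + (z + 1) = z by rewrite addrC.
  rewrite !inE => /or4P[]/eqP-> /or4P[]/eqP->;
  by rewrite ?addr0 ?add0r ?addff ?E1 ?E2 ?E3 ?E4 ?[1 + w]addrC eqxx ?orbT.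
have MV a b : a \in M3 -> b \in V -> a * b \in V.
  move=> aM; rewrite !VE => /orP[/eqP->|bM]; first by rewrite mulr0 eqxx.
  by rewrite M3_M ?orbT.
pose K := affine_group M3_1 M3_0 M3_M V0 VD MV.
have cardK : #|K| = 12%N by rewrite (card_affine_set _ M3_0) card_M3 cardV.
have memK k : k \in K -> exists a b, [/\ a \in M3, b \in V & k = affinity a b].
  by case/imsetP=> -[a b] /setXP[/= aM bV] ->; exists a, b.
have KN k : k \in K -> k None = None by apply: affine_set_fix_infty.
pose Y := ~: (None |: [set Some z | z in V]).
have memY z : (Some z \in Y) = (z \notin V).
  by rewrite !inE /= mem_imset ?inE // => ? ? [].
have NY : None \notin Y by rewrite !inE.
have cardY : #|Y| = (q - 4)%N.
  rewrite cardsCs setCK cardsU1 card_imset ?cardV => [|? ? []//].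
  rewrite card_option; case: imsetP => [[]//|_]; by rewrite add1n subSS.
have KV k z : k \in K -> z \in V -> exists2 z', z' \in V & k (Some z) = Some z'.
  case/memK=> a [b [aM bV ->]] zV; rewrite affinityE ?M3_0 //.
  by exists (a * z + b); rewrite ?VD ?MV.
have KVi k z z' : k \in K -> k (Some z) = Some z' -> z' \in V -> z \in V.
  move=> kK E z'V; have [z'' z''V] := KV _ _ (groupVr kK) z'V.
  by rewrite -E permK => -[->].
have KY k : k \in K -> k @: Y = Y.
  move=> kK; apply: stable_imset kK => {}k [z|] kK; last by rewrite (negPf NY).
  rewrite memY => zV; case E : (k (Some z)) => [z'|].
    by rewrite memY; apply: contra zV; apply: KVi E.
  by move: E; rewrite -(KN k kK) => /perm_inj.
have K1 k : k \in K -> k @: [set None] = [set None].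
  by move=> kK; rewrite imset_set1 KN.
have YZ : Y :&: [set None] = set0.
  by apply/setP=> x; rewrite in_setI in_set1 in_set0; case: eqVneq => [->|]; rewrite ?(negPf NY) ?andbF.
have Kfree k x : k \in K -> k != 1%g -> x \in Y -> k x != x.
  case/memK=> a [b [aM bV ->]]; case: x => [z|]; last by rewrite (negPf NY).
  move=> ab1; rewrite memY; apply: contra; rewrite affinityE ?M3_0 // => /eqP[E].
  have [a1|a1] := eqVneq a 1.
    case/negP: ab1; move: E; rewrite a1 mul1r => /eqP.
    by rewrite -subr_eq0 addrAC subrr add0r => /eqP->; rewrite affinity10.
  have zb : (a + 1) * z = b.
    have : a * z + b + a * z = z + a * z by rewrite E.
    by rewrite addrAC addff add0r => ->; rewrite mulrDl mul1r addrC.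
  (* A fixed point b / (a + 1) lies in V, the inverse of a + 1 being in M3. *)
  have [c cM ca] : exists2 c, c \in M3 & c * (a + 1) = 1.
    move: aM a1; rewrite !inE => /or3P[]/eqP->; rewrite ?eqxx // => _.
    - by exists w; rewrite ?inE ?eqxx ?orbT // w_mul1.
    - by exists (w + 1); rewrite ?inE ?eqxx ?orbT // -addrA addff addr0 w1_mul1.
  by rewrite -[z]mul1r -ca -mulrA zb MV.
have := card_stable_sets KY K1 YZ Kfree 1.
rewrite cardK cards1 cardY bin1 => <-.
apply: eq_card => B; rewrite inE [RHS]inE.
apply/and3P/and3P => [[BB S1 Sw]|[cardB /eqP BZ /forall_inP BK]]; last first.
  have BK' k : k \in K -> k \in G -> k \in stab B.
    by move=> kK kG; apply/stabP; split=> //; apply/eqP/BK.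
  split; rewrite ?inE //; apply: BK'; rewrite ?affinity_in //; apply/imsetP.
    by exists (1, 1); rewrite // in_setX M3_1 VE M3_1 orbT.
  by exists (w, 0); rewrite // in_setX V0 !inE eqxx orbT.
have NB : None \in B by apply: (invol_stab_infty hF BB _ S1); rewrite oner_eq0.
have KS k : k \in K -> k \in stab B.
  have S1' b : b \in M3 -> affinity 1 b \in stab B.
    rewrite !inE => /or3P[]/eqP-> //.
      by rewrite -[w]mulr1 -affinity_wC groupJ.
    by rewrite -w_sqr -affinity_wC -[w in affinity 1 w]mulr1 -affinity_wC !groupJ.
  case/memK=> a [b [aM bV ->]].
  have -> : affinity a b = (affinity a 0 * affinity 1 b)%g.
    by rewrite affinityM ?M3_0 ?oner_eq0 // !mul1r add0r.
  apply: groupM; first exact: stab_M3.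
  move: bV; rewrite VE => /orP[/eqP->|/S1'//].
  by rewrite affinity10 group1.
split; first by rewrite inE in BB.
  apply/eqP/setP=> -[z|]; last by rewrite !inE /= NB.
  rewrite in_setD memY negbK [RHS]inE /=; apply/negP=> /andP[zV zB].
  have SB : Some 0 \notin B by rewrite -(fix_affinity_w BB Sw).
  have kK : affinity 1 z \in K by apply/imsetP; exists (1, z); rewrite // in_setX M3_1.
  case/negP: SB; rewrite -(mem_stable _ (stab_im (KS _ kK))) affinityE ?oner_eq0 //.
  by rewrite mulr0 add0r.
by apply/forall_inP=> k kK; apply/eqP/stab_im/KS.
Qed.

End Root.
End OrderThreeCounts.

(** * Double counting over all blocks *)

Lemma double_count (I J : finType) (A : {set I}) (P : {set J}) (R : I -> J -> bool) :
  (\sum_(i in A) #|[set j in P | R i j]| = \sum_(j in P) #|[set i in A | R i j]|)%N.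
Proof.
transitivity (\sum_(i in A) \sum_(j in P) R i j)%N.
  by apply: eq_bigr => i _; rewrite -sum1dep_card big_mkcondr.
rewrite exchange_big /=.
by apply: eq_bigr => j _; rewrite -sum1dep_card big_mkcondr.
Qed.

Section Sums.

Variables (F : finFieldType) (n : nat).
Hypothesis hn : (0 < n)%N.
Hypothesis hF : #|F| = (2 ^ n)%N.
Implicit Types (a b c d z w e : F) (x y : option F) (g h k : {perm option F}).
Implicit Types B : {set option F}.
Notation G := (PSL2_group F).
Notation q := #|F|.
Notation blocks := (blocks F).

Definition all_invols := [set g in G | #[g]%g == 2%N].
Definition all_order3s := [set g in G | #[g]%g == 3%N].

Lemma involsE B : invols B = [set g in all_invols | g \in stab B].
Proof.
apply/setP=> g; apply/setIdP/setIdP=> [[gS o]|[/setIdP[gG o] gS]]; split=> //.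
by apply/setIdP; split=> //; apply: stab_in gS.
Qed.

Lemma order3sE B : order3s B = [set g in all_order3s | g \in stab B].
Proof.
apply/setP=> g; apply/setIdP/setIdP=> [[gS o]|[/setIdP[gG o] gS]]; split=> //.
by apply/setIdP; split=> //; apply: stab_in gS.
Qed.

Lemma order_setJ m g k : k \in G ->
  ((g ^ k)%g \in [set g in G | #[g]%g == m]) = (g \in [set g in G | #[g]%g == m]).
Proof.
move=> kG; apply/idP/idP => /setIdP[gG o]; apply/setIdP; move: gG o;
  by rewrite groupJr // orderJ.
Qed.

Lemma common_blocks_diag g : common_blocks g g = #|[set B in blocks | g \in stab B]|.
Proof. by apply: eq_card => B; rewrite inE [RHS]inE andbb. Qed.

Lemma all_invols_class : all_invols = (affinity 1 1 ^: G)%g.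
Proof.
have t2 : #[affinity 1 1 : {perm option F}]%g = 2%N.
  apply/order2P; rewrite (affinity_sq hF); split=> //.
  apply/eqP=> /(congr1 (fun s : {perm option F} => s (Some 0))).
  rewrite affinityE ?oner_eq0 // perm1 mulr0 add0r => -[] /eqP; rewrite oner_eq0 //.
apply/setP=> g; rewrite inE; apply/andP/imsetP=> [[gG /eqP og]|[k kG ->]].
  have [k kG gE] := involution_conj hn hF gG og.
  by exists k; rewrite // gE.
by rewrite groupJ ?affinity_in // orderJ t2.
Qed.

(** A commuting element fixes the unique fixed point oo, and commuting with z + 1 forces
its multiplier to be 1. *)
Lemma cent_affinity11 : 'C_G[affinity 1 1] = [set affinity 1 b | b in [set: F]].
Proof.
apply/setP=> g; apply/setIP/imsetP => [[gG /cent1P comm]|[b _ ->]]; last first.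
  split; first exact: affinity_in.
  by apply/cent1P; rewrite /commute !affinityM ?oner_eq0 // !mul1r addrC.
have fixN x : (affinity 1 1 x == x) = (x == None).
  rewrite affinityE ?oner_eq0 //; case: x => [z|] //=.
  by rewrite mul1r (inj_eq (@Some_inj _)) -subr_eq0 addrAC subrr add0r oner_eq0.
have gN : g None = None.
  apply/eqP; rewrite -fixN -permM comm permM; apply/eqP; congr (g _).
  by apply/eqP; rewrite fixN.
have [a [b [a0 gE]]] := fix_infty_affine gG gN.
exists b => //; rewrite gE; congr affinity.
have := congr1 (fun s : {perm option F} => s (Some 0)) comm.
rewrite gE !permM !affinityE ?oner_eq0 // mulr0 !mul1r !add0r mulr1 => -[E].
by apply: (addrI b); rewrite E addrC.
Qed.

Lemma card_all_invols : (#|all_invols| * q = #|G|)%N.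
Proof.
have <- : #|'C_G[affinity (1 : F) 1]| = q.
  rewrite cent_affinity11 card_imset ?cardsT // => b c /affinity_inj[];
  by rewrite ?oner_eq0.
by rewrite all_invols_class -index_cent1 mulnC Lagrange // subsetIl.
Qed.

Lemma sum_class (phi : {perm option F} -> nat) t :
  (forall g k, k \in G -> phi (g ^ k)%g = phi g) ->
  (\sum_(g in (t ^: G)%g) phi g = #|(t ^: G)%g| * phi t)%N.
Proof.
move=> phiJ; rewrite -sum_nat_const; apply: eq_bigr => _ /imsetP[k kG ->].
exact: phiJ.
Qed.

(** All involutions are conjugate to z -> z + 1, whose centraliser has order q. *)
Lemma sum_invols : (q * \sum_(B in blocks) #|invols B| = #|G| * 'C(q %/ 2, 6))%N.
Proof.
under eq_bigr => B _ do rewrite involsE.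
rewrite double_count (eq_bigr (fun g => common_blocks g g)) => [|g _]; last by rewrite common_blocks_diag.
rewrite all_invols_class sum_class => [|g k kG]; last exact: common_blocks_conj.
rewrite (common_blocks_invol hF) mulnA [(q * _)%N]mulnC.
by rewrite -all_invols_class card_all_invols.
Qed.

Lemma comm_involsE B : comm_invols B =
  [set p in [set p in setX all_invols all_invols | (p.1 != p.2) && (p.1 * p.2 == p.2 * p.1)%g]
    | (p.1 \in stab B) && (p.2 \in stab B)].
Proof.
apply/setP=> -[g h]; rewrite /comm_invols !involsE !inE /=.
by case: (g \in stab B); case: (h \in stab B); rewrite ?andbF ?andbT.
Qed.

(** With the first involution normalised to z -> z + 1, the second one is z -> z + e
with e different from 0 and 1. *)
Lemma sum_comm_invols :
  (q * \sum_(B in blocks) #|comm_invols B| = #|G| * ((q - 2) * 'C(q %/ 4, 3)))%N.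
Proof.
under eq_bigr => B _ do rewrite comm_involsE.
rewrite double_count (eq_bigr (fun p => common_blocks p.1 p.2)) => [|[g h] _]; last by [].
pose com g h := (g != h) && (g * h == h * g)%g.
rewrite (eq_bigl (fun p : _ * _ => (p.1 \in all_invols) && ((p.2 \in all_invols) && com p.1 p.2))); last first.
  by move=> [g h]; rewrite inE in_setX -andbA.
rewrite -(pair_big_dep (fun g => g \in all_invols)
  (fun g h => (h \in all_invols) && com g h) (fun g h => common_blocks g h)) /=.
rewrite {1}all_invols_class.
rewrite (sum_class (phi := fun g => \sum_(h in all_invols | com g h) common_blocks g h)%N) => [|g k kG]; last first.
  rewrite (reindex_inj (@conjg_inj _ k)) /=; apply: eq_big => [h|h _]; last by rewrite common_blocks_conj.
  congr andb; first exact: order_setJ.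
  by rewrite /com (inj_eq (@conjg_inj _ k)) -!conjMg (inj_eq (@conjg_inj _ k)).
rewrite mulnA [(q * _)%N]mulnC -all_invols_class card_all_invols; congr muln.
pose E := ~: [set (0 : F); 1].
have cardE : #|E| = (q - 2)%N.
  by rewrite cardsCs setCK cards2 eq_sym oner_eq0.
rewrite (eq_bigl (fun h => h \in [set affinity 1 e | e in E])) => [|h].
  rewrite big_imset => [|e e' _ _ /affinity_inj[]]; rewrite ?oner_eq0 //.
  rewrite -cardE -sum_nat_const; apply: eq_bigr => e; rewrite !inE negb_or => /andP[e0 e1].
  exact: (common_blocks_commuting_invols hF).
apply/andP/imsetP => [[]|[e eE ->]].
  rewrite inE => /andP[hG /eqP oh] /andP[ht /eqP comm].
  have : h \in 'C_G[affinity 1 1] by rewrite inE hG; apply/cent1P.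
  rewrite cent_affinity11 => /imsetP[e _ hE]; exists e => //.
  rewrite !inE negb_or; apply/andP; split.
    by apply/eqP=> e0; move: oh; rewrite hE e0 affinity10 order1.
  by apply: contraNneq ht => e1; rewrite hE e1.
have /andP[e0 e1] : (e != 0) && (e != 1) by move: eE; rewrite !inE negb_or.
split.
  apply/setIdP; split; first exact: affinity_in.
  apply/eqP/order2P; rewrite (affinity_sq hF).
  by split=> //; rewrite -affinity10; apply: contraNneq e0 => /affinity_inj[]; rewrite ?oner_eq0 // => _ ->.
apply/andP; split; last by rewrite !affinityM ?oner_eq0 // !mul1r addrC.
by apply: contraNneq e1 => /affinity_inj[]; rewrite ?oner_eq0 // => _ ->.
Qed.

Section Root.
Variable w : F.
Hypothesis ww : w ^+ 2 + w + 1 = 0.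

(** A commuting element permutes the two fixed points 0 and oo.  It cannot exchange
them: the map z -> b / z conjugates z -> w z to its inverse. *)
Lemma cent_affinity_w : 'C_G[affinity w 0] = [set affinity a 0 | a in [set~ 0]].
Proof.
have w0 := w_neq0 ww.
apply/setP=> g; apply/setIP/imsetP => [[gG /cent1P comm]|[a + ->]]; last first.
  rewrite in_setC1 => a0; split; first exact: affinity_in.
  by apply/cent1P; rewrite /commute !affinityM // mulrC !mulr0 !addr0.
have gS x : x \in [set None; Some 0] -> g x \in [set None; Some 0].
  rewrite -!(affinity_w_fix hF ww) -permM => /eqP E.
  by rewrite comm permM E.
have comm1 := congr1 (fun s : {perm option F} => s (Some 1)) comm.
have := gS None; rewrite !inE eqxx /= => /(_ isT)/orP[]/eqP gN.
  have [a [b [a0 gE]]] := fix_infty_affine gG gN; exists a; rewrite ?inE //.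
  have := gS (Some 0); rewrite gE !inE affinityE // mulr0 add0r eqxx orbT => /(_ isT) /=.
  by rewrite (inj_eq (@Some_inj _)) => /eqP->.
have g0 : g (Some 0) = None.
  have := gS (Some 0); rewrite !inE eqxx orbT => /(_ isT)/orP[/eqP//|/eqP g0].
  by have := etrans gN (esym g0) => /perm_inj.
have [a [b [c [d [nz gE]]]]] := homographyP gG.
move: gN g0; rewrite gE !homographyE //=.
case: eqVneq => // c0 [/eqP]; rewrite mulf_eq0 invr_eq0 (negPf c0) orbF => /eqP a0.
rewrite mulr0 add0r; case: eqVneq => // d0 _.
have gz z : z != 0 -> g (Some z) = Some (b / (c * z)).
  move=> z0; rewrite gE homographyE //= a0 d0 mul0r add0r addr0.
  by rewrite mulf_eq0 (negPf c0) (negPf z0).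
have b0 : b != 0 by move: nz; rewrite a0 mul0r sub0r oppr_eq0 mulf_eq0 negb_or => /andP[].
move: comm1; rewrite !permM [affinity w 0 (Some 1)]affinityE // addr0 mulr1.
rewrite !gz ?oner_eq0 // affinityE // addr0 mulr1 => -[] E.
have : w * w * (b / c) = b / c.
  by rewrite -mulrA E; field; rewrite w0 c0.
rewrite (w_sqr hF ww) mulrDl mul1r => /eqP.
by rewrite -subr_eq0 addrK !mulf_eq0 invr_eq0 (negPf w0) (negPf b0) (negPf c0).
Qed.

Lemma card_class_w : (#|(affinity w 0 ^: G)%g| * q.-1 = #|G|)%N.
Proof.
have <- : #|'C_G[affinity w 0]| = q.-1.
  rewrite cent_affinity_w card_in_imset ?cardsC1 // => a b; rewrite !inE => a0 b0.
  by case/(affinity_inj a0 b0).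
by rewrite -index_cent1 mulnC Lagrange // subsetIl.
Qed.

(** Conjugation by z -> 1 / z exchanges w and its inverse w + 1, so that all elements of
order 3 with fixed points form a single class. *)
Lemma affinity_w1_class : (affinity (w + 1) 0 \in affinity w 0 ^: G)%g.
Proof.
have nz : 0 * 0 - 1 * 1 != 0 :> F by rewrite mul0r sub0r mulr1 oppr_eq0 oner_eq0.
apply/imsetP; exists (homography 0 1 1 0); first exact: homography_in.
apply: (mulgI (homography 0 1 1 0)); rewrite conjgE mulKVg; apply/permP=> x.
have w0 := w_neq0 ww; have w10 := w1_neq0 hF ww.
pose h := homography (0 : F) 1 1 0; rewrite -/h !permM.
have hN : h None = Some 0 by rewrite homographyE //= oner_eq0 mul0r.
have hS z : h (Some z) = if z == 0 then None else Some z^-1.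
  by rewrite homographyE //= mul0r add0r mul1r addr0 mul1r.
case: x => [z|]; last by rewrite hN !affinityE // hN mulr0 addr0.
rewrite [affinity w 0 _]affinityE // addr0 !hS mulf_eq0 (negPf w0) /=.
case: eqVneq => z0; rewrite affinityE // addr0 invfM; congr (Some (_ * _)).
by apply: (mulfI w0); rewrite (w_mul1 hF ww) mulfV.
Qed.

Lemma sum_order3s :
  (q.-1 * \sum_(B in blocks) #|order3s B| = #|G| * (2 * 'C(q.-1 %/ 3, 4)))%N.
Proof.
under eq_bigr => B _ do rewrite order3sE.
rewrite double_count (eq_bigr (fun g => common_blocks g g)) => [|g _]; last by rewrite common_blocks_diag.
have sub : {subset (affinity w 0 ^: G)%g <= all_order3s}.
  move=> _ /imsetP[k kG ->]; rewrite inE groupJ ?affinity_in //.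
  by rewrite orderJ (order_affinity_w hF ww).
rewrite (bigID (fun g => g \in (affinity w 0 ^: G)%g)) /= [X in (_ + X)%N]big1 ?addn0; last first.
  move=> g /andP[g3]; apply: contraNeq; rewrite -lt0n => /card_gt0P[B].
  rewrite inE andbb => /andP[BB gS].
  have gO : g \in order3s B by rewrite order3sE inE g3.
  have cardB : #|B| = 13%N by rewrite inE in BB; exact/eqP.
  have [w' [ww' gw']] := order3_conj hF cardB gO.
  have := root3_cases hF ww ww' => /orP[]/eqP w'E; first by rewrite -w'E.
  by move: gw'; rewrite w'E (class_eqP affinity_w1_class).
rewrite (eq_bigl (fun g => g \in (affinity w 0 ^: G)%g)) => [|g]; last first.
  by rewrite andb_idl //; apply: sub.
rewrite sum_class => [|g k kG]; last exact: common_blocks_conj.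
by rewrite (common_blocks_order3 hF ww) mulnA [(q.-1 * _)%N]mulnC card_class_w.
Qed.

(** With the involution normalised to z -> z + 1, only the 2 q elements z -> m z + b
with m = w or w + 1 have a common block with it, by the classification: the
stabiliser then has order 12 and fixes a point, which is oo.  A translation, commuting
with the involution, takes b to 0. *)
Lemma sum_invols_order3s :
  (q * \sum_(B in blocks) #|invols B| * #|order3s B| = #|G| * (2 * q * ((q - 4) %/ 12)))%N.
Proof.
pose R B (p : {perm option F} * {perm option F}) := (p.1 \in stab B) && (p.2 \in stab B).
have E B : (#|invols B| * #|order3s B|)%N = #|[set p in setX all_invols all_order3s | R B p]|.
  rewrite -cardsX; apply: eq_card => -[g h].
  rewrite in_setX involsE order3sE !inE /R /=.
  by case: (g \in stab B); case: (h \in stab B); rewrite ?andbF ?andbT.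
under eq_bigr => B _ do rewrite E.
rewrite double_count (eq_bigr (fun p => common_blocks p.1 p.2)) => [|[g h] _]; last by [].
rewrite (eq_bigl (fun p : _ * _ => (p.1 \in all_invols) && (p.2 \in all_order3s))); last first.
  by move=> [g h]; rewrite in_setX.
rewrite -(pair_big (fun g => g \in all_invols) (fun h => h \in all_order3s) (fun g h => common_blocks g h)) /=.
rewrite {1}all_invols_class.
rewrite (sum_class (phi := fun g => \sum_(h in all_order3s) common_blocks g h)%N) => [|g k kG]; last first.
  rewrite (reindex_inj (@conjg_inj _ k)) /=; apply: eq_big => [h|h _]; last by rewrite common_blocks_conj.
  exact: order_setJ.
rewrite mulnA [(q * _)%N]mulnC -all_invols_class card_all_invols; congr muln.
pose W := [set x in [:: w; w + 1]].
have cardW : #|W| = 2%N.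
  rewrite cardsE; apply/card_uniqP; rewrite /= !inE.
  by rewrite -subr_eq0 opprD addrA subrr sub0r oppr_eq0 oner_eq0.
have WP m : m \in W -> m ^+ 2 + m + 1 = 0.
  by rewrite !inE => /orP[]/eqP-> //; apply: (w1_root hF ww).
pose A := [set affinity p.1 p.2 | p in setX W [set: F]].
(* The fixed point b / (m + 1) is translated from 0. *)
have AJ m b : m \in W ->
    affinity m b = (affinity m 0 ^ affinity 1 (b / (m + 1)))%g.
  move=> mW; have mm := WP m mW; have m0 := w_neq0 mm; have m10 := w1_neq0 hF mm.
  apply: (mulgI (affinity 1 (b / (m + 1)))); rewrite conjgE mulKVg.
  rewrite !affinityM ?oner_eq0 // mulr1 !mul1r add0r; congr affinity.
  rewrite -{2}[b](divfK m10) mulrDr mulr1 [_ * m]mulrC addrA (addff hF) //.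
  by rewrite add0r.
have sub : {subset A <= all_order3s}.
  move=> _ /imsetP[[m b] /setXP[/= mW _] ->]; have mm := WP m mW.
  apply/setIdP; split; first exact: affinity_in.
  by rewrite AJ // orderJ (order_affinity_w hF mm).
rewrite (bigID (fun g => g \in A)) /= [X in (_ + X)%N]big1 ?addn0; last first.
  move=> h /andP[h3]; apply: contraNeq; rewrite -lt0n => /card_gt0P[B].
  rewrite inE => /and3P[BB tS hS].
  have cardB : #|B| = 13%N by rewrite inE in BB; exact/eqP.
  have hO : h \in order3s B by rewrite order3sE inE h3.
  have tI : affinity 1 1 \in invols B by rewrite involsE inE all_invols_class class_refl.
  have O0 : #|order3s B| <> 0%N by move/eqP; rewrite cards_eq0 => /eqP E0; rewrite E0 inE in hO.
  have I0 : #|invols B| <> 0%N by move/eqP; rewrite cards_eq0 => /eqP E0; rewrite E0 inE in tI.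
  have [] := stabilisers hn hF cardB.
  - by case.
  - by case.
  - by case.
  - by case.
  - move=> _ [p pfix].
    have pN : p = None.
      have := pfix _ tS; rewrite affinityE ?oner_eq0 //; case: p pfix => [z|] //= _ [].
      by move/eqP; rewrite mul1r -subr_eq0 addrAC subrr add0r oner_eq0.
    rewrite {}pN in pfix; have hG := stab_in hS.
    have [m [b [m0 hE]]] := fix_infty_affine hG (pfix _ hS).
    apply/imsetP; exists (m, b); rewrite // in_setX in_setT andbT.
    have /setIdP[_ /eqP o3] := h3; have [h1 h_cube] := perm_order3 o3.
    rewrite !inE; apply: (root3_cases hF ww).
    have m3 : m ^+ 3 = 1.
      have := h_cube; rewrite hE !expgS expg0 mulg1 !affinityM ?mulf_neq0 // -affinity10.
      case/affinity_inj; rewrite ?mulf_neq0 ?oner_eq0 // => <- _.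
      by rewrite exprS expr2 mulrA.
    have m1 : m != 1.
      apply/eqP=> m1; move: h_cube; rewrite hE m1 expgS expg2 (affinity_sq hF) mulg1 => E1.
      by rewrite hE m1 E1 eqxx in h1.
    have : (m - 1) * (m ^+ 2 + m + 1) = m ^+ 3 - 1 by ring.
    by rewrite m3 subrr => /eqP; rewrite mulf_eq0 subr_eq0 (negPf m1) => /eqP.
  - by case.
  - by case.
rewrite (eq_bigl (fun g => g \in A)) => [|g]; last first.
  by rewrite andb_idl //; apply: sub.
rewrite big_imset => [|[m b] [m' b'] /setXP[/= mW _] /setXP[/= mW' _]]; last first.
  by case/affinity_inj; rewrite ?(w_neq0 (WP _ _)) // => -> ->.
rewrite (eq_bigr (fun => (q - 4) %/ 12)%N) => [|[m b] /setXP[/= mW _]].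
  by rewrite sum_nat_const cardsX cardW cardsT.
have tJ : (affinity 1 1 ^ affinity 1 (b / (m + 1)) = affinity 1 1)%g.
  apply: (mulgI (affinity 1 (b / (m + 1)))); rewrite conjgE mulKVg.
  by rewrite !affinityM ?oner_eq0 // !mul1r addrC.
rewrite /= (AJ m b mW) -{1}tJ common_blocks_conj ?affinity_in //.
by rewrite (common_blocks_invol_order3 hF (WP m mW)).
Qed.

End Root.
End Sums.

(** * Orbits of blocks by order of the stabiliser *)

Section Families.

Variables (F : finFieldType) (n : nat).
Hypothesis hn : (0 < n)%N.
Hypothesis hF : #|F| = (2 ^ n)%N.
Implicit Types (x y : option F) (g h k : {perm option F}).
Implicit Types B : {set option F}.
Implicit Types Bs : {set {set option F}}.
Notation G := (PSL2_group F).
Notation q := #|F|.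
Notation blocks := (blocks F).

Definition stable_family Bs := forall k B, k \in G -> B \in Bs -> k @: B \in Bs.

Lemma setactE B k : ('P^*)%act B k = k @: B.
Proof. by apply: eq_imset => x; rewrite /= apermE. Qed.

Lemma acts_on_family Bs : stable_family Bs -> [acts G, on Bs | 'P^*].
Proof.
move=> BsG; apply/actsP=> k kG B; rewrite setactE; apply/idP/idP; last exact: BsG.
move=> kB; suff -> : B = k^-1%g @: (k @: B) by apply: BsG; rewrite ?groupV.
by rewrite -imset_comp -[LHS]imset_id; apply: eq_imset => x /=; rewrite permK.
Qed.

Definition blocks_of s := [set B in blocks | #|stab B| == s].

Lemma blocks_of_stable s : stable_family (blocks_of s).
Proof.
move=> k B kG; rewrite !inE (card_imset _ (@perm_inj _ k)) => /andP[-> sB].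
by rewrite card_stab_conj.
Qed.

Notation orb B := (orbit 'P^* G B).

Lemma card_orbit_of s B : B \in blocks_of s -> (#|orb B| * s = #|G|)%N.
Proof.
by rewrite inE => /andP[_ /eqP <-]; rewrite stabE card_orbit_stab.
Qed.

Definition orbits_of s Bs := [set orb B | B in Bs :&: blocks_of s].

Lemma card_family_of s Bs : stable_family Bs ->
  (#|Bs :&: blocks_of s| * s = #|orbits_of s Bs| * #|G|)%N.
Proof.
move=> BsG; have IG : stable_family (Bs :&: blocks_of s).
  move=> k B kG /setIP[BB Bs']; apply/setIP; split; first exact: BsG.
  exact: blocks_of_stable.
rewrite -(acts_sum_card_orbit (acts_on_family IG)) big_distrl /=.
rewrite (eq_bigr (fun => #|G|)) ?sum_nat_const // => _ /imsetP[B /setIP[_ Bs'] ->].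
exact: card_orbit_of.
Qed.

Lemma blocksG : stable_family blocks.
Proof. by move=> k B kG; rewrite !inE (card_imset _ (@perm_inj _ k)). Qed.

Lemma card_blocks_of s : (#|blocks_of s| * s = #|orbits_of s blocks| * #|G|)%N.
Proof.
rewrite -(card_family_of s blocksG); congr (_ * _)%N; apply: eq_card => B.
by rewrite in_setI inE andbA andbb.
Qed.

Lemma leq_orbits_of s Bs : Bs \subset blocks -> (#|orbits_of s Bs| <= #|orbits_of s blocks|)%N.
Proof. by move=> sB; apply/subset_leq_card/imsetS/setSI. Qed.

(** Fixing an enumeration makes the choice of m orbits a function of s and m. *)
Definition first_orbits s m :=
  cover [set O in take m (enum (orbits_of s blocks))].

Lemma first_orbitsP s m : (m <= #|orbits_of s blocks|)%N ->
  [/\ stable_family (first_orbits s m), first_orbits s m \subset blocks_of s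
    & (#|first_orbits s m| * s = m * #|G|)%N].
Proof.
move=> le_m; rewrite /first_orbits; set C := [set O in _].
have CO : C \subset orbits_of s blocks.
  by apply/subsetP=> O; rewrite inE => /mem_take; rewrite mem_enum.
have Cm : #|C| = m.
  by rewrite cardsE (card_uniqP _) ?take_uniq ?enum_uniq // size_takel // -cardE.
have orbC O : O \in C -> exists2 B, B \in blocks_of s & O = orb B.
  by move/(subsetP CO) => /imsetP[B /setIP[_ Bs] ->]; exists B.
have triv : trivIset C.
  apply: trivIsetS CO _; apply: trivIsetS (imsetS _ (subsetIl _ _)) _.
  by have /and3P[] := orbit_partition (acts_on_family blocksG).
have sub O : O \in C -> O \subset blocks_of s.
  move=> /orbC[B Bs ->]; apply/subsetP=> _ /orbitP[k kG <-].
  by rewrite setactE; apply: blocks_of_stable.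
split.
- move=> k B kG /bigcupP[O OC BO]; apply/bigcupP; exists O => //.
  have [B' _ OE] := orbC O OC; move: BO; rewrite OE -setactE => /orbit_eqP <-.
  exact: mem_orbit.
- by apply/bigcupsP.
rewrite -(eqP triv) big_distrl /= -Cm -sum_nat_const.
by apply: eq_bigr => O /orbC[B Bs ->]; apply: card_orbit_of.
Qed.

(** As the order of the stabiliser is constant on orbits, this is the union over all s
of j s orbits of blocks with stabiliser of order s. *)
Definition family_with_orbits (j : nat -> nat) :=
  [set B in blocks | B \in first_orbits #|stab B| (j #|stab B|)].

Lemma family_with_orbitsP j : (forall s, j s <= #|orbits_of s blocks|)%N ->
  [/\ stable_family (family_with_orbits j), family_with_orbits j \subset blocks
    & forall s, (#|family_with_orbits j :&: blocks_of s| * s = j s * #|G|)%N].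
Proof.
move=> le_j; split=> [k B kG /setIdP[BB Bj]||s].
- apply/setIdP; split; first exact: blocksG.
  by rewrite card_stab_conj //; have [stj _ _] := first_orbitsP (le_j #|stab B|); apply: stj.
- by apply/subsetP=> B /setIdP[].
have [_ sub <-] := first_orbitsP (le_j s); congr (_ * _)%N; apply: eq_card => B.
apply/setIP/idP=> [[/setIdP[_ Bj] /setIdP[_ /eqP sB]]|Bj]; first by rewrite sB in Bj.
have := subsetP sub B Bj => /setIdP[BB sB]; split; last by apply/setIdP.
by apply/setIdP; rewrite (eqP sB).
Qed.

Definition stab_orders := [:: 1; 2; 3; 4; 12; 22; 26]%N.

Lemma stab_order_cases B : B \in blocks -> #|stab B| \in stab_orders.
Proof.
rewrite inE => /eqP cardB.
by case: (stabilisers hn hF cardB) => [] [-> _ _ _].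
Qed.

Lemma sum_by_order (phi : nat -> nat) Bs : Bs \subset blocks ->
  (\sum_(B in Bs) phi #|stab B| = \sum_(s <- stab_orders) phi s * #|Bs :&: blocks_of s|)%N.
Proof.
move=> sB.
transitivity (\sum_(B in Bs) \sum_(s <- stab_orders) (#|stab B| == s) * phi s)%N.
  apply: eq_bigr => B BB; have := stab_order_cases (subsetP sB B BB).
  move: #|stab B| => m; rewrite /stab_orders unlock /= !inE.
  by do 6?[case/orP]; move/eqP->; rewrite /= ?mul0n ?mul1n ?addn0 ?add0n.
rewrite exchange_big /=; apply: eq_bigr => s _.
rewrite -big_distrl /= mulnC; congr muln; rewrite -sum1_card.
rewrite [RHS](eq_bigl (fun B => (B \in Bs) && (#|stab B| == s))) ?big_mkcondr //.
move=> B; rewrite in_setI [in LHS]inE; case: (boolP (B \in Bs)) => // BB.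
by rewrite (subsetP sB).
Qed.

Lemma card_by_order Bs : Bs \subset blocks ->
  (#|Bs| = #|Bs :&: blocks_of 1| + #|Bs :&: blocks_of 2| + #|Bs :&: blocks_of 3|
    + #|Bs :&: blocks_of 4| + #|Bs :&: blocks_of 12| + #|Bs :&: blocks_of 22|
    + #|Bs :&: blocks_of 26|)%N.
Proof.
move=> sB; rewrite -sum1_card (sum_by_order (fun => 1%N) sB) /stab_orders.
by rewrite !big_cons big_nil !mul1n addn0 !addnA.
Qed.

Notation N s := #|blocks_of s|.

Lemma sum_blocks_by_order (phi : nat -> nat) :
  (\sum_(B in blocks) phi #|stab B| = phi 1 * N 1 + phi 2 * N 2 + phi 3 * N 3
    + phi 4 * N 4 + phi 12 * N 12 + phi 22 * N 22 + phi 26 * N 26)%N.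
Proof.
rewrite sum_by_order // /stab_orders !big_cons big_nil addn0 !addnA.
have E s : blocks :&: blocks_of s = blocks_of s.
  by apply/setIidPr/subsetP=> B; rewrite inE => /andP[].
by rewrite !E.
Qed.

Lemma card_blocks : (N 1 + N 2 + N 3 + N 4 + N 12 + N 22 + N 26 = 'C(q.+1, 13))%N.
Proof.
have := sum_blocks_by_order (fun => 1%N); rewrite !mul1n => <-.
by rewrite sum1_card -card_option; apply: card_draws.
Qed.

Lemma count_invols :
  (q * (N 2 + 3 * N 4 + 3 * N 12 + 11 * N 22 + 13 * N 26) = #|G| * 'C(q %/ 2, 6))%N.
Proof.
rewrite -(sum_invols hn hF); congr muln.
pose phi s := nth 0%N [:: 0; 0; 1; 0; 3; 0; 0; 0; 0; 0; 0; 0; 3; 0; 0; 0; 0; 0; 0; 0; 0; 0; 11; 0; 0; 0; 13]%N s.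
rewrite (eq_bigr (fun B => phi #|stab B|)) => [|B].
  by rewrite sum_blocks_by_order /phi /=; lia.
rewrite inE => /eqP cardB.
by case: (stabilisers hn hF cardB) => [] [-> -> _ _].
Qed.

Lemma count_comm_invols :
  (q * (6 * N 4 + 6 * N 12) = #|G| * ((q - 2) * 'C(q %/ 4, 3)))%N.
Proof.
rewrite -(sum_comm_invols hn hF); congr muln.
pose phi s := nth 0%N [:: 0; 0; 0; 0; 6; 0; 0; 0; 0; 0; 0; 0; 6]%N s.
rewrite (eq_bigr (fun B => phi #|stab B|)) => [|B].
  by rewrite sum_blocks_by_order /phi /=; lia.
rewrite inE => /eqP cardB.
by case: (stabilisers hn hF cardB) => [] [-> _ _ ->].
Qed.

Lemma count_order3s : ~~ odd n ->
  (q.-1 * (2 * N 3 + 8 * N 12) = #|G| * (2 * 'C(q.-1 %/ 3, 4)))%N.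
Proof.
case/(cube_root_iff hF) => w ww; rewrite -(sum_order3s hF ww); congr muln.
pose phi s := nth 0%N [:: 0; 0; 0; 2; 0; 0; 0; 0; 0; 0; 0; 0; 8]%N s.
rewrite (eq_bigr (fun B => phi #|stab B|)) => [|B].
  by rewrite sum_blocks_by_order /phi /=; lia.
rewrite inE => /eqP cardB.
by case: (stabilisers hn hF cardB) => [] [-> _ -> _].
Qed.

Lemma count_invols_order3s : ~~ odd n ->
  (q * (24 * N 12) = #|G| * (2 * q * ((q - 4) %/ 12)))%N.
Proof.
case/(cube_root_iff hF) => w ww; rewrite -(sum_invols_order3s hn hF ww); congr muln.
pose phi s := nth 0%N [:: 0; 0; 0; 0; 0; 0; 0; 0; 0; 0; 0; 0; 24]%N s.
rewrite (eq_bigr (fun B => phi #|stab B|)) => [|B].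
  by rewrite sum_blocks_by_order /phi /=; lia.
rewrite inE => /eqP cardB.
by case: (stabilisers hn hF cardB) => [] [-> -> -> _].
Qed.

Lemma no_order3s : odd n -> N 3 = 0%N /\ N 12 = 0%N.
Proof.
move=> n_odd; have no3 B : #|B| = 13%N -> #|order3s B| = 0%N.
  move=> cardB; apply/eqP; rewrite cards_eq0; apply/eqP/setP=> g; rewrite in_set0.
  apply/negP=> gO; have [w [ww _]] := order3_conj hF cardB gO.
  have : ~~ odd n by apply/(cube_root_iff hF); exists w.
  by rewrite n_odd.
by split; apply/eqP; rewrite cards_eq0; apply/eqP/setP=> B; rewrite !inE;
   apply/negP=> /andP[/eqP cardB /eqP sB]; have := no3 B cardB;
   case: (stabilisers hn hF cardB) => [] [E _ O _]; rewrite sB in E; rewrite // O.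
Qed.

(** All blocks with stabiliser of order 22 are equivalent, so they form one orbit, of
size |G| / 22, or none. *)
Lemma card_blocks22 : (N 22 * 22 = (n %% 10 == 0) * #|G|)%N.
Proof.
case: eqP => n10.
  have [a aP] : exists a : F, 11.-primitive_root a by apply/(order11_iff hF)/eqP.
  have [s22 _ _ _] := stab_type_block11 hF aP.
  have b22 : block11 F \in blocks_of 22 by rewrite !inE (card_block11 aP) s22.
  rewrite mul1n -(card_orbit_of b22); congr muln; apply: eq_card => B.
  apply/idP/orbitP=> [|[k kG <-]]; last first.
    by rewrite setactE; apply: blocks_of_stable.
  rewrite !inE => /andP[/eqP cardB /eqP sB].
  case: (stabilisers hn hF cardB) => [] [E _ _ _]; rewrite ?E // in sB *.
  by move=> _ [k kG ->]; exists k; rewrite // setactE.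
rewrite mul0n; apply/eqP; rewrite muln_eq0 orbF cards_eq0; apply/eqP/setP=> B; rewrite !inE.
apply/negP=> /andP[/eqP cardB /eqP sB]; case: n10; apply/eqP/(order11_iff hF).
by case: (stabilisers hn hF cardB) => [] [E _ _ _]; rewrite ?E // in sB.
Qed.

(** All blocks with stabiliser of order 26 are equivalent, so they form one orbit, of
size |G| / 26, or none. *)
Lemma card_blocks26 : (N 26 * 26 = (n %% 6 == 0) * #|G|)%N.
Proof.
have sub B : B \in blocks_of 26 -> exists c k, [/\ psi c = 0, k \in G & B = k @: block13 c].
  rewrite !inE => /andP[/eqP cardB /eqP sB].
  by case: (stabilisers hn hF cardB) => [] [E _ _ _]; rewrite ?E // in sB.
case: eqP => n6.
  have [c cr] : exists c : F, psi c = 0 by apply/(psi_root_iff hF)/eqP.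
  have cardB := card_block13 hF cr.
  have b26 : block13 c \in blocks_of 26.
    rewrite !inE cardB /=; have := order_dvdG (turn_stab13 c); rewrite (order_turn hF cr).
    by case: (stabilisers hn hF cardB) => [] [-> _ _ _].
  rewrite mul1n -(card_orbit_of b26); congr muln; apply: eq_card => B.
  apply/idP/orbitP=> [|[k kG <-]]; last first.
    by rewrite setactE; apply: blocks_of_stable.
  case/sub => c' [k [cr' kG ->]]; have [k' kG' ->] := block13_conj hF cr cr'.
  exists (k' * k)%g; first by rewrite groupM.
  by rewrite setactE -[RHS]imset_comp; apply: eq_imset => x /=; rewrite permM.
rewrite mul0n; apply/eqP; rewrite muln_eq0 orbF cards_eq0; apply/eqP/setP=> B; rewrite in_set0.
apply/negP=> /sub[c [k [cr _ _]]]; case: n6; apply/eqP/(psi_root_iff hF).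
by exists c.
Qed.

End Families.

(** * Rational arithmetic *)

Lemma ffactR (R : comPzRingType) (m k : nat) :
  (m ^_ k)%:R = \prod_(i < k) (m%:R - i%:R) :> R.
Proof.
elim: k => [|k IHk]; first by rewrite ffactn0 big_ord0.
rewrite ffactnSr natrM IHk big_ord_recr /=.
have [le_km|lt_mk] := leqP k m; first by rewrite natrB.
by rewrite -IHk ffact_small // !mul0r.
Qed.

Lemma binR (m k : nat) : 'C(m, k)%:R * k`!%:R = \prod_(0 <= i < k) (m%:R - i%:R) :> rat.
Proof. by rewrite -natrM bin_ffact ffactR big_mkord. Qed.

Lemma factR_neq0 (k : nat) : k`!%:R != 0 :> rat.
Proof. by rewrite pnatr_eq0 -lt0n fact_gt0. Qed.

Lemma bin3R (m : nat) (x : rat) : m%:R = x ->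
  'C(m, 3)%:R = x * (x - 1) * (x - 2%:R) / 6%:R :> rat.
Proof.
move=> mx; have := binR m 3; rewrite mx.
have -> : 3`!%:R = 6%:R :> rat by rewrite !factS fact0 !natrM; ring.
have : 6%:R != 0 :> rat.
  by [].
move: 6%:R => c c0; rewrite unlock /= => E.
by rewrite -['C(m, 3)%:R](mulfK c0) E; congr (_ / _); ring.
Qed.

Lemma bin4R (m : nat) (x : rat) : m%:R = x ->
  'C(m, 4)%:R = x * (x - 1) * (x - 2%:R) * (x - 3%:R) / 24%:R :> rat.
Proof.
move=> mx; have := binR m 4; rewrite mx.
have -> : 4`!%:R = 24%:R :> rat by rewrite !factS fact0 !natrM; ring.
have : 24%:R != 0 :> rat.
  by [].
move: 24%:R => c c0; rewrite unlock /= => E.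
by rewrite -['C(m, 4)%:R](mulfK c0) E; congr (_ / _); ring.
Qed.

Lemma bin6R (m : nat) (x : rat) : m%:R = x ->
  'C(m, 6)%:R = x * (x - 1) * (x - 2%:R) * (x - 3%:R) * (x - 4%:R) * (x - 5%:R) / 720%:R :> rat.
Proof.
move=> mx; have := binR m 6; rewrite mx.
have -> : 6`!%:R = 720%:R :> rat by rewrite !factS fact0 !natrM; ring.
have : 720%:R != 0 :> rat.
  by rewrite pnatr_eq0.
move: 720%:R => c c0; rewrite unlock /= => E.
by rewrite -['C(m, 6)%:R](mulfK c0) E; congr (_ / _); ring.
Qed.

Lemma fact13R : 6227020800%:R = 13%:R * 12%:R * 11%:R * 10%:R * 9%:R * 8%:R * 7%:R
  * 6%:R * 5%:R * 4%:R * 3%:R * 2%:R :> rat.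
Proof. by ring. Qed.

Lemma fact13N (c : rat) : c = 13%:R * 12%:R * 11%:R * 10%:R * 9%:R * 8%:R * 7%:R
  * 6%:R * 5%:R * 4%:R * 3%:R * 2%:R -> 13`!%:R = c.
Proof. by move=> ->; rewrite !factS fact0 !natrM; ring. Qed.

Lemma bin13R (m : nat) (x c : rat) : m%:R = x ->
  c = 13%:R * 12%:R * 11%:R * 10%:R * 9%:R * 8%:R * 7%:R * 6%:R * 5%:R * 4%:R * 3%:R * 2%:R ->
  'C(m, 13)%:R = x * (x - 1) * (x - 2%:R) * (x - 3%:R) * (x - 4%:R) * (x - 5%:R) * (x - 6%:R) * (x - 7%:R) * (x - 8%:R) * (x - 9%:R) * (x - 10%:R) * (x - 11%:R) * (x - 12%:R) / c :> rat.
Proof.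
move=> mx cE; have E := binR m 13.
have F := fact13N cE.
have c0 := factR_neq0 13.
rewrite F in c0.
rewrite F in E.
rewrite {}mx in E.
rewrite unlock /= in E.
rewrite -['C(m, 13)%:R](mulfK c0) E.
congr (_ / _).
ring.
Qed.

(** The relation that counts involutions, solved for the number of orbits with
stabiliser of order 2.  The unknown m12 cancels: the orders 4 and 12 enter together
through the Klein four-groups. *)
Lemma solve_m2 (R : numFieldType) (Q g m2 m12 m22 m26 : R) (Q0 : Q != 0) (g0 : g != 0) :
  Q * (m2 * g / 2%:R + 3%:R * (((Q - 2%:R) * (Q - 4%:R) * (Q - 8%:R) / 576%:R - m12 / 3%:R) * g / 4%:R)
    + 3%:R * (m12 * g / 12%:R) + 11%:R * (m22 * g / 22%:R) + 13%:R * (m26 * g / 26%:R))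
  = g * (Q / 2%:R * (Q / 2%:R - 1) * (Q / 2%:R - 2%:R) * (Q / 2%:R - 3%:R)
         * (Q / 2%:R - 4%:R) * (Q / 2%:R - 5%:R) / 720%:R) ->
  m2 = 1 / 23040%:R * Q * (Q - 2%:R) * (Q - 4%:R) * (Q - 8%:R) * (Q - 16%:R) - m26 - m22.
Proof.
have -> : Q * (m2 * g / 2%:R + 3%:R * (((Q - 2%:R) * (Q - 4%:R) * (Q - 8%:R) / 576%:R - m12 / 3%:R) * g / 4%:R)
    + 3%:R * (m12 * g / 12%:R) + 11%:R * (m22 * g / 22%:R) + 13%:R * (m26 * g / 26%:R))
  = Q * g * (m2 / 2%:R + (Q - 2%:R) * (Q - 4%:R) * (Q - 8%:R) / 768%:R + m22 / 2%:R + m26 / 2%:R) by field.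
have -> : g * (Q / 2%:R * (Q / 2%:R - 1) * (Q / 2%:R - 2%:R) * (Q / 2%:R - 3%:R)
         * (Q / 2%:R - 4%:R) * (Q / 2%:R - 5%:R) / 720%:R)
   = Q * g * ((Q - 2%:R) * (Q - 4%:R) * (Q - 6%:R) * (Q - 8%:R) * (Q - 10%:R) / 46080%:R) by field.
move/(mulfI (mulf_neq0 Q0 g0)) => E.
have -> : m2 = 2%:R * (m2 / 2%:R + (Q - 2%:R) * (Q - 4%:R) * (Q - 8%:R) / 768%:R + m22 / 2%:R + m26 / 2%:R)
   - (Q - 2%:R) * (Q - 4%:R) * (Q - 8%:R) / 384%:R - m22 - m26 by field.
rewrite E.
by field.
Qed.

(** The count of all 13-subsets of a set with q + 1 elements, solved for the number of
regular orbits; c stands for 13!. *)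
Lemma solve_m1 (R : numFieldType) (Q c m1 m2 m3 m4 m12 m22 m26 : R)
    (g := (Q + 1) * (Q * (Q - 1))) (g0 : g != 0) (c0 : c != 0) :
  m2 = 1 / 23040%:R * Q * (Q - 2%:R) * (Q - 4%:R) * (Q - 8%:R) * (Q - 16%:R) - m26 - m22 ->
  m4 = (Q - 2%:R) * (Q - 4%:R) * (Q - 8%:R) / 576%:R - m12 / 3%:R ->
  m1 * g / 1%:R + m2 * g / 2%:R + m3 * g / 3%:R + m4 * g / 4%:R + m12 * g / 12%:R
    + m22 * g / 22%:R + m26 * g / 26%:R
  = (Q + 1) * (Q + 1 - 1) * (Q + 1 - 2%:R) * (Q + 1 - 3%:R) * (Q + 1 - 4%:R)
    * (Q + 1 - 5%:R) * (Q + 1 - 6%:R) * (Q + 1 - 7%:R) * (Q + 1 - 8%:R)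
    * (Q + 1 - 9%:R) * (Q + 1 - 10%:R) * (Q + 1 - 11%:R) * (Q + 1 - 12%:R) / c ->
  m1 = 1 / c * (Q - 2%:R) * (Q - 3%:R) * (Q - 4%:R) * (Q - 5%:R)
    * (Q - 6%:R) * (Q - 7%:R) * (Q - 8%:R) * (Q - 9%:R) * (Q - 10%:R) * (Q - 11%:R)
    - 1 / 46080%:R * (Q - 2%:R) * (Q - 4%:R) * (Q - 6%:R) * (Q - 8%:R) * (Q - 10%:R)
    + 1 / 1152%:R * (Q - 2%:R) * (Q - 4%:R) * (Q - 8%:R)
    - m3 / 3%:R + m26 * (6%:R / 13%:R) + m22 * (5%:R / 11%:R).
Proof.
move=> m2E m4E.
have -> : m1 * g / 1%:R + m2 * g / 2%:R + m3 * g / 3%:R + m4 * g / 4%:R + m12 * g / 12%:R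
    + m22 * g / 22%:R + m26 * g / 26%:R =
  g * (m1 + m2 / 2%:R + m3 / 3%:R + m4 / 4%:R + m12 / 12%:R + m22 / 22%:R + m26 / 26%:R).
  by field.
have -> : (Q + 1) * (Q + 1 - 1) * (Q + 1 - 2%:R) * (Q + 1 - 3%:R) * (Q + 1 - 4%:R)
    * (Q + 1 - 5%:R) * (Q + 1 - 6%:R) * (Q + 1 - 7%:R) * (Q + 1 - 8%:R)
    * (Q + 1 - 9%:R) * (Q + 1 - 10%:R) * (Q + 1 - 11%:R) * (Q + 1 - 12%:R) / c
  = g * ((Q - 2%:R) * (Q - 3%:R) * (Q - 4%:R) * (Q - 5%:R)
    * (Q - 6%:R) * (Q - 7%:R) * (Q - 8%:R) * (Q - 9%:R) * (Q - 10%:R) * (Q - 11%:R) / c).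
  by rewrite /g; field.
move/(mulfI g0) => E.
set x := (X in X / c) in E.
rewrite -[LHS](addrK (m2 / 2%:R + m3 / 3%:R + m4 / 4%:R + m12 / 12%:R + m22 / 22%:R + m26 / 26%:R)).
rewrite !addrA E m2E m4E /x.
by field.
Qed.

Section Residues.
Variable n : nat.
Let b6 := (n %% 6 == 0)%N.
Let b10 := (n %% 10 == 0)%N.

(** All conditions on n depend on n mod 60 only, so that they can be compared on the
60 residues. *)
Lemma residue60 (P : nat -> bool -> bool -> bool -> bool) :
  all (fun r => P r (odd r) (r %% 6 == 0)%N (r %% 10 == 0)%N) (iota 0 60) ->
  P (n %% 60)%N (odd n) b6 b10.
Proof.
have -> : odd n = odd (n %% 60) by rewrite {1}(divn_eq n 60) oddD oddM andbF.
rewrite /b6 /b10 -(@modn_dvdm 60 n 6) // -(@modn_dvdm 60 n 10) //.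
by move/allP; apply; rewrite mem_iota ltn_mod.
Qed.

Lemma m858E : m858 n = W n - b6%:R - b10%:R.
Proof.
rewrite /m858.
have /eqP -> := @residue60 (fun r _ b c => (r \in [:: 6; 10; 12; 18; 20; 24; 36; 40; 42; 48; 50; 54]%N) == b (+) c) isT.
have /eqP -> := @residue60 (fun r _ b c => (r \in [:: 0; 30]%N) == b && c) isT.
by move: (W n) => w; case: b6; case: b10 => /=; ring.
Qed.

Lemma m1716E : m1716 n = X' n + (~~ odd n)%:R * Y n + b6%:R * (6%:R / 13%:R) + b10%:R * (5%:R / 11%:R).
Proof.
rewrite /m1716.
have := @residue60 (fun r o b c => [&& o ==> ~~ b && ~~ c,
   ~~ o ==> ((r \in [:: 2; 4; 8; 14; 16; 22; 26; 28; 32; 34; 38; 44; 46; 52; 56; 58]%N) == ~~ b && ~~ c),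
   (r \in [:: 10; 20; 40; 50]%N) == ~~ b && c &
   (r \in [:: 6; 12; 18; 24; 36; 42; 48; 54]%N) == b && ~~ c]) isT.
case/and4P => + + /eqP -> /eqP ->; move: (X' n) (Y n) => x y.
case: (odd n) => /= [/andP[/negPf -> /negPf ->] _|_ /eqP ->]; first by rewrite /=; field.
by case: b6; case: b10 => /=; field.
Qed.
End Residues.

(** * The numbers of orbits *)

Lemma pow2_div4R (R : numFieldType) (n : nat) : (1 < n)%N -> (2 ^ n %/ 4)%:R = (2%:R ^+ n) / 4%:R :> R.
Proof.
case: n => [|[|n]] // _; rewrite !expnS mulnA mulKn // !exprS mulrA -natrM.
by rewrite mulrC mulrA mulVf ?mul1r ?natrX // pnatr_eq0.
Qed.

Section Multiplicities.

Variables (F : finFieldType) (n : nat).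
Hypothesis hn : (0 < n)%N.
Hypothesis hF : #|F| = (2 ^ n)%N.
Notation G := (PSL2_group F).
Notation q := #|F|.
Local Notation Q := (qn n).
Local Notation N s := (#|blocks_of F s|%:R : rat).
Local Notation M s := (#|orbits_of s (blocks F)|%:R : rat).

Lemma qR : q%:R = Q.
Proof. by rewrite hF natrX. Qed.

Lemma q_gt1 : (1 < q)%N.
Proof. by rewrite hF -(expn0 2) ltn_exp2l. Qed.

Lemma Q_neq0 : Q != 0.
Proof. by rewrite -qR pnatr_eq0 -lt0n (ltnW q_gt1). Qed.

Lemma qpredR : q.-1%:R = Q - 1.
Proof. by rewrite -subn1 natrB ?qR // ltnW // q_gt1. Qed.

Lemma Qm1_neq0 : Q - 1 != 0.
Proof. by rewrite -qpredR pnatr_eq0 -lt0n -subn1 subn_gt0 q_gt1. Qed.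

Lemma cardGR : #|G|%:R = (Q + 1) * (Q * (Q - 1)) :> rat.
Proof. by rewrite card_PSL2 !natrM qpredR qR -addn1 natrD qR. Qed.

Lemma cardG_neq0 : #|G|%:R != 0 :> rat.
Proof. by rewrite pnatr_eq0 -lt0n cardG_gt0. Qed.

Lemma halfR : (q %/ 2)%:R = Q / 2%:R.
Proof.
rewrite hF /qn; case: n hn => // m _; rewrite expnS mulKn // exprS.
by rewrite mulrC mulrA mulVf ?mul1r ?natrX // pnatr_eq0.
Qed.

Lemma even_card_mod3 : ~~ odd n -> (3 %| q.-1)%N.
Proof.
move=> n_even; rewrite (dvdn_pred_card hF) // (@modn_pow2 3 2) // modn2.
by rewrite (negPf n_even).
Qed.

Lemma third_R : ~~ odd n -> (q.-1 %/ 3)%:R = (Q - 1) / 3%:R.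
Proof. by move=> n_even; rewrite natf_div ?even_card_mod3 // qpredR. Qed.

Lemma twelfth_R : ~~ odd n -> ((q - 4) %/ 12)%:R = (Q - 4%:R) / 12%:R.
Proof.
move=> n_even; have n_gt1 : (1 < n)%N by case: n hn n_even => [|[|]].
have q4 : (4 <= q)%N by rewrite hF (@leq_exp2l 2 2).
rewrite natf_div ?natrB ?qR // (@Gauss_dvd 4 3) //; apply/andP; split.
  by rewrite dvdn_sub // hF (@dvdn_exp2l 2 2).
have -> : (q - 4)%N = (q.-1 - 3)%N by rewrite -subn1 -subnDA.
by rewrite dvdn_sub // even_card_mod3.
Qed.

(** For n = 1 the quotient of q by 4 is not exact, but the factor q - 2 vanishes. *)
Lemma fourth_R : (q - 2)%:R * 'C(q %/ 4, 3)%:R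
   = (Q - 2%:R) * (Q / 4%:R * (Q / 4%:R - 1) * (Q / 4%:R - 2%:R) / 6%:R) :> rat.
Proof.
rewrite natrB ?q_gt1 // qR; have [n1|n_gt1] := leqP n 1.
  have -> : Q = 2%:R by rewrite /qn (_ : n = 1%N) ?expr1 //; apply/eqP; rewrite eqn_leq n1.
  by rewrite subrr !mul0r.
by congr (_ * _); apply: bin3R; rewrite hF pow2_div4R.
Qed.

Lemma card_blocksR s : (0 < s)%N -> N s = M s * #|G|%:R / s%:R.
Proof.
move=> s0; rewrite -natrM -card_blocks_of natrM mulfK // pnatr_eq0 -lt0n //.
Qed.

Lemma orbits26 : M 26 = (n %% 6 == 0)%N%:R.
Proof.
apply: (mulIf cardG_neq0); rewrite -!natrM -card_blocks_of.
by rewrite (card_blocks26 hn hF).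
Qed.

Lemma orbits22 : M 22 = (n %% 10 == 0)%N%:R.
Proof.
apply: (mulIf cardG_neq0); rewrite -!natrM -card_blocks_of.
by rewrite (card_blocks22 hn hF).
Qed.

Lemma orbits12 : M 12 = m143 n.
Proof.
have E := card_blocks_of F 12.
rewrite /m143; case: (boolP (odd n)) => n_odd.
  have [_ N12] := no_order3s hn hF n_odd.
  move: E; rewrite N12 mul0n => /esym/eqP; rewrite muln_eq0 [#|G| == _]eqn0Ngt cardG_gt0 orbF.
  by move/eqP->.
have := congr1 (fun m : nat => m%:R : rat) (count_invols_order3s hn hF n_odd).
rewrite !natrM twelfth_R // qR (card_blocksR (isT : (0 < 12)%N)) => H.
have g0 := cardG_neq0; have Q0 := Q_neq0.
apply: (mulIf g0); apply: (mulIf Q0).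
transitivity (Q * (24%:R * (M 12 * #|G|%:R / 12%:R)) / 2%:R); first by field.
by rewrite H; field.
Qed.

Lemma orbits4 : M 4 = (Q - 2%:R) * (Q - 4%:R) * (Q - 8%:R) / 576%:R - M 12 / 3%:R.
Proof.
have := congr1 (fun m : nat => m%:R : rat) (count_comm_invols hn hF).
rewrite !natrM natrD !natrM fourth_R qR !card_blocksR // => H.
have g0 := cardG_neq0; have Q0 := Q_neq0.
apply: (mulIf g0); apply: (mulIf Q0).
transitivity ((Q * (6%:R * (M 4 * #|G|%:R / 4%:R) + 6%:R * (M 12 * #|G|%:R / 12%:R))) * 2%:R / 3%:R
   - M 12 / 3%:R * #|G|%:R * Q); first by field.
by rewrite H; field.
Qed.

Lemma orbits4E : M 4 = m429 n.
Proof.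
rewrite orbits4 orbits12 /m429 /m143; case: (odd n); first by rewrite mul0r subr0.
by field.
Qed.

Lemma orbits3 : M 3 = m572 n.
Proof.
have E := card_blocks_of F 3.
rewrite /m572; case: (boolP (odd n)) => n_odd.
  have [N3 _] := no_order3s hn hF n_odd.
  move: E; rewrite N3 mul0n => /esym/eqP; rewrite muln_eq0 [#|G| == _]eqn0Ngt cardG_gt0 orbF.
  by move/eqP->.
have := congr1 (fun m : nat => m%:R : rat) (count_order3s hn hF n_odd).
rewrite !natrM natrD !natrM qpredR (bin4R (third_R n_odd)) !card_blocksR // orbits12 /m143 (negPf n_odd) => H.
have g0 := cardG_neq0; have Q0 := Qm1_neq0.
apply: (mulIf g0); apply: (mulIf Q0).
transitivity ((Q - 1) * (2%:R * (M 3 * #|G|%:R / 3%:R) + 8%:R * ((Q - 4%:R) / 12%:R * #|G|%:R / 12%:R)) * 3%:R / 2%:R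
   - (Q - 4%:R) / 12%:R * #|G|%:R * (Q - 1)); first by field.
by rewrite H; field.
Qed.

Lemma orbits2 : M 2 = m858 n.
Proof.
have := congr1 (fun m : nat => m%:R : rat) (count_invols hn hF).
rewrite !natrM 4!natrD !natrM (bin6R halfR) qR !card_blocksR // orbits4 => H.
rewrite m858E -orbits22 -orbits26.
exact: (solve_m2 Q_neq0 cardG_neq0 H).
Qed.

Lemma Y_m572 : (~~ odd n)%:R * Y n = - (m572 n / 3%:R).
Proof.
rewrite /Y /m572; case: (odd n) => /=; first by rewrite mul0r mul0r oppr0.
by field.
Qed.

Lemma qSR : q.+1%:R = Q + 1.
Proof. by rewrite -addn1 natrD qR. Qed.

Lemma orbits1 : M 1 = m1716 n.
Proof.
have g0 := cardG_neq0; rewrite cardGR in g0.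
have := congr1 (fun m : nat => m%:R : rat) (card_blocks hn hF).
rewrite 6!natrD !card_blocksR // cardGR (bin13R qSR fact13R) => H.
have orbits2W := orbits2; rewrite m858E -orbits22 -orbits26 in orbits2W.
have c0 := factR_neq0 13; rewrite (fact13N fact13R) in c0.
rewrite m1716E Y_m572 -orbits3 -orbits22 -orbits26.
exact: (solve_m1 g0 c0 orbits2W orbits4 H).
Qed.

End Multiplicities.

(** * Designs *)

(** A family with m s blocks of type s consists of j s = m s * s / g orbits of that type,
each of which contributes 1716 / s to lambda. *)
Lemma lambda_of_counts (lambda g b : nat) (j m : nat -> nat) :
  (0 < g)%N ->
  (b = m 1 + m 2 + m 3 + m 4 + m 12 + m 22 + m 26)%N ->
  (forall s, m s * s = j s * g)%N ->
  (lambda * g = 1716 * b)%N <-> lambda = (66 * j 26 + 78 * j 22 + 143 * j 12 + 429 * j 4 + 572 * j 3 + 858 * j 2 + 1716 * j 1)%N.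
Proof.
move=> g0 -> c.
suff -> : (1716 * (m 1 + m 2 + m 3 + m 4 + m 12 + m 22 + m 26) = (66 * j 26 + 78 * j 22
    + 143 * j 12 + 429 * j 4 + 572 * j 3 + 858 * j 2 + 1716 * j 1) * g)%N.
  by split=> [/eqP|->//]; rewrite eqn_pmul2r // => /eqP.
move: (c 1%N) (c 2%N) (c 3%N) (c 4%N) (c 12%N) (c 22%N) (c 26%N) => {c}.
move: (m 1%N) (m 2%N) (m 3%N) (m 4%N) (m 12%N) (m 22%N) (m 26%N) => m1 m2 m3 m4 m5 m6 m7.
move: (j 1%N) (j 2%N) (j 3%N) (j 4%N) (j 12%N) (j 22%N) (j 26%N) => j1 j2 j3 j4 j5 j6 j7.
move=> c1 c2 c3 c4 c5 c6 c7; rewrite 6!mulnDl.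
rewrite -(mulnA _ j1) -(mulnA _ j2) -(mulnA _ j3) -(mulnA _ j4) -(mulnA _ j5).
rewrite -(mulnA _ j6) -(mulnA _ j7) -c1 -c2 -c3 -c4 -c5 -c6 -c7; lia.
Qed.

Lemma bound_orbits (m : nat) (mu : rat) (i : int) : m%:R = mu ->
  (0 <= i%:Q <= mu) = (0 <= i <= m%:Z).
Proof. by move=> <-; rewrite -[m%:R]/(m%:Z%:Q) ler0z ler_int. Qed.

Lemma bound_orbitsP (m : nat) (mu : rat) (i : int) : m%:R = mu ->
  0 <= i%:Q <= mu -> exists2 j : nat, i = j & (j <= m)%N.
Proof. by move=> /bound_orbits ->; case: i => // j; exists j. Qed.

Section Designs.

Variables (F : finFieldType) (n : nat).
Hypothesis hn : (0 < n)%N.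
Hypothesis hF : #|F| = (2 ^ n)%N.
Implicit Types (x y : option F) (g h k : {perm option F}).
Implicit Types B S : {set option F}.
Implicit Types Bs : {set {set option F}}.
Notation G := (PSL2_group F).
Notation q := #|F|.
Notation blocks := (blocks F).

Definition covering Bs S := #|[set A in Bs | S \subset A]|.

Lemma imset_perm_inj k : injective (fun B : {set option F} => k @: B).
Proof. by apply: imset_inj; apply: perm_inj. Qed.

Lemma covering_im Bs S k : stable_family Bs -> k \in G ->
  covering Bs (k @: S) = covering Bs S.
Proof.
move=> BsG kG; rewrite /covering -[RHS](card_imset _ (imset_perm_inj (k := k))).
apply: eq_card => B; apply/setIdP/imsetP=> [[BB SB]|[A /setIdP[AB SA] ->]]; last first.
  by split; [exact: BsG | exact: imsetS].
have BE : k @: (k^-1%g @: B) = B.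
  by rewrite -imset_comp -[RHS]imset_id; apply: eq_imset => x /=; rewrite permKV.
exists (k^-1%g @: B) => //; apply/setIdP; split; first by apply: BsG; rewrite ?groupV.
apply/subsetP=> x xS; have : k x \in B by apply: (subsetP SB); apply: imset_f.
by rewrite -{1}BE mem_imset //; apply: perm_inj.
Qed.

Definition triple0 : {set option F} := [set None; Some 0; Some 1].

Lemma triple_im S : #|S| = 3%N -> exists2 k, k \in G & S = k @: triple0.
Proof.
move=> S3; have /card_gt2P[x [y [z [[xS yS zS] [xy yz zx]]]]] : (2 < #|S|)%N by rewrite S3.
rewrite eq_sym in zx; have [k kG [kx ky kz]] := three_transitive xy yz zx.
exists k => //; rewrite /triple0 !imsetU !imset_set1 kx ky kz.
apply/esym/eqP; rewrite eqEcard S3; apply/andP; split.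
  by apply/subsetP=> t; rewrite !inE => /orP[/orP[]|]/eqP->.
by rewrite -setUA !cardsU1 cards1 !inE negb_or xy zx yz.
Qed.

(** By transitivity on 3-subsets all of them lie in equally many blocks; then count the
incident pairs, with 286 triples in each block and |G| / 6 triples in all. *)
Lemma covering_count Bs S : stable_family Bs -> Bs \subset blocks -> #|S| = 3%N ->
  (covering Bs S * #|G| = 1716 * #|Bs|)%N.
Proof.
move=> BsG sB S3.
have cov (T : {set option F}) : #|T| = 3%N -> covering Bs T = covering Bs S.
  move=> T3; have [k kG ->] := triple_im T3; have [k' kG' ->] := triple_im S3.
  by rewrite !covering_im.
have E : (286 * #|Bs| = 'C(q.+1, 3) * covering Bs S)%N.
  have := double_count Bs [set T : {set option F} | #|T| == 3%N] (fun B T => T \subset B).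
  rewrite (eq_bigr (fun => 286%N)) => [|B BB].
    rewrite sum_nat_const mulnC => ->; rewrite -card_option -card_draws -sum_nat_const.
    by apply: eq_bigr => T; rewrite inE => /eqP/cov.
  have /eqP cardB : #|B| == 13%N by have := subsetP sB B BB; rewrite inE.
  transitivity 'C(#|B|, 3); last by rewrite cardB.
  by rewrite -cards_draws; apply: eq_card => T; rewrite !inE andbC.
have C3 : ('C(q.+1, 3) * 6 = #|G|)%N.
  rewrite card_PSL2 -[6%N]/(3`!) bin_ffact !ffactnS ffactn0 muln1 /=.
  by case: #|F|.
by rewrite -C3 mulnC -mulnA [(6 * _)%N]mulnC mulnA -E mulnAC.
Qed.

Lemma stable_familyP Bs : stable_family Bs <-> PSL2 F \subset design_aut Bs.
Proof.
split=> [BsG|/subsetP aut].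
  apply/subsetP=> k kG; rewrite inE eqEcard (card_imset _ (imset_perm_inj (k := k))) leqnn andbT.
  by apply/subsetP=> _ /imsetP[B BB ->]; apply: BsG.
move=> k B kG BB; have := aut k kG; rewrite inE => /eqP E.
by rewrite -E; apply/imsetP; exists B.
Qed.

Lemma designP Bs lambda : stable_family Bs ->
  simple_design 3 (2 ^ n + 1) 13 lambda Bs <->
  Bs \subset blocks /\ (lambda * #|G| = 1716 * #|Bs|)%N.
Proof.
move=> BsG; split=> [[_ B13 Bcov]|[sB E]].
  have sB : Bs \subset blocks by apply/subsetP=> B /B13 BE; rewrite inE BE.
  have t3 : #|triple0| = 3%N.
    rewrite /triple0 -setUA !cardsU1 cards1 !inE /= (inj_eq (@Some_inj _)).
    by rewrite eq_sym oner_eq0.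
  by split=> //; rewrite -(covering_count BsG sB t3) /covering Bcov.
split.
- by rewrite card_option hF addn1.
- by move=> B /(subsetP sB); rewrite inE => /eqP.
move=> S S3; apply/eqP; rewrite -(eqn_pmul2r (cardG_gt0 G)) E.
exact/eqP/covering_count.
Qed.

Lemma orbits26_m66 : #|orbits_of 26 blocks|%:R = m66 n.
Proof. by rewrite (orbits26 hn hF) /m66; case: eqP. Qed.

Lemma orbits22_m78 : #|orbits_of 22 blocks|%:R = m78 n.
Proof. by rewrite (orbits22 hn hF) /m78; case: eqP. Qed.

End Designs.

Theorem theorem6p1 (n lambda : nat) (F : finFieldType)
    (hn : (1 <= n)%N) (hF : #|F| = (2 ^ n)%N) :
  (exists B : {set {set option F}},
      simple_design 3 (2 ^ n + 1) 13 lambda B /\ PSL2 F \subset design_aut B)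
  <->
  (exists i66 i78 i143 i429 i572 i858 i1716 : int,
      [/\ 0 <= i66%:Q <= m66 n, 0 <= i78%:Q <= m78 n,
          0 <= i143%:Q <= m143 n & 0 <= i429%:Q <= m429 n] /\
      [/\ 0 <= i572%:Q <= m572 n, 0 <= i858%:Q <= m858 n &
          0 <= i1716%:Q <= m1716 n] /\
      lambda%:Z = 66%:R * i66 + 78%:R * i78 + 143%:R * i143 + 429%:R * i429
                  + 572%:R * i572 + 858%:R * i858 + 1716%:R * i1716).
Proof.
have g0 := cardG_gt0 (PSL2_group F).
have counts := lambda_of_counts lambda g0.
split=> [[Bs [des /stable_familyP BsG]]|].
  have [sB E] := (designP hF lambda BsG).1 des.
  have H := (counts _ _ _ (card_by_order hn hF sB) (fun s => card_family_of s BsG)).1 E.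
  have b s mu : #|orbits_of s (blocks F)|%:R = mu ->
      0 <= (#|orbits_of s Bs|%:Z)%:Q <= mu.
    by move/bound_orbits ->; rewrite lez_nat leq_orbits_of.
  exists #|orbits_of 26 Bs|, #|orbits_of 22 Bs|, #|orbits_of 12 Bs|.
  exists #|orbits_of 4 Bs|, #|orbits_of 3 Bs|, #|orbits_of 2 Bs|, #|orbits_of 1 Bs|.
  split; last split.
  - split; apply: b; [exact: orbits26_m66 | exact: orbits22_m78 | exact: orbits12 | exact: orbits4E].
  - split; apply: b; [exact: orbits3 | exact: orbits2 | exact: orbits1].
  by rewrite H -natz 6!natrD 7!natrM !natz.
move=> [i26 [i22 [i12 [i4 [i3 [i2 [i1 [[b26 b22 b12 b4] [[b3 b2 b1] E]]]]]]]]].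
have [j26 Ej26 l26] := bound_orbitsP (orbits26_m66 hn hF) b26.
have [j22 Ej22 l22] := bound_orbitsP (orbits22_m78 hn hF) b22.
have [j12 Ej12 l12] := bound_orbitsP (orbits12 hn hF) b12.
have [j4 Ej4 l4] := bound_orbitsP (orbits4E hn hF) b4.
have [j3 Ej3 l3] := bound_orbitsP (orbits3 hn hF) b3.
have [j2 Ej2 l2] := bound_orbitsP (orbits2 hn hF) b2.
have [j1 Ej1 l1] := bound_orbitsP (orbits1 hn hF) b1.
pose j s := match s with
  | 1 => j1 | 2 => j2 | 3 => j3 | 4 => j4 | 12 => j12 | 22 => j22 | 26 => j26 | _ => 0
  end%N.
have le_j s : (j s <= #|orbits_of s (blocks F)|)%N by do 27?[case: s => [|s] //].
have [BsG sB c] := family_with_orbitsP le_j.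
exists (family_with_orbits F j); split; last exact/stable_familyP.
apply/(designP hF lambda BsG); split=> //.
apply/(counts _ _ _ (card_by_order hn hF sB) c); apply/eqP.
by rewrite -eqz_nat E Ej26 Ej22 Ej12 Ej4 Ej3 Ej2 Ej1 /= -[X in _ == X]natz 6!natrD 7!natrM !natz.
Qed.
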